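(* Let $G, H$ be topological groups, let $X$ be a Hausdorff space with a $G$-action and let $Y$ be a Hausdorff space with an $H$-action. There is a weak equivalence $$ \mathbb{L}(U^{op})_! \left[ \operatorname{Conf}(-, X) \times \operatorname{Conf}(-, Y) \right] \overset{\sim}{\longrightarrow} \operatorname{Conf}(-, X \times Y) $$ in the category of functors $\mathrm{GI}^{op} \to \mathrm{Top}_{G \times H}$, where $\mathbb{L}(U^{op})_!$ denotes homotopy left Kan extension along $U^{op}\colon \mathrm{GI}_2^{op}\to\mathrm{GI}^{op}$.
   Context: A finite graph $\Gamma=(V,\sim)$ is a finite set $V$ with a graphical relation $\sim$, i.e. a symmetric relation with $v\not\sim v$ for all $v$. A graph injection $(V_1,\sim_1)\to(V_2,\sim_2)$ is an injection $\varphi\colon V_1\hookrightarrow V_2$ with $u\sim_1 v\implies\varphi(u)\sim_2\varphi(v)$. $\mathrm{GI}$ is the category of finite graphs and graph injections. $\mathrm{GI}_2$ has objects triples $(V;\sim',\sim'')$ of a finite set with two graphical relations, and morphisms the injections of vertex sets preserving each relation separately. The functor $U\colon\mathrm{GI}_2\to\mathrm{GI}$ sends $(V;\sim',\sim'')$ to $(V,\sim'\cup\sim'')$, the union of relations as subsets of $V\times V$. For a space $Z$, $\operatorname{Conf}(\Gamma,Z)$ is the space of functions $z\colon V\to Z$ with $z_u\neq z_v$ whenever $u\sim v$ (subspace topology from $Z^V$). A graph injection $\varphi\colon\Gamma_1\to\Gamma_2$ induces $\operatorname{Conf}(\Gamma_2,Z)\to\operatorname{Conf}(\Gamma_1,Z)$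 by precomposition $z\mapsto z\circ\varphi$. $\mathrm{Top}_G$ is the category of spaces with an action of $G$. A group acting on $Z$ acts diagonally on $\operatorname{Conf}(\Gamma,Z)$; $G\times H$ acts on $X\times Y$ factorwise. $\operatorname{Conf}(-,X)\times\operatorname{Conf}(-,Y)\colon\mathrm{GI}_2^{op}\to\mathrm{Top}_{G\times H}$ sends $(V;\sim',\sim'')$ to $\operatorname{Conf}((V,\sim'),X)\times\operatorname{Conf}((V,\sim''),Y)$. A weak equivalence of functors is a natural transformation that is objectwise a weak homotopy equivalence on underlying spaces; homotopy left Kan extension is computed objectwise by $[\mathbb{L}f_!F](d)=\operatorname{hocolim}_{f/d}F$.
   Formalization: Actions are required to be continuous along continuous families in the group indexed by compact Hausdorff spaces (implied by joint continuity, equivalent to it for locally compact Hausdorff groups), since joint continuity can fail for the homotopy left Kan extension, e.g. for the rationals. *)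

(* Defs.v *)
From HB Require Import structures.
From Stdlib Require Import Relation_Operators.
From mathcomp Require Import all_boot all_order all_algebra generic_quotient.
From mathcomp Require Import all_classical all_reals topology normedtype.

Set Implicit Arguments.
Unset Strict Implicit.
Unset Printing Implicit Defensive.

Import Order.TTheory GRing.Theory Num.Theory.
Import numFieldNormedType.Exports.
Local Open Scope classical_set_scope.
Local Open Scope ring_scope.
Local Open Scope quotient_scope.

#[projections(primitive)]
Record category := Category {
  ob :> Type;
  hom : ob -> ob -> Type;
  idm : forall a, hom a a;
  compm : forall a b c, hom b c -> hom a b -> hom a c;
  comp1m : forall a b (f : hom a b), compm (idm b) f = f;
  compm1 : forall a b (f : hom a b), compm f (idm a) = f;
  compmA : forall a b c d (h : hom c d) (g : hom b c) (f : hom a b),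
    compm h (compm g f) = compm (compm h g) f }.
Arguments idm {_} a.
Arguments compm {_ a b c}.

#[projections(primitive)]
Record functor (C D : category) := Functor {
  fob :> C -> D;
  fmap : forall a b, hom a b -> hom (fob a) (fob b);
  fmap1 : forall a, fmap (idm a) = idm (fob a);
  fmapM : forall a b c (g : hom b c) (f : hom a b),
    fmap (compm g f) = compm (fmap g) (fmap f) }.
Arguments fmap {_ _} _ {a b}.

Definition op (C : category) : category :=
  @Category C (fun a b => hom b a) (fun a => idm a)
    (fun a b c g f => compm f g)
    (fun a b f => compm1 f) (fun a b f => comp1m f)
    (fun a b c d h g f => esym (compmA f g h)).

Definition op_functor (C D : category) (F : functor C D) :
    functor (op C) (op D) :=
  @Functor (op C) (op D) F (fun a b f => fmap F f)
    (fun a => fmap1 F a) (fun a b c g f => fmapM F f g).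

Lemma functor_comp_fmap1 (A B C : category) (G : functor B C) (F : functor A B)
  a : fmap G (fmap F (idm a)) = idm (G (F a)).
Proof. by rewrite !fmap1. Qed.

Lemma functor_comp_fmapM (A B C : category) (G : functor B C) (F : functor A B)
  a b c (g : hom b c) (f : hom a b) :
  fmap G (fmap F (compm g f)) = compm (fmap G (fmap F g)) (fmap G (fmap F f)).
Proof. by rewrite !fmapM. Qed.

Definition functor_comp (A B C : category) (G : functor B C) (F : functor A B) :
    functor A C :=
  @Functor A C (fun a => G (F a)) (fun a b f => fmap G (fmap F f))
    (functor_comp_fmap1 G F) (@functor_comp_fmapM _ _ _ G F).

(** The poset [n] = {0 < ... < n}; a functor from [m] to [n] is a monotone
    map, and a functor from [n] to C is an n-simplex of the nerve of C. *)
Definition ordcat (n : nat) : category :=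
  @Category 'I_n.+1 (fun i j => (i <= j)%N) (fun i => leqnn i)
    (fun i j k jk ij => leq_trans ij jk)
    (fun _ _ _ => bool_irrelevance _ _) (fun _ _ _ => bool_irrelevance _ _)
    (fun _ _ _ _ _ _ _ => bool_irrelevance _ _).

Section comma.
Variables (C D : category) (f : functor C D).

#[projections(primitive)]
Record comma_ob (d : D) := CommaOb {
  comma_src : C;
  comma_arr : hom (f comma_src) d }.

#[projections(primitive)]
Record comma_hom (d : D) (o o' : comma_ob d) := CommaHom {
  comma_map : hom (comma_src o) (comma_src o');
  comma_mapP : compm (comma_arr o') (fmap f comma_map) = comma_arr o }.

Lemma comma_hom_eq (d : D) (o o' : comma_ob d) (g h : comma_hom o o') :
  comma_map g = comma_map h -> g = h.
Proof.
case: g h => [g gP] [h hP] /= E; move: gP hP; rewrite E => gP hP.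
by rewrite (Prop_irrelevance gP hP).
Qed.

Lemma comma_idP (d : D) (o : comma_ob d) :
  compm (comma_arr o) (fmap f (idm (comma_src o))) = comma_arr o.
Proof. by rewrite fmap1 compm1. Qed.

Lemma comma_compP (d : D) (o1 o2 o3 : comma_ob d)
  (h : comma_hom o2 o3) (g : comma_hom o1 o2) :
  compm (comma_arr o3) (fmap f (compm (comma_map h) (comma_map g)))
  = comma_arr o1.
Proof. by rewrite fmapM compmA !comma_mapP. Qed.

Definition comma_id (d : D) (o : comma_ob d) : comma_hom o o :=
  CommaHom (comma_idP o).

Definition comma_comp (d : D) (o1 o2 o3 : comma_ob d)
  (h : comma_hom o2 o3) (g : comma_hom o1 o2) : comma_hom o1 o3 :=
  CommaHom (comma_compP h g).

Lemma comma_comp1m (d : D) (o o' : comma_ob d) (g : comma_hom o o') :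
  comma_comp (comma_id o') g = g.
Proof. exact/comma_hom_eq/comp1m. Qed.

Lemma comma_compm1 (d : D) (o o' : comma_ob d) (g : comma_hom o o') :
  comma_comp g (comma_id o) = g.
Proof. exact/comma_hom_eq/compm1. Qed.

Lemma comma_compA (d : D) (o1 o2 o3 o4 : comma_ob d)
  (h : comma_hom o3 o4) (g : comma_hom o2 o3) (k : comma_hom o1 o2) :
  comma_comp h (comma_comp g k) = comma_comp (comma_comp h g) k.
Proof. exact/comma_hom_eq/compmA. Qed.

Definition comma (d : D) : category :=
  Category (@comma_comp1m d) (@comma_compm1 d) (@comma_compA d).

Definition comma_proj (d : D) : functor (comma d) C :=
  @Functor (comma d) C (@comma_src d) (fun o o' g => comma_map g)
    (fun=> erefl) (fun _ _ _ _ _ => erefl).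

Lemma comma_pushP (d d' : D) (u : hom d d') (o o' : comma_ob d)
  (g : comma_hom o o') :
  compm (compm u (comma_arr o')) (fmap f (comma_map g)) = compm u (comma_arr o).
Proof. by rewrite -compmA comma_mapP. Qed.

Definition comma_push_ob (d d' : D) (u : hom d d') (o : comma d) : comma d' :=
  CommaOb (compm u (comma_arr o)).

Definition comma_push_hom (d d' : D) (u : hom d d') (o o' : comma d)
  (g : hom o o') : hom (comma_push_ob u o) (comma_push_ob u o') :=
  @CommaHom d' (comma_push_ob u o) (comma_push_ob u o') (comma_map g)
    (comma_pushP u g).

Lemma comma_push1 (d d' : D) (u : hom d d') (o : comma d) :
  comma_push_hom u (idm o) = idm (comma_push_ob u o).
Proof. exact: comma_hom_eq. Qed.

Lemma comma_pushM (d d' : D) (u : hom d d') (o1 o2 o3 : comma d)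
  (h : hom o2 o3) (g : hom o1 o2) :
  comma_push_hom u (compm h g) = compm (comma_push_hom u h) (comma_push_hom u g).
Proof. exact: comma_hom_eq. Qed.

Definition comma_push (d d' : D) (u : hom d d') :
    functor (comma d) (comma d') :=
  Functor (comma_push1 u) (@comma_pushM _ _ u).

End comma.

HB.mixin Record isTopologicalGroup G of Group G & Topological G := {
  mulg_continuous : continuous (fun p : G * G => p.1 * p.2)%g;
  invg_continuous : continuous (fun x : G => x^-1)%g }.

#[short(type="topologicalGroupType")]
HB.structure Definition TopologicalGroup :=
  {G of isTopologicalGroup G & Group G & Topological G}.

Lemma continuous_pair_fun (T U V : topologicalType) (f : T -> U) (g : T -> V) :
  continuous f -> continuous g -> continuous (fun x => (f x, g x)).
Proof. by move=> cf cg x; apply: cvg_pair; [exact: cf|exact: cg]. Qed.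

Lemma continuous_comp_fun (T U V : topologicalType) (f : T -> U) (g : U -> V) :
  continuous f -> continuous g -> continuous (fun x => g (f x)).
Proof. by move=> cf cg x; apply: continuous_comp; [exact: cf|exact: cg]. Qed.

Lemma fst_continuous (T U : topologicalType) : continuous (@fst T U).
Proof. by move=> x; exact: cvg_fst. Qed.

Lemma snd_continuous (T U : topologicalType) : continuous (@snd T U).
Proof. by move=> x; exact: cvg_snd. Qed.

Section prod_topological_group.
Variables G H : topologicalGroupType.

Let prod_mulg_continuous :
  continuous (fun p : (G * H) * (G * H) => p.1 * p.2)%g.
Proof.
have c11 : continuous (fun p : (G * H) * (G * H) => (p.1.1, p.2.1)).
  by apply: continuous_pair_fun; apply: continuous_comp_fun;
    try exact: fst_continuous; exact: snd_continuous.
have c22 : continuous (fun p : (G * H) * (G * H) => (p.1.2, p.2.2)).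
  by apply: continuous_pair_fun; apply: continuous_comp_fun;
    try exact: snd_continuous; exact: fst_continuous.
exact: (continuous_pair_fun
  (continuous_comp_fun c11 (@mulg_continuous G))
  (continuous_comp_fun c22 (@mulg_continuous H))).
Qed.

Let prod_invg_continuous : continuous (fun p : G * H => p^-1)%g.
Proof.
exact: (continuous_pair_fun
  (continuous_comp_fun (@fst_continuous G H) (@invg_continuous G))
  (continuous_comp_fun (@snd_continuous G H) (@invg_continuous H))).
Qed.

HB.instance Definition _ := isTopologicalGroup.Build (G * H)%type
  prod_mulg_continuous prod_invg_continuous.

End prod_topological_group.

(** Spaces with a K-action. Continuity of the action is the convenient-category
    one: every continuous family of group elements indexed by a compact
    Hausdorff space acts continuously. Jointly continuous actions have this
    property ([gspace_of_joint]), and the two notions agree when K is locally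
    compact Hausdorff ([act_continuous_locally_compact]). For general K, joint
    continuity for the plain product topology is not inherited by homotopy
    colimits: K x - does not preserve quotient maps of topological spaces. *)
Record gspace (K : topologicalGroupType) := GSpace {
  gcarrier :> topologicalType;
  act : K -> gcarrier -> gcarrier;
  act1 : forall z, act 1%g z = z;
  actM : forall g h z, act (g * h)%g z = act g (act h z);
  act_continuous : forall (T : topologicalType) (a : T -> K),
    compact [set: T] -> hausdorff_space T -> continuous a ->
    continuous (fun p : T * gcarrier => act (a p.1) p.2) }.
Arguments act {K} _ _ _.

Section gspace_continuity.
Variables (K : topologicalGroupType) (Z : topologicalType) (m : K -> Z -> Z).

Lemma joint_act_continuous : continuous (fun p : K * Z => m p.1 p.2) ->
  forall (T : topologicalType) (a : T -> K),
    compact [set: T] -> hausdorff_space T -> continuous a ->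
    continuous (fun p : T * Z => m (a p.1) p.2).
Proof.
move=> mc T a _ _ ac.
have := continuous_pair_fun (continuous_comp_fun (@fst_continuous T Z) ac)
  (@snd_continuous T Z).
by move=> /continuous_comp_fun /(_ mc).
Qed.

Definition gspace_of_joint (m1 : forall z, m 1%g z = z)
    (mM : forall g h z, m (g * h)%g z = m g (m h z))
    (mc : continuous (fun p : K * Z => m p.1 p.2)) : gspace K :=
  GSpace m1 mM (joint_act_continuous mc).

End gspace_continuity.

Section gspace_locally_compact.
Variables (K : topologicalGroupType) (Z : gspace K) (N : set K).

Let sub_nbhs (x : N) (U : set N) : nbhs x U ->
  exists2 W : set K, nbhs (set_val x) W & set_val @^-1` W `<=` U.
Proof.
move=> [/= V [[W oW <-] /= Wx] VU]; exists W => //.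
exact: open_nbhs_nbhs.
Qed.

Let sub_compact : compact N -> compact [set: N].
Proof.
move=> cN F FF _; have PF : ProperFilter ((@set_val _ N) @ F).
  exact: fmap_proper_filter.
have FN : ((@set_val _ N) @ F) N.
  by apply: (@filterS _ F _ setT) => [[x xN] _|]; [exact: set_mem|exact: filterT].
have [x [Nx clx]] := cN _ PF FN.
exists (SigSub (mem_set Nx)); split => // A B FA /sub_nbhs[W nW WB].
have FA' : ((@set_val _ N) @ F) (set_val @` A).
  by apply: (@filterS _ F _ A) => [y Ay|//]; exists y.
have [_ [[y Ay <-] Wy]] := clx _ _ FA' nW.
by exists y; split => //; exact: WB.
Qed.

Let sub_hausdorff : hausdorff_space K -> hausdorff_space N.
Proof.
move=> hK x y clxy; apply: val_inj; apply: hK => A B nA nB.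
have cv := @initial_continuous N K set_val.
have [z [Az Bz]] := clxy _ _ (cv x _ nA) (cv y _ nB).
by exists (set_val z).
Qed.

Lemma act_continuous_near k z : compact N -> nbhs k N -> hausdorff_space K ->
  {for (k, z), continuous (fun p : K * Z => act Z p.1 p.2)}.
Proof.
move=> cN nN hK U /= nU.
have xN : k \in N by rewrite inE; exact: nbhs_singleton.
have := @act_continuous _ Z _ _ (sub_compact cN) (sub_hausdorff hK)
  (@initial_continuous N K set_val).
move=> /(_ (SigSub xN, z) U nU) [[A B] /= [/sub_nbhs[W nW WA] nB] ABU].
exists (W `&` N, B) => /=; first by split => //; exact: filterI.
move=> [h w] /= [[Wh Nh] Bw].
exact: (ABU (SigSub (mem_set Nh), w) (conj (WA (SigSub (mem_set Nh)) Wh) Bw)).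
Qed.

End gspace_locally_compact.

Lemma act_continuous_locally_compact (K : topologicalGroupType) (Z : gspace K) :
  locally_compact [set: K] -> hausdorff_space K ->
  continuous (fun p : K * Z => act Z p.1 p.2).
Proof.
move=> lcK hK [k z]; have [N /= Nk [cN _]] := lcK k I.
apply: (@act_continuous_near _ Z N) => //.
by move: Nk; rewrite /within/= ; apply: filterS => x; exact.
Qed.

Section prod_gspace.
Variables (G H : topologicalGroupType) (X : gspace G) (Y : gspace H).

Let pact (g : G * H) (z : X * Y) : X * Y := (act X g.1 z.1, act Y g.2 z.2).

Let pact1 z : pact 1%g z = z.
Proof. by rewrite /pact /= !act1 -surjective_pairing. Qed.

Let pactM g h z : pact (g * h)%g z = pact g (pact h z).
Proof. by rewrite /pact /= !actM. Qed.

Let pact_continuous (T : topologicalType) (a : T -> (G * H)%type) :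
  compact [set: T] -> hausdorff_space T -> continuous a ->
  continuous (fun p : T * (X * Y) => pact (a p.1) p.2).
Proof.
move=> cT hT ac.
have c1 := continuous_comp_fun ac (@fst_continuous G H).
have c2 := continuous_comp_fun ac (@snd_continuous G H).
have p1 : continuous (fun p : T * (X * Y) => (p.1, p.2.1)).
  apply: continuous_pair_fun; first exact: fst_continuous.
  exact: (continuous_comp_fun (@snd_continuous _ _) (@fst_continuous _ _)).
have p2 : continuous (fun p : T * (X * Y) => (p.1, p.2.2)).
  apply: continuous_pair_fun; first exact: fst_continuous.
  exact: (continuous_comp_fun (@snd_continuous _ _) (@snd_continuous _ _)).
exact: (continuous_pair_fun
  (continuous_comp_fun p1 (@act_continuous _ X T _ cT hT c1))
  (continuous_comp_fun p2 (@act_continuous _ Y T _ cT hT c2))).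
Qed.

Definition prod_gspace : gspace (G * H)%type := GSpace pact1 pactM pact_continuous.

End prod_gspace.

Record gmap (K : topologicalGroupType) (Z W : gspace K) := GMap {
  gmap_fun :> Z -> W;
  gmap_continuous : continuous gmap_fun;
  gmap_act : forall g z, gmap_fun (act Z g z) = act W g (gmap_fun z) }.

Record diagram (C : category) (K : topologicalGroupType) := Diagram {
  dob :> C -> gspace K;
  dmap : forall a b, hom a b -> gmap (dob a) (dob b);
  dmap1 : forall a x, dmap (idm a) x = x;
  dmapM : forall a b c (g : hom b c) (f : hom a b) x,
    dmap (compm g f) x = dmap g (dmap f x) }.
Arguments dmap {C K} _ {a b}.

Record nat_trans (C : category) (K : topologicalGroupType) (D E : diagram C K) :=
  NatTrans {
    nt :> forall c, gmap (D c) (E c);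
    nt_natural : forall a b (f : hom a b) x,
      nt b (dmap D f x) = dmap E f (nt a x) }.

Definition diagram_comp (C C' : category) (K : topologicalGroupType)
    (D : diagram C' K) (F : functor C C') : diagram C K.
Proof.
refine (@Diagram C K (fun c => D (F c)) (fun a b f => dmap D (fmap F f)) _ _).
- by move=> a x; rewrite fmap1 dmap1.
- by move=> a b c g f x; rewrite fmapM dmapM.
Defined.


Section simplex.
Variable R : realType.

Definition simplex_set (n : nat) : set {ptws 'I_n.+1 -> R} :=
  [set t | (forall i, 0 <= t i) /\ \sum_(i < n.+1) t i = 1].
Arguments simplex_set : clear implicits.

Definition simplex (n : nat) : topologicalType := set_type (simplex_set n).

Lemma simplex_mapP m n (theta : functor (ordcat m) (ordcat n)) (t : simplex m) :
  (fun j => \sum_(i < m.+1 | theta i == j) set_val t i) \in simplex_set n.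
Proof.
have [t0 t1] := set_valP t; rewrite inE; split=> [j|].
  by apply: sumr_ge0 => i _; exact: t0.
by rewrite -[RHS]t1 (partition_big theta predT).
Qed.

(** The map of simplices sending the i-th vertex to the theta(i)-th one. *)
Definition simplex_map m n (theta : functor (ordcat m) (ordcat n))
    (t : simplex m) : simplex n :=
  SigSub (simplex_mapP theta t).

End simplex.

(** The Bousfield-Kan homotopy colimit: the geometric realization of the
    simplicial space whose n-simplices are the coproduct, over the chains
    sigma(0) -> ... -> sigma(n) in C, of the spaces D(sigma(0)). *)
Section hocolim.
Variables (R : realType) (K : topologicalGroupType) (C : category).

Definition nerve := {classic {n : nat & functor (ordcat n) C}}.
Definition nerve_dim (s : nerve) : nat := projT1 s.
Definition nerve_first (s : nerve) : C := projT2 s ord0.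

Section object.
Variable D : diagram C K.

Definition hocell (s : nerve) : topologicalType :=
  (simplex R (nerve_dim s) * D (nerve_first s))%type.

Definition hocells : topologicalType := {s : nerve & hocell s}.

Definition hocells_pair n (sigma : functor (ordcat n) C) (t : simplex R n)
    (x : D (sigma ord0)) : hocells :=
  existT hocell (existT _ n sigma) (t, x).

(** The coend relation over the simplex category: pushing t forward along
    theta : [m] -> [n] is identified with restricting the chain sigma along
    theta, which replaces its first object by sigma(theta(0)). *)
Inductive hoglue : hocells -> hocells -> Prop :=
  HoGlue m n (theta : functor (ordcat m) (ordcat n))
    (sigma : functor (ordcat n) C) (t : simplex R m) (x : D (sigma ord0)) :
  hoglue (hocells_pair (simplex_map theta t) x)
    (@hocells_pair m (functor_comp sigma theta) t
      (dmap D (@fmap _ _ sigma ord0 (theta ord0) (leq0n (theta ord0))) x)).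

Definition hoequiv (p q : hocells) : bool :=
  `[< clos_refl_sym_trans _ hoglue p q >].

Lemma hoequiv_refl : reflexive hoequiv.
Proof. by move=> p; apply/asboolP; exact: rst_refl. Qed.

Lemma hoequiv_sym : symmetric hoequiv.
Proof.
by move=> p q; apply/idP/idP => /asboolP h; apply/asboolP; exact: rst_sym.
Qed.

Lemma hoequiv_trans : transitive hoequiv.
Proof.
move=> q p r /asboolP pq /asboolP qr; apply/asboolP.
exact: rst_trans pq qr.
Qed.

Canonical hoequiv_equiv : equiv_rel hocells :=
  EquivRel hoequiv hoequiv_refl hoequiv_sym hoequiv_trans.

Definition hocolim_space : topologicalType :=
  quotient_topology {eq_quot hoequiv_equiv}.

Definition hopi (p : hocells) : hocolim_space :=
  \pi_({eq_quot hoequiv_equiv}) p.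

Lemma hopi_eq p q : hopi p = hopi q <-> clos_refl_sym_trans _ hoglue p q.
Proof.
split => [/eqmodP/asboolP //|pq].
by apply/eqmodP/asboolP.
Qed.

Lemma hopi_glue p q : hoglue p q -> hopi p = hopi q.
Proof. by move=> pq; apply/hopi_eq; exact: rst_step. Qed.

Lemma hopi_surj (z : hocolim_space) : exists p, z = hopi p.
Proof. by exists (repr z); rewrite /hopi reprK. Qed.

Lemma hopi_continuous : continuous hopi.
Proof. exact: pi_continuous. Qed.

Lemma hocolim_openP (U : set hocolim_space) : open U <-> open (hopi @^-1` U).
Proof. by []. Qed.

Definition hocolim_lift (T : Type) (f : hocells -> T) (z : hocolim_space) : T :=
  f (repr z).

Lemma hocolim_liftE (T : Type) (f : hocells -> T) :
  (forall p q, hoglue p q -> f p = f q) ->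
  forall p, hocolim_lift f (hopi p) = f p.
Proof.
move=> fglue p; rewrite /hocolim_lift.
have : clos_refl_sym_trans _ hoglue (repr (hopi p)) p.
  by apply/hopi_eq; rewrite /hopi reprK.
by move: (repr _) => q; elim=> [a b /fglue||a b _ ->|a b c _ -> _ ->].
Qed.

End object.
End hocolim.

(** Quotient maps are preserved by products with compact Hausdorff spaces. *)
Lemma hocolim_prod_continuous (R : realType) (K : topologicalGroupType)
    (C : category) (D : diagram C K) (T W : topologicalType)
    (f : T * hocolim_space R D -> W) :
  compact [set: T] -> hausdorff_space T ->
  continuous (fun q : T * hocells R D => f (q.1, hopi q.2)) -> continuous f.
Proof.
move=> cT hT fc [c z] U /=; have [p ->] := hopi_surj z.
rewrite nbhsE => -[O [oO Ocp] OU].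
have Pop q : O (f (q.1, hopi q.2)) ->
    nbhs q [set q' : T * hocells R D | O (f (q'.1, hopi q'.2))].
  by move=> Oq; exact: (fc q O (open_nbhs_nbhs (conj oO Oq))).
have [[A B] /= [nA nB] AB] := Pop (c, p) Ocp.
have [N nN clNA] : filter_from (nbhs c) closure A.
  by apply: (compact_regular hT cT filterT).
pose V := [set y | forall c', closure N c' -> O (f (c', y))].
have cN : compact (closure N).
  by apply: (subclosed_compact _ cT) => //; exact: closed_closure.
have oV : open V.
  apply/hocolim_openP; rewrite openE => q Vq.
  apply: (proj1 (compact_near_coveringP _) cN _ (nbhs q)
    (fun q' c' => O (f (c', hopi q')))) => c' Nc'.
  by have := Pop (c', q) (Vq c' Nc').
exists (N, V) => /=.
  split => //; apply: (@open_nbhs_nbhs (hocolim_space R D)); split => // c' /clNA Ac'.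
  by have /= := AB (c', p); apply; split => //; exact: nbhs_singleton.
move=> [c' y] /= [Nc' Vy]; apply: OU.
by apply: Vy; exact: subset_closure.
Qed.

Section hocolim_gspace.
Variables (R : realType) (K : topologicalGroupType) (C : category).
Variable D : diagram C K.

Let cellact (g : K) (p : hocells R D) : hocells R D :=
  existT (hocell R D) (projT1 p)
    ((projT2 p).1, act (D (nerve_first (projT1 p))) g (projT2 p).2).

Definition hocolim_act (g : K) : hocolim_space R D -> hocolim_space R D :=
  hocolim_lift (fun p => hopi (cellact g p)).

Let hocolim_act_def g p : hocolim_act g (hopi p) = hopi (cellact g p).
Proof.
apply: hocolim_liftE => {}p _ [m n theta sigma t x].
by apply: hopi_glue; rewrite /cellact /= -gmap_act; exact: HoGlue.
Qed.

Lemma hocolim_actE g n (sigma : functor (ordcat n) C) (t : simplex R n)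
    (x : D (sigma ord0)) :
  hocolim_act g (hopi (hocells_pair t x)) =
  hopi (hocells_pair t (act (D (sigma ord0)) g x)).
Proof. exact: hocolim_act_def. Qed.

Lemma hocolim_act1 z : hocolim_act 1%g z = z.
Proof.
have [[[n sigma] [t x]] ->] := hopi_surj z.
by rewrite hocolim_actE act1.
Qed.

Lemma hocolim_actM g h z :
  hocolim_act (g * h)%g z = hocolim_act g (hocolim_act h z).
Proof.
have [[[n sigma] [t x]] ->] := hopi_surj z.
by rewrite !hocolim_actE actM.
Qed.

Lemma hocolim_act_continuous (T : topologicalType) (a : T -> K) :
  compact [set: T] -> hausdorff_space T -> continuous a ->
  continuous (fun p : T * hocolim_space R D => hocolim_act (a p.1) p.2).
Proof.
move=> cT hT ac; apply: hocolim_prod_continuous => //=.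
have -> : (fun q : T * hocells R D => hocolim_act (a q.1) (hopi q.2)) =
          (fun q : T * hocells R D => hopi (cellact (a q.1) q.2)).
  by apply/funext => q; exact: hocolim_act_def.
apply: continuous_comp_fun; last exact: hopi_continuous.
move=> [c [s [t x]]] U [[A B] /= [nA nB] ABU].
have [[P Q] /= [nP nQ] PQB] := @act_continuous _ _ _ _ cT hT ac (c, x) B nB.
exists (P, existT (hocell R D) s @` (A `*` Q)) => /=.
  by split => //; apply: existT_nbhs; exists (A, Q).
move=> [c' _] /= [Pc' [[t' x'] [At' Qx'] <-]] /=.
have Bx' := PQB (c', x') (conj Pc' Qx').
exact: (ABU (t', act (D (nerve_first s)) (a c') x') (conj At' Bx')).
Qed.

Definition hocolim : gspace K :=
  GSpace hocolim_act1 hocolim_actM hocolim_act_continuous.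

End hocolim_gspace.

Lemma functor_irr (A B : category) (o : A -> B)
    (m : forall a b, hom a b -> hom (o a) (o b)) p1 pM q1 qM :
  @Functor A B o m p1 pM = @Functor A B o m q1 qM.
Proof. by rewrite (Prop_irrelevance p1 q1) (Prop_irrelevance pM qM). Qed.

(** Used with [es] and [et] equal to [erefl]: the chains agree only
    propositionally, but the spaces over their first objects are convertible. *)
Lemma hocells_pair_eq (R : realType) (K : topologicalGroupType) (C : category)
    (D : diagram C K) (B : Type) (P : B -> Type) (h : C -> B)
    (j : forall c, P (h c) -> D c)
    n (sigma tau : functor (ordcat n) C) (t : simplex R n)
    (b : B) (es : h (sigma ord0) = b) (et : h (tau ord0) = b) (x : P b) :
  sigma = tau ->
  @hocells_pair _ _ _ D n sigma t (j _ (eq_rect_r P x es)) =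
  @hocells_pair _ _ _ D n tau t (j _ (eq_rect_r P x et)).
Proof. by move=> E; subst tau; rewrite (Prop_irrelevance es et). Qed.

Section hocolim_map.
Variables (R : realType) (K : topologicalGroupType) (C C' : category).
Variables (Phi : functor C C') (D : diagram C K) (D' : diagram C' K).
Variable alpha : nat_trans D (diagram_comp D' Phi).

Let cell_map (p : hocells R D) : hocells R D' :=
  @hocells_pair _ _ _ D' _ (functor_comp Phi (projT2 (projT1 p))) (projT2 p).1
    (alpha (nerve_first (projT1 p)) (projT2 p).2).

Definition hocolim_fun : hocolim_space R D -> hocolim_space R D' :=
  hocolim_lift (fun p => hopi (cell_map p)).

Let hocolim_fun_def p : hocolim_fun (hopi p) = hopi (cell_map p).
Proof.
apply: hocolim_liftE => {}p _ [m n theta sigma t x].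
rewrite /cell_map /=.
set x' := alpha _ _; set y' := alpha _ _.
have -> : y' = dmap D' (@fmap _ _ (functor_comp Phi sigma) ord0 (theta ord0)
  (leq0n (theta ord0))) x' by exact: nt_natural.
rewrite (hopi_glue (@HoGlue R K C' D' m n theta (functor_comp Phi sigma) t x')).
set w := dmap D' _ x'; congr (hopi _).
apply: (@hocells_pair_eq R K C' D' C' (fun c => D' c) id (fun=> id) m
  (functor_comp (functor_comp Phi sigma) theta)
  (functor_comp Phi (functor_comp sigma theta)) t _ erefl erefl w).
exact: functor_irr.
Qed.

Lemma hocolim_funE n (sigma : functor (ordcat n) C) (t : simplex R n)
    (x : D (sigma ord0)) :
  hocolim_fun (hopi (hocells_pair t x)) =
  hopi (@hocells_pair _ _ _ D' n (functor_comp Phi sigma) t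
    (alpha (sigma ord0) x)).
Proof. exact: hocolim_fun_def. Qed.

Lemma hocolim_fun_continuous : continuous hocolim_fun.
Proof.
apply/quotient_continuous.
have -> : hocolim_fun \o \pi_(hocolim_space R D) = (fun p => hopi (cell_map p)).
  by apply/funext => p; exact: hocolim_fun_def.
apply: continuous_comp_fun; last exact: hopi_continuous.
move=> [s [t x]] U [[A B] /= [nA nB] ABU].
exists (A, alpha (nerve_first s) @^-1` B) => /=.
  by split => //; exact: gmap_continuous.
by move=> [t' x'] /= [At' Bx']; exact: (ABU (t', alpha (nerve_first s) x')).
Qed.

Lemma hocolim_fun_act g z :
  hocolim_fun (act (hocolim R D) g z) = act (hocolim R D') g (hocolim_fun z).
Proof.
have [[[n sigma] [t x]] ->] := hopi_surj z.
by rewrite /= hocolim_actE !hocolim_funE hocolim_actE gmap_act.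
Qed.

Definition hocolim_map : gmap (hocolim R D) (hocolim R D') :=
  @GMap K (hocolim R D) (hocolim R D') hocolim_fun hocolim_fun_continuous hocolim_fun_act.

End hocolim_map.

Section hLan.
Variables (R : realType) (K : topologicalGroupType) (C D : category).
Variables (f : functor C D) (X : diagram C K).

Lemma comma_functor_eq (A : category) d (s : A -> C)
    (u v : forall a, hom (f (s a)) d) (m : forall a b, hom a b -> hom (s a) (s b))
    (pu : forall a b (g : hom a b), compm (u b) (fmap f (m a b g)) = u a)
    (pv : forall a b (g : hom a b), compm (v b) (fmap f (m a b g)) = v a)
    p1 pM q1 qM : u = v ->
  @Functor A (comma f d) (fun a => CommaOb (u a))
    (fun a b g => @CommaHom _ _ f d (CommaOb (u a)) (CommaOb (u b)) _ (pu a b g))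
    p1 pM =
  @Functor A (comma f d) (fun a => CommaOb (v a))
    (fun a b g => @CommaHom _ _ f d (CommaOb (v a)) (CommaOb (v b)) _ (pv a b g))
    q1 qM.
Proof.
move=> E; subst v; have E := Prop_irrelevance pu pv; subst pv.
exact: functor_irr.
Qed.

Lemma comma_push_idE d (A : category) (F : functor A (comma f d)) :
  functor_comp (comma_push f (idm d)) F = F.
Proof.
apply: comma_functor_eq; apply/functional_extensionality_dep => a.
exact: comp1m.
Qed.

Lemma comma_push_compE d1 d2 d3 (v : hom d2 d3) (u : hom d1 d2) (A : category)
    (F : functor A (comma f d1)) :
  functor_comp (comma_push f (compm v u)) F =
  functor_comp (comma_push f v) (functor_comp (comma_push f u) F).
Proof.
apply: comma_functor_eq; apply/functional_extensionality_dep => a.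
exact: esym (compmA _ _ _).
Qed.

Definition comma_diagram d : diagram (comma f d) K :=
  diagram_comp X (comma_proj f d).

Definition gmap_id (Z : gspace K) : gmap Z Z :=
  @GMap _ Z Z id (fun x => @cvg_id _ (nbhs x)) (fun _ _ => erefl).

Definition comma_push_diagram d d' (u : hom d d') :
    nat_trans (comma_diagram d) (diagram_comp (comma_diagram d') (comma_push f u)) :=
  @NatTrans _ _ (comma_diagram d)
    (diagram_comp (comma_diagram d') (comma_push f u))
    (fun o => gmap_id (X (comma_src o))) (fun _ _ _ _ => erefl).

Definition hLan_map d d' (u : hom d d') :
    gmap (hocolim R (comma_diagram d)) (hocolim R (comma_diagram d')) :=
  hocolim_map R (comma_push_diagram u).

Lemma hLan_mapE d d' (u : hom d d') n (sigma : functor (ordcat n) (comma f d))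
    (t : simplex R n) (x : X (comma_src (sigma ord0))) :
  hLan_map u (hopi (@hocells_pair _ _ _ (comma_diagram d) n sigma t x)) =
  hopi (@hocells_pair _ _ _ (comma_diagram d') n
    (functor_comp (comma_push f u) sigma) t x).
Proof. exact: hocolim_funE. Qed.

Lemma hLan_map1 d z : hLan_map (idm d) z = z.
Proof.
have [[[n sigma] [t x]] ->] := hopi_surj z.
rewrite (@hLan_mapE _ _ (idm d) n sigma t x).
exact: (f_equal (@hopi R K (comma f d) (comma_diagram d))
  (@hocells_pair_eq R K (comma f d) (comma_diagram d) C (fun c => X c)
  (@comma_src _ _ f d) (fun=> id) n
  (functor_comp (comma_push f (idm d)) sigma) sigma t _ erefl erefl x
  (comma_push_idE sigma))).
Qed.

Lemma hLan_mapM d1 d2 d3 (v : hom d2 d3) (u : hom d1 d2) z :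
  hLan_map (compm v u) z = hLan_map v (hLan_map u z).
Proof.
have [[[n sigma] [t x]] ->] := hopi_surj z.
rewrite (@hLan_mapE _ _ u n sigma t x)
  (@hLan_mapE _ _ v n (functor_comp (comma_push f u) sigma) t x)
  (@hLan_mapE _ _ (compm v u) n sigma t x).
exact: (f_equal (@hopi R K (comma f d3) (comma_diagram d3))
  (@hocells_pair_eq R K (comma f d3) (comma_diagram d3) C
  (fun c => X c)  (@comma_src _ _ f d3) (fun=> id) n
  (functor_comp (comma_push f (compm v u)) sigma)
  (functor_comp (comma_push f v) (functor_comp (comma_push f u) sigma))
  t _ erefl erefl x (comma_push_compE v u sigma))).
Qed.

(** The left derived Kan extension, [L f_! X](d) = hocolim_(f/d) X. *)
Definition hLan : diagram D K := Diagram hLan_map1 hLan_mapM.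

End hLan.

(** Vertex sets are taken in [Set], so that GI and GI_2 are small; every
    finite set is in bijection with such a set. *)
Definition graphical (V : Set) (r : V -> V -> Prop) : Prop :=
  (forall u v, r u v -> r v u) /\ (forall v, ~ r v v).

Record graph := Graph {
  vertex : Set;
  adj : vertex -> vertex -> Prop;
  vertex_finite : finite_set [set: vertex];
  adj_graphical : graphical adj }.

Record graph2 := Graph2 {
  vertex2 : Set;
  adj' : vertex2 -> vertex2 -> Prop;
  adj'' : vertex2 -> vertex2 -> Prop;
  vertex2_finite : finite_set [set: vertex2];
  adj'_graphical : graphical adj';
  adj''_graphical : graphical adj'' }.

Record graph_injection (A B : graph) := GraphInjection {
  gi_fun :> vertex A -> vertex B;
  gi_inj : injective gi_fun;
  gi_adj : forall u v, adj u v -> adj (gi_fun u) (gi_fun v) }.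

Record graph2_injection (A B : graph2) := Graph2Injection {
  gi2_fun :> vertex2 A -> vertex2 B;
  gi2_inj : injective gi2_fun;
  gi2_adj' : forall u v, adj' u v -> adj' (gi2_fun u) (gi2_fun v);
  gi2_adj'' : forall u v, adj'' u v -> adj'' (gi2_fun u) (gi2_fun v) }.

Lemma graph_injection_eq (A B : graph) (f g : graph_injection A B) :
  (f : _ -> _) = g -> f = g.
Proof.
case: f g => [f fi fa] [g gi ga] /= E; subst g.
by rewrite (Prop_irrelevance fi gi) (Prop_irrelevance fa ga).
Qed.

Lemma graph2_injection_eq (A B : graph2) (f g : graph2_injection A B) :
  (f : _ -> _) = g -> f = g.
Proof.
case: f g => [f fi f1 f2] [g gi g1 g2] /= E; subst g.
by rewrite (Prop_irrelevance fi gi) (Prop_irrelevance f1 g1)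
  (Prop_irrelevance f2 g2).
Qed.

Definition gi_id (A : graph) : graph_injection A A :=
  @GraphInjection A A id (@inj_id _) (fun _ _ uv => uv).

Definition gi_comp (A B C : graph) (g : graph_injection B C)
    (f : graph_injection A B) : graph_injection A C :=
  @GraphInjection A C (g \o f) (inj_comp (@gi_inj _ _ g) (@gi_inj _ _ f))
    (fun u v uv => gi_adj g (gi_adj f uv)).

Definition gi2_id (A : graph2) : graph2_injection A A :=
  @Graph2Injection A A id (@inj_id _) (fun _ _ uv => uv) (fun _ _ uv => uv).

Definition gi2_comp (A B C : graph2) (g : graph2_injection B C)
    (f : graph2_injection A B) : graph2_injection A C :=
  @Graph2Injection A C (g \o f) (inj_comp (@gi2_inj _ _ g) (@gi2_inj _ _ f))
    (fun u v uv => gi2_adj' g (gi2_adj' f uv))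
    (fun u v uv => gi2_adj'' g (gi2_adj'' f uv)).

Definition GI : category :=
  @Category graph graph_injection gi_id gi_comp
    (fun A B f => @graph_injection_eq A B (gi_comp (gi_id B) f) f erefl)
    (fun A B f => @graph_injection_eq A B (gi_comp f (gi_id A)) f erefl)
    (fun A B C D h g f => @graph_injection_eq A D
       (gi_comp h (gi_comp g f)) (gi_comp (gi_comp h g) f) erefl).

Definition GI2 : category :=
  @Category graph2 graph2_injection gi2_id gi2_comp
    (fun A B f => @graph2_injection_eq A B (gi2_comp (gi2_id B) f) f erefl)
    (fun A B f => @graph2_injection_eq A B (gi2_comp f (gi2_id A)) f erefl)
    (fun A B C D h g f => @graph2_injection_eq A D
       (gi2_comp h (gi2_comp g f)) (gi2_comp (gi2_comp h g) f) erefl).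

Definition graph_l (A : graph2) : graph :=
  Graph (vertex2_finite A) (adj'_graphical A).

Definition graph_r (A : graph2) : graph :=
  Graph (vertex2_finite A) (adj''_graphical A).

Lemma graphical_union (A : graph2) :
  graphical (fun u v : vertex2 A => adj' u v \/ adj'' u v).
Proof.
have [[s' i'] [s'' i'']] := (adj'_graphical A, adj''_graphical A).
by split=> [u v [/s'|/s'']|v [/i'|/i'']]; [left|right| |].
Qed.

Definition graph_union (A : graph2) : graph :=
  Graph (vertex2_finite A) (graphical_union A).

Definition gi_l (A B : graph2) (f : graph2_injection A B) :
    graph_injection (graph_l A) (graph_l B) :=
  @GraphInjection (graph_l A) (graph_l B) f (@gi2_inj _ _ f) (@gi2_adj' _ _ f).

Definition gi_r (A B : graph2) (f : graph2_injection A B) :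
    graph_injection (graph_r A) (graph_r B) :=
  @GraphInjection (graph_r A) (graph_r B) f (@gi2_inj _ _ f) (@gi2_adj'' _ _ f).

Lemma gi_union_adj (A B : graph2) (f : graph2_injection A B)
    (u v : vertex (graph_union A)) :
  adj u v -> @adj (graph_union B) (f u) (f v).
Proof. by case=> [/(gi2_adj' f)|/(gi2_adj'' f)]; [left|right]. Qed.

Definition gi_union (A B : graph2) (f : graph2_injection A B) :
    graph_injection (graph_union A) (graph_union B) :=
  @GraphInjection (graph_union A) (graph_union B) f (@gi2_inj _ _ f)
    (@gi_union_adj _ _ f).

Definition union_functor : functor GI2 GI :=
  @Functor GI2 GI graph_union gi_union
    (fun A => @graph_injection_eq (graph_union A) (graph_union A)
       (gi_union (gi2_id A)) (gi_id _) erefl)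
    (fun A B C g f => @graph_injection_eq (graph_union A) (graph_union C)
       (gi_union (gi2_comp g f)) (gi_comp (gi_union g) (gi_union f)) erefl).

Definition conf_set (A : graph) (Z : topologicalType) :
    set {ptws vertex A -> Z} :=
  [set z | forall u v, adj u v -> z u <> z v].
Arguments conf_set : clear implicits.

Definition conf (A : graph) (Z : topologicalType) : topologicalType :=
  set_type (conf_set A Z).

Lemma ptws_eval_continuous (V : Type) (Z : topologicalType) (v : V) :
  continuous (fun z : {ptws V -> Z} => z v).
Proof.
move=> z; have /cvg_sup/(_ v) := @cvg_id _ (nbhs z).
move=> h W nW.
exact: (h _ (@initial_continuous _ _ (fun f : V -> Z => f v) z W nW)).
Qed.

Lemma ptws_continuous (T Z : topologicalType) (V : Type) (f : T -> V -> Z) :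
  (forall v, continuous (f^~ v)) -> continuous (f : T -> {ptws V -> Z}).
Proof.
move=> fc t; apply/cvg_sup => v W [W' [[Q oQ <-] /= Qt] QW].
by apply: filterS QW _; exact: (fc v t Q (open_nbhs_nbhs (conj oQ Qt))).
Qed.

Lemma set_type_continuous (T Z : topologicalType) (A : set Z) (f : T -> A) :
  continuous (fun t => set_val (f t)) -> continuous f.
Proof.
move=> fc t W [W' [[Q oQ <-] /= Qt] QW].
by apply: filterS QW _; exact: (fc t Q (open_nbhs_nbhs (conj oQ Qt))).
Qed.

Lemma conf_eval_continuous (A : graph) (Z : topologicalType) (v : vertex A) :
  continuous (fun z : conf A Z => set_val z v).
Proof.
exact: (continuous_comp_fun (@initial_continuous (conf_set A Z) _ set_val)
  (@ptws_eval_continuous (vertex A) Z v)).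
Qed.

Lemma conf_continuous (T : topologicalType) (A : graph) (Z : topologicalType)
    (f : T -> conf A Z) :
  (forall v, continuous (fun t => set_val (f t) v)) -> continuous f.
Proof.
by move=> fc; apply: set_type_continuous; exact: ptws_continuous.
Qed.

Lemma conf_eq (A : graph) (Z : topologicalType) (z w : conf A Z) :
  (forall v, set_val z v = set_val w v) -> z = w.
Proof. by move=> zw; apply: val_inj; apply/funext. Qed.

Section conf_gspace.
Variables (K : topologicalGroupType) (A : graph) (Z : gspace K).

Lemma conf_actP (g : K) (z : conf A Z) :
  (fun v => act Z g (set_val z v)) \in conf_set A Z.
Proof.
rewrite inE => u v uv E; have zP : conf_set A Z (set_val z) := set_valP z.
apply: (zP u v uv).
by rewrite -[LHS](@act1 _ Z) -[RHS](@act1 _ Z) -(mulVg g) !actM E.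
Qed.

Definition conf_act (g : K) (z : conf A Z) : conf A Z :=
  SigSub (conf_actP g z).

Lemma conf_act1 z : conf_act 1%g z = z.
Proof. by apply: conf_eq => v; exact: act1. Qed.

Lemma conf_actM g h z : conf_act (g * h)%g z = conf_act g (conf_act h z).
Proof. by apply: conf_eq => v; exact: actM. Qed.

Lemma conf_act_continuous (T : topologicalType) (a : T -> K) :
  compact [set: T] -> hausdorff_space T -> continuous a ->
  continuous (fun p : T * conf A Z => conf_act (a p.1) p.2).
Proof.
move=> cT hT ac; apply: conf_continuous => v /=.
have c : continuous (fun p : T * conf A Z => (p.1, set_val p.2 v)).
  apply: continuous_pair_fun; first exact: fst_continuous.
  exact: (continuous_comp_fun (@snd_continuous _ _) (@conf_eval_continuous A Z v)).
exact: (continuous_comp_fun c (@act_continuous _ Z T a cT hT ac)).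
Qed.

Definition conf_gspace : gspace K :=
  GSpace conf_act1 conf_actM conf_act_continuous.

End conf_gspace.

Section conf_diagram.
Variables (K : topologicalGroupType) (Z : gspace K).

Lemma conf_mapP (A B : graph) (f : graph_injection A B) (z : conf B Z) :
  (set_val z \o f) \in conf_set A Z.
Proof. by rewrite inE => u v /(gi_adj f); exact: ((set_valP z : conf_set B Z (set_val z)) _ _). Qed.

Definition conf_fun (A B : graph) (f : graph_injection A B) (z : conf B Z) :
  conf A Z := SigSub (conf_mapP f z).

Lemma conf_fun_continuous (A B : graph) (f : graph_injection A B) :
  continuous (conf_fun f).
Proof. by apply: conf_continuous => v; exact: conf_eval_continuous. Qed.

Lemma conf_fun_act (A B : graph) (f : graph_injection A B) g z :
  conf_fun f (act (conf_gspace B Z) g z) = act (conf_gspace A Z) g (conf_fun f z).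
Proof. exact: conf_eq. Qed.

Definition conf_map (A B : graph) (f : graph_injection A B) :
    gmap (conf_gspace B Z) (conf_gspace A Z) :=
  @GMap K (conf_gspace B Z) (conf_gspace A Z) (conf_fun f)
    (@conf_fun_continuous A B f) (@conf_fun_act A B f).

Lemma conf_map1 (A : graph) z : conf_map (gi_id A) z = z.
Proof. exact: conf_eq. Qed.

Lemma conf_mapM (A B C : graph) (g : graph_injection C B)
    (f : graph_injection B A) z :
  conf_map (gi_comp f g) z = conf_map g (conf_map f z).
Proof. exact: conf_eq. Qed.

Definition conf_diagram : diagram (op GI) K :=
  @Diagram (op GI) K (fun A => conf_gspace A Z) (fun A B f => conf_map f)
    conf_map1 conf_mapM.

End conf_diagram.

Definition prod_gmap (G H : topologicalGroupType) (X X' : gspace G)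
    (Y Y' : gspace H) (f : gmap X X') (g : gmap Y Y') :
    gmap (prod_gspace X Y) (prod_gspace X' Y') :=
  @GMap _ (prod_gspace X Y) (prod_gspace X' Y') (fun p => (f p.1, g p.2))
    (continuous_pair_fun
      (continuous_comp_fun (@fst_continuous X Y) (@gmap_continuous _ _ _ f))
      (continuous_comp_fun (@snd_continuous X Y) (@gmap_continuous _ _ _ g)))
    (fun k p => f_equal2 pair (gmap_act f k.1 p.1) (gmap_act g k.2 p.2)).

Section conf_prod_diagram.
Variables (G H : topologicalGroupType) (X : gspace G) (Y : gspace H).

Definition conf_prod_ob (A : graph2) : gspace (G * H)%type :=
  prod_gspace (conf_gspace (graph_l A) X) (conf_gspace (graph_r A) Y).

Definition conf_prod_map (A B : graph2) (f : graph2_injection A B) :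
    gmap (conf_prod_ob B) (conf_prod_ob A) :=
  prod_gmap (conf_map X (gi_l f)) (conf_map Y (gi_r f)).

Lemma conf_prod_map1 (A : graph2) z : conf_prod_map (gi2_id A) z = z.
Proof. by case: z => x y; congr pair; exact: conf_eq. Qed.

Lemma conf_prod_mapM (A B C : graph2) (g : graph2_injection C B)
    (f : graph2_injection B A) z :
  conf_prod_map (gi2_comp f g) z = conf_prod_map g (conf_prod_map f z).
Proof. by case: z => x y; congr pair; exact: conf_eq. Qed.

Definition conf_prod_diagram : diagram (op GI2) (G * H)%type :=
  @Diagram (op GI2) (G * H)%type conf_prod_ob
    (fun A B f => conf_prod_map f) conf_prod_map1 conf_prod_mapM.

End conf_prod_diagram.

Section weak_equivalence.
Variable R : realType.

Definition unit_interval : topologicalType := set_type `[(0 : R), 1]%classic.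

Definition cube_set (n : nat) : set {ptws 'I_n -> R} :=
  [set s | forall i, 0 <= s i <= 1].
Arguments cube_set : clear implicits.

Definition cube (n : nat) : topologicalType := set_type (cube_set n).

Definition cube_boundary (n : nat) : set (cube n) :=
  [set s | exists i, set_val s i = 0 \/ set_val s i = 1].

Section homotopy_sets.
Variable Z : topologicalType.

Definition path_component (z : Z) : set Z :=
  [set w | exists p : unit_interval -> Z,
    [/\ continuous p, forall t, set_val t = 0 -> p t = z
      & forall t, set_val t = 1 -> p t = w]].

Definition pi0 : set (set Z) := [set path_component z | z in setT].

Definition spheroid n (z : Z) : set (cube n -> Z) :=
  [set a | continuous a /\ forall s, cube_boundary s -> a s = z].
Arguments spheroid : clear implicits.

Definition spheroid_homotopic n (z : Z) (a b : cube n -> Z) : Prop :=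
  exists h : unit_interval * cube n -> Z,
    [/\ continuous h,
      forall t s, set_val t = 0 -> h (t, s) = a s,
      forall t s, set_val t = 1 -> h (t, s) = b s
    & forall t s, cube_boundary s -> h (t, s) = z].

Definition spheroid_class n (z : Z) (a : cube n -> Z) : set (cube n -> Z) :=
  [set b | spheroid n z b /\ spheroid_homotopic z a b].

(** Only used for n > 0; [pi0] above needs no base point, hence also compares
    empty spaces correctly. *)
Definition pi_ n (z : Z) : set (set (cube n -> Z)) :=
  [set spheroid_class z a | a in spheroid n z].
Arguments pi_ : clear implicits.

End homotopy_sets.
Arguments spheroid {Z} n z.
Arguments pi_ {Z} n z.

Section induced.
Variables (Z W : topologicalType) (f : Z -> W).

(** The unions are over representatives, all of which give the same class. *)
Definition pi0_map (P : set Z) : set W :=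
  \bigcup_(z in P) path_component (f z).

Definition pi_map n (z : Z) (P : set (cube n -> Z)) : set (cube n -> W) :=
  \bigcup_(a in P) spheroid_class (f z) (f \o a).

Definition weak_homotopy_equivalence : Prop :=
  [/\ continuous f,
      set_bij (@pi0 Z) (@pi0 W) pi0_map
    & forall (n : nat) (z : Z), (0 < n)%N ->
        set_bij (pi_ n z) (pi_ n (f z)) (@pi_map n z)].

End induced.
End weak_equivalence.

Definition weak_equivalence (R : realType) (C : category)
    (K : topologicalGroupType) (D E : diagram C K) (eta : nat_trans D E) : Prop :=
  forall c, weak_homotopy_equivalence R (eta c).

(* Main.v *)
(** Fix a graph with vertex set V and write B for its configuration space in
    X x Y. Over a configuration z, put on each edge uv a weight in [0, 1] that is
    positive only if the X-coordinates of z differ at u and v, and less than 1 only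
    if the Y-coordinates differ. These weighted configurations form a space T over
    B, and by Tietze's theorem (X and Y are Hausdorff, cubes are normal) every
    relative lifting problem for a cube and its boundary against T -> B is solvable.

    The homotopy colimit E maps to T over B: a point of a simplex on a chain of
    pairs of relations weighs each edge by the share of the mass at which it
    belongs to the first relation. Conversely a weighted configuration gives,
    through the superlevel sets of its weights at finitely many thresholds, a chain
    of pairs of relations, hence a point of E. The composite E -> T -> E is
    homotopic to the identity over B, in two steps: pull every object over the
    graph back to V (a natural transformation, hence a homotopy), then move
    linearly inside the simplex of the pulled back chain. Gluing a lift to T with
    the trace of this homotopy on a collar of the cube solves relative lifting
    problems against E -> B up to reparametrization of the cube, which is enough
    for the bijections on all homotopy groups and on path components. *)

From mathcomp Require Import all_boot all_order all_algebra.
From mathcomp Require Import all_classical all_reals topology normedtype numfun.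
From mathcomp Require Import lra zify.
Require Import Defs.

Set Implicit Arguments.
Unset Strict Implicit.
Unset Printing Implicit Defensive.

Import Order.TTheory GRing.Theory Num.Theory.
Import numFieldNormedType.Exports.
Local Open Scope classical_set_scope.
Local Open Scope ring_scope.

(** * Pasting and real-valued functions *)

(** The covers of the edges by two relations that a configuration admits change from one
    configuration to the next, so in general [E -> B] is not locally trivial. Weights turn this
    discrete choice into a convex one: over a configuration each edge may use one endpoint of [0, 1]
    or the whole interval, and lifting becomes extension of real functions.

    The way back from [T] to [E] meets two obstacles. The superlevel covers jump when a weight
    crosses a threshold; the barycentric coordinate of a threshold is therefore built from its
    distances to all the values [w] and [1 - w], and vanishes exactly at such ties, where the jump
    becomes invisible in the realization. Moreover, for a point coming from a chain of covers, the
    superlevel covers have to be members of that same chain, or no linear motion would be possible.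
    This is why a cover gives an edge weight 1, 1/2 or 0, and why thresholds come in pairs [a] and
    [1 - a] with [a <= 1 / 2]: the superlevel cover at [a] is then the member of the chain at which
    the cumulative mass reaches [2 * a]. *)

Section pasting.
Variables (X Y : topologicalType).

Lemma within_continuous_eq (A : set X) (f g : X -> Y) :
  (forall x, A x -> f x = g x) -> {within A, continuous f} ->
  {within A, continuous g}.
Proof.
by move=> fg; apply: subspace_eq_continuous => x /set_mem; exact: fg.
Qed.

Lemma within_continuous_comp (Z : topologicalType) (A : set X) (B : set Y)
    (f : X -> Y) (g : Y -> Z) :
  {within A, continuous f} -> {within B, continuous g} ->
  (forall x, A x -> B (f x)) -> {within A, continuous (g \o f)}.
Proof.
move=> /subspace_continuousP fc /subspace_continuousP gc AB.
apply/subspace_continuousP => x Ax U nU /=.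
have := fc x Ax _ (gc _ (AB x Ax) U nU).
by rewrite /= /within /= !nbhs_simpl /=; apply: filterS => y; auto.
Qed.

Lemma continuous_within (A : set X) (f : X -> Y) :
  continuous f -> {within A, continuous f}.
Proof. exact: continuous_subspaceT. Qed.

(** Near [x] only the members through [x] matter: each of the others is closed and misses a
    neighbourhood of [x], and there are finitely many of them. *)
Lemma paste_continuous (I : finType) (F : I -> set X) (f : X -> Y) :
  (forall i, closed (F i)) -> (forall x, exists i, F i x) ->
  (forall i, {within F i, continuous f}) -> continuous f.
Proof.
move=> Fcl Fcov fc x U nU.
have : \forall y \near x, forall i, F i y -> U (f y).
  apply: filter_forall => i.
  have [Fx|Fx] := pselect (F i x); last first.
    have oC : open (~` F i) by exact/closed_openC.
    by apply: filterS (open_nbhs_nbhs (conj oC Fx)) => y /= nF /nF.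
  by have /subspace_continuousP/(_ x Fx U nU) := fc i.
by apply: filterS => y FU; have [i] := Fcov y; exact: FU.
Qed.

Lemma paste2_continuous (A B : set X) (f : X -> Y) :
  closed A -> closed B -> (forall x, A x \/ B x) ->
  {within A, continuous f} -> {within B, continuous f} -> continuous f.
Proof.
move=> cA cB AB fA fB; apply: (@paste_continuous _ (fun b : bool => if b then A else B)).
- by case.
- by move=> x; have [?|?] := AB x; [exists true|exists false].
- by case.
Qed.

End pasting.

(** This is where the Hausdorff hypotheses on the two spaces will enter: the loci where two adjacent
    vertices share a coordinate, hence where a weight is forced, are closed. *)
Lemma closed_preimage_eq (X Y : topologicalType) (f g : X -> Y) :
  hausdorff_space Y -> continuous f -> continuous g -> closed [set x | f x = g x].
Proof.
move=> hY fc gc; rewrite -[X in closed X]setCK; apply: open_closedC.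
rewrite openE => x /= /eqP nfg; move: hY; rewrite open_hausdorff.
move=> /(_ _ _ nfg)[[P Q] /= [/set_mem fP /set_mem gQ] [oP oQ PQ]].
have nP := fc x P (open_nbhs_nbhs (conj oP fP)).
have nQ := gc x Q (open_nbhs_nbhs (conj oQ gQ)).
have : nbhs x (f @^-1` P `&` g @^-1` Q) by exact: filterI.
apply: filterS => y /= [Py Qy] E.
have : (P `&` Q) (f y) by split => //; rewrite E.
by rewrite (eqP PQ).
Qed.

Section real_continuity.
Variables (R : realType) (X : topologicalType).
Implicit Types f g : X -> R.

Lemma continuous_addr f g : continuous f -> continuous g ->
  continuous (fun x => f x + g x).
Proof. by move=> fc gc x; exact: (@cvgD R R^o X (nbhs x) _ f g _ _ (fc x) (gc x)). Qed.

Lemma continuous_oppr f : continuous f -> continuous (fun x => - f x).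
Proof. by move=> fc x; exact: (@cvgN R R^o X (nbhs x) _ f _ (fc x)). Qed.

Lemma continuous_subr f g : continuous f -> continuous g ->
  continuous (fun x => f x - g x).
Proof. by move=> fc gc; apply: continuous_addr => //; exact: continuous_oppr. Qed.

Lemma continuous_mulr f g : continuous f -> continuous g ->
  continuous (fun x => f x * g x).
Proof. by move=> fc gc x; exact: (@cvgM R X (nbhs x) _ f g _ _ (fc x) (gc x)). Qed.

Lemma continuous_invr f : (forall x, f x != 0) -> continuous f ->
  continuous (fun x => (f x)^-1).
Proof. by move=> f0 fc x; apply: cvgV => //; exact: fc. Qed.

Lemma continuous_normr f : continuous f -> continuous (fun x => `|f x|).
Proof. by move=> fc x; exact: (@cvg_norm R R^o X (nbhs x) _ f _ (fc x)). Qed.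

Lemma continuous_cst (Y : topologicalType) (y : Y) : continuous (fun _ : X => y).
Proof. by move=> x; exact: cvg_cst. Qed.

Lemma continuous_maxr f g : continuous f -> continuous g ->
  continuous (fun x => Num.max (f x) (g x)).
Proof.
move=> fc gc; have -> : (fun x => Num.max (f x) (g x)) =
    (fun x => (f x + g x + `|f x - g x|) / 2).
  by apply/funext => x; exact: maxr_absE.
apply: continuous_mulr; last exact: continuous_cst.
apply: continuous_addr; first exact: continuous_addr.
by apply: continuous_normr; exact: continuous_subr.
Qed.

Lemma continuous_minr f g : continuous f -> continuous g ->
  continuous (fun x => Num.min (f x) (g x)).
Proof.
move=> fc gc; have -> : (fun x => Num.min (f x) (g x)) =
    (fun x => (f x + g x - `|f x - g x|) / 2).
  by apply/funext => x; exact: minr_absE.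
apply: continuous_mulr; last exact: continuous_cst.
apply: continuous_subr; first exact: continuous_addr.
by apply: continuous_normr; exact: continuous_subr.
Qed.

Lemma continuous_sumr (I : Type) (r : seq I) (P : pred I) (F : I -> X -> R) :
  (forall i, continuous (F i)) -> continuous (fun x => \sum_(i <- r | P i) F i x).
Proof.
move=> Fc; elim: r => [|i r IH].
  under eq_fun do rewrite big_nil; exact: continuous_cst.
under eq_fun do rewrite big_cons.
by case: (P i) => //; exact: continuous_addr.
Qed.

Lemma continuous_prodr (I : Type) (r : seq I) (P : pred I) (F : I -> X -> R) :
  (forall i, continuous (F i)) -> continuous (fun x => \prod_(i <- r | P i) F i x).
Proof.
move=> Fc; elim: r => [|i r IH].
  under eq_fun do rewrite big_nil; exact: continuous_cst.
under eq_fun do rewrite big_cons.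
by case: (P i) => //; exact: continuous_mulr.
Qed.

Lemma closed_le_continuous f g : continuous f -> continuous g ->
  closed [set x | f x <= g x].
Proof.
move=> fc gc; have -> : [set x | f x <= g x] = (fun x => g x - f x) @^-1` [set y | 0 <= y].
  by apply/seteqP; split => x /=; rewrite subr_ge0.
by apply: preimage_closed => [x _|]; [exact: continuous_subr|exact: closed_ge].
Qed.

Lemma closed_eq_continuous f g : continuous f -> continuous g ->
  closed [set x | f x = g x].
Proof. exact/closed_preimage_eq/Rhausdorff. Qed.

End real_continuity.

Lemma set_val_continuous (Z : topologicalType) (A : set Z) :
  continuous (fun z : A => set_val z).
Proof. exact: initial_continuous. Qed.

(** * Cubes *)

Section set_type_topology.
Variables (Z : topologicalType) (A : set Z).

Lemma set_type_compact : compact A -> compact [set: A].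
Proof.
move=> cA F FF _.
have FA : ((@set_val Z A) @ F) A.
  by apply: (@filterS _ F _ setT) => [a _|]; [exact: set_valP|exact: filterT].
have [x [Ax clx]] := cA _ (fmap_proper_filter (@set_val Z A) FF) FA.
exists (SigSub (mem_set Ax)); split => // P Q FP [_ [[W oW <-] /= Wx] WQ].
have FP' : ((@set_val Z A) @ F) (set_val @` P).
  by apply: (@filterS _ F _ P) => // a Pa; exists a.
have [_ [[a Pa <-] Wa]] := clx _ _ FP' (open_nbhs_nbhs (conj oW Wx)).
by exists a; split => //; exact: WQ.
Qed.

Lemma set_type_hausdorff : hausdorff_space Z -> hausdorff_space A.
Proof.
move=> hZ x y clxy; apply: val_inj; apply: hZ => P Q nP nQ.
have [z [Pz Qz]] := clxy _ _ (set_val_continuous nP) (set_val_continuous nQ).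
by exists (set_val z).
Qed.

End set_type_topology.

Section cubes.
Variable R : realType.

Lemma unit_intervalP (s : unit_interval R) : 0 <= set_val s <= 1.
Proof. by have := set_valP s; rewrite /= in_itv. Qed.

Lemma unit_interval_mem (x : R) : 0 <= x <= 1 -> x \in `[(0 : R), 1]%classic.
Proof. by move=> x01; rewrite inE /= in_itv. Qed.

Definition unit_pt (x : R) (x01 : 0 <= x <= 1) : unit_interval R :=
  SigSub (unit_interval_mem x01).

Lemma unit_ptE x (x01 : 0 <= x <= 1) : set_val (unit_pt x01) = x.
Proof. by []. Qed.

Lemma unit_interval_eq (s t : unit_interval R) : set_val s = set_val t -> s = t.
Proof. exact: val_inj. Qed.

Lemma unit_interval_compact : compact [set: unit_interval R].
Proof. by apply: set_type_compact; exact: segment_compact. Qed.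

Lemma unit_interval_hausdorff : hausdorff_space (unit_interval R).
Proof. exact/set_type_hausdorff/Rhausdorff. Qed.

Lemma unit_val_continuous (Z : topologicalType) (f : Z -> unit_interval R) :
  continuous f -> continuous (fun z => set_val (f z) : R).
Proof. by move=> fc; exact: (continuous_comp_fun fc (@set_val_continuous _ _)). Qed.

Definition unit0 := unit_pt (introT andP (conj (lexx 0) (@ler01 R))).
Definition unit1 := unit_pt (introT andP (conj (@ler01 R) (lexx 1))).

Lemma unit_opp_subproof (s : unit_interval R) : 0 <= 1 - set_val s <= 1.
Proof. by have := unit_intervalP s; lra. Qed.
Definition unit_opp s := unit_pt (unit_opp_subproof s).

Lemma unit_opp_continuous : continuous unit_opp.
Proof.
apply: set_type_continuous; apply: continuous_subr; first exact: continuous_cst.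
exact: set_val_continuous.
Qed.

Lemma unit_clamp_subproof (x : R) : 0 <= Num.max 0 (Num.min 1 x) <= 1.
Proof. by rewrite le_max lexx /= ge_max ler01 ge_min lexx. Qed.
Definition unit_clamp x := unit_pt (unit_clamp_subproof x).

Lemma unit_clamp_val x : set_val (unit_clamp x) = Num.max 0 (Num.min 1 x).
Proof. by []. Qed.

Lemma unit_clampE x : 0 <= x <= 1 -> set_val (unit_clamp x) = x.
Proof. by move=> /andP[x0 x1]; rewrite unit_clamp_val min_r// max_r. Qed.

Lemma unit_clamp0 x : x <= 0 -> unit_clamp x = unit0.
Proof.
move=> x0; apply: unit_interval_eq; rewrite unit_clamp_val /=.
by rewrite min_r ?max_l// (le_trans x0).
Qed.

Lemma unit_clamp1 x : 1 <= x -> unit_clamp x = unit1.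
Proof. by move=> x1; apply: unit_interval_eq; rewrite unit_clamp_val min_l// max_r. Qed.

Lemma unit_clamp_continuous (Z : topologicalType) (f : Z -> R) :
  continuous f -> continuous (fun z => unit_clamp (f z)).
Proof.
move=> fc; apply: set_type_continuous => /=.
apply: continuous_maxr; first exact: continuous_cst.
by apply: continuous_minr => //; exact: continuous_cst.
Qed.

Section cube.
Variable n : nat.

Lemma cubeP (x : cube R n) i : 0 <= set_val x i <= 1.
Proof. exact: (set_valP x : cube_set _). Qed.

Lemma cube_mem (f : 'I_n -> R) : (forall i, 0 <= f i <= 1) -> f \in @cube_set R n.
Proof. by move=> f01; rewrite inE. Qed.

Definition cube_pt (f : 'I_n -> R) f01 : cube R n := SigSub (@cube_mem f f01).

Lemma cube_ptE (f : 'I_n -> R) f01 i : set_val (@cube_pt f f01) i = f i.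
Proof. by []. Qed.

Lemma cube_eq (x y : cube R n) : (forall i, set_val x i = set_val y i) -> x = y.
Proof. by move=> xy; apply: val_inj; apply/funext. Qed.

Lemma cube_compact : compact [set: cube R n].
Proof.
apply: set_type_compact.
have := @tychonoff 'I_n (fun=> R) (fun=> `[(0 : R), 1]%classic)
  (fun=> @segment_compact R 0 1).
by congr compact; apply/seteqP; split => f /= + i => /(_ i); rewrite in_itv.
Qed.

Lemma cube_hausdorff : hausdorff_space (cube R n).
Proof.
apply: set_type_hausdorff; apply: (@hausdorff_product 'I_n (fun=> R)) => _.
exact: Rhausdorff.
Qed.

Lemma cube_normal : normal_space (cube R n).
Proof. by apply: compact_normal; [exact: cube_hausdorff|exact: cube_compact]. Qed.

Lemma cube_coord_continuous i : continuous (fun x : cube R n => set_val x i : R).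
Proof.
exact: (continuous_comp_fun (@set_val_continuous _ _)
  (@ptws_eval_continuous 'I_n R i)).
Qed.

Lemma cube_continuous (Z : topologicalType) (f : Z -> cube R n) :
  (forall i, continuous (fun z => set_val (f z) i : R)) -> continuous f.
Proof. by move=> fc; apply: set_type_continuous; exact: ptws_continuous. Qed.

Lemma cube_boundary_closed : closed (@cube_boundary R n).
Proof.
have -> : @cube_boundary R n = \bigcup_(i in [set: 'I_n])
    ([set x | (set_val x i : R) = 0] `|` [set x | (set_val x i : R) = 1]).
  apply/seteqP; split => [x [i xi]|x [i _ xi]]; first by exists i.
  by exists i; case: xi; [left|right].
apply: closed_bigcup => [|i _]; first exact: finite_finset.
by apply: closedU; apply: closed_eq_continuous;
  try exact: cube_coord_continuous; exact: continuous_cst.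
Qed.

Let N (x : cube R n) : R := \big[Num.max/0]_i `|set_val x i - 1 / 2|.

Let NP x i : `|set_val x i - 1 / 2| <= N x.
Proof. exact: (le_bigmax 0 (fun i => `|set_val x i - 1 / 2|) i). Qed.

Let N_le x : N x <= 1 / 2.
Proof.
apply: bigmax_le => [|i _]; first by lra.
by have := cubeP x i; rewrite ler_norml; lra.
Qed.

Let N_attained x : 0 < N x -> exists i, `|set_val x i - 1 / 2| = N x.
Proof.
move=> N0; have := lexx (N x).
rewrite {2}/N => /bigmax_geP[|[i _ Ni]]; first by rewrite leNgt N0.
by exists i; apply/le_anti; rewrite NP Ni.
Qed.

Let N_continuous : continuous N.
Proof.
rewrite /N; elim: (index_enum _) => [|i r IH].
  under eq_fun do rewrite big_nil; exact: continuous_cst.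
under eq_fun do rewrite big_cons.
apply: continuous_maxr => //; apply: continuous_normr.
apply: continuous_subr; first exact: cube_coord_continuous.
exact: continuous_cst.
Qed.

(** Dividing by [l] doubles the inner cube of sup-radius 1/4 and brings every other point to
    sup-distance 1/2 from the centre; the two regimes agree at [N x = 1 / 4]. *)
Let l x := Num.max (1 / 2) (2 * N x).

Let l_gt0 x : 0 < l x.
Proof. by rewrite /l lt_max; apply/orP; left; lra. Qed.

Let collapse_subproof x i : 0 <= 1 / 2 + (set_val x i - 1 / 2) / l x <= 1.
Proof.
have : `|(set_val x i - 1 / 2) / l x| <= 1 / 2.
  rewrite normrM normfV (gtr0_norm (l_gt0 x)) ler_pdivrMr//.
  have : 2 * N x <= l x by rewrite /l le_max lexx orbT.
  by have := NP x i; lra.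
rewrite ler_norml; lra.
Qed.

(** The radial collapse of the collar of points at sup-distance at least 1/4
    from the centre onto the boundary; [u] is the collar coordinate. *)
Lemma cube_collapse : exists (r : cube R n -> cube R n) (u : cube R n -> unit_interval R),
  [/\ continuous r, continuous u,
    forall x, u x = unit0 \/ cube_boundary (r x)
  & forall x, cube_boundary x -> r x = x /\ u x = unit1].
Proof.
(* [4 * N x - 1] grows from 0 at the inner edge of the collar, [N x = 1 / 4], to 1 on the boundary,
   [N x = 1 / 2]. *)
exists (fun x => cube_pt (collapse_subproof x)), (fun x => unit_clamp (4 * N x - 1)).
split.
- apply: cube_continuous => i /=.
  apply: continuous_addr; first exact: continuous_cst.
  apply: continuous_mulr.
    by apply: continuous_subr; [exact: cube_coord_continuous|exact: continuous_cst].
  apply: continuous_invr => [x|]; first by rewrite gt_eqF.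
  apply: continuous_maxr; first exact: continuous_cst.
  by apply: continuous_mulr => //; exact: continuous_cst.
- apply: unit_clamp_continuous; apply: continuous_subr; last exact: continuous_cst.
  by apply: continuous_mulr => //; exact: continuous_cst.
- move=> x; have [Nx|Nx] := leP (N x) (1 / 4).
    by left; apply: unit_clamp0; lra.
  right; have lx : l x = 2 * N x by rewrite /l max_r //; lra.
  have [|i Ni] := @N_attained x; first by lra.
  exists i; rewrite cube_ptE lx.
  have [xi|xi] := leP 0 (set_val x i - 1 / 2); move: Ni.
    rewrite ger0_norm// => ->; right; rewrite invfM mulrCA mulfV; lra.
  rewrite ltr0_norm// => /(congr1 -%R); rewrite opprK => ->; left.
  rewrite invfM mulrCA mulNr mulfV; lra.
- move=> x [i xi]; have Nx : N x = 1 / 2.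
    apply/le_anti; rewrite N_le /=; apply: le_trans (NP x i).
    case: xi => ->; first by rewrite distrC ger0_norm; lra.
    by rewrite ger0_norm; lra.
  have lx : l x = 1 by rewrite /l max_r //; lra.
  split; last by apply: unit_clamp1; lra.
  by apply: cube_eq => j; rewrite cube_ptE lx invr1 mulr1; lra.
Qed.

Lemma cube_line_subproof (s : unit_interval R) (x y : cube R n) i :
  0 <= (1 - set_val s) * set_val x i + set_val s * set_val y i <= 1.
Proof.
have := unit_intervalP s; have := cubeP x i; have := cubeP y i.
move=> /andP[y0 y1] /andP[x0 x1] /andP[s0 s1].
by apply/andP; split; nra.
Qed.
Definition cube_line s x y := cube_pt (cube_line_subproof s x y).

Lemma cube_line0 s x y : set_val s = 0 -> cube_line s x y = x.
Proof. by move=> s0; apply: cube_eq => i; rewrite cube_ptE s0; lra. Qed.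

Lemma cube_line1 s x y : set_val s = 1 -> cube_line s x y = y.
Proof. by move=> s1; apply: cube_eq => i; rewrite cube_ptE s1; lra. Qed.

Lemma cube_line_id s x : cube_line s x x = x.
Proof. by apply: cube_eq => i; rewrite cube_ptE; lra. Qed.

Lemma cube_line_continuous (Z : topologicalType) (s : Z -> unit_interval R)
    (x y : Z -> cube R n) : continuous s -> continuous x -> continuous y ->
  continuous (fun z => cube_line (s z) (x z) (y z)).
Proof.
move=> sc xc yc; have sc' := unit_val_continuous sc.
apply: cube_continuous => i /=.
apply: continuous_addr; apply: continuous_mulr => //.
- by apply: continuous_subr => //; exact: continuous_cst.
- exact: (continuous_comp_fun xc (@cube_coord_continuous i)).
- exact: (continuous_comp_fun yc (@cube_coord_continuous i)).
Qed.

End cube.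

Section cube_cons.
Variable n : nat.

Lemma cube_cons_subproof (p : unit_interval R * cube R n) (i : 'I_n.+1) :
  0 <= (if unlift ord0 i is Some j then set_val p.2 j else set_val p.1 : R) <= 1.
Proof. by case: (unlift ord0 i) => [j|]; [exact: cubeP|exact: unit_intervalP]. Qed.
Definition cube_cons p : cube R n.+1 := cube_pt (cube_cons_subproof p).

Definition cube_split (x : cube R n.+1) : unit_interval R * cube R n :=
  (unit_pt (cubeP x ord0), cube_pt (fun i => cubeP x (lift ord0 i))).

Lemma cube_consK : cancel cube_cons cube_split.
Proof.
move=> [s x]; congr pair.
  by apply: unit_interval_eq; rewrite unit_ptE cube_ptE unlift_none.
by apply: cube_eq => i; rewrite !cube_ptE liftK.
Qed.

Lemma cube_cons_continuous : continuous cube_cons.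
Proof.
apply: cube_continuous => i.
change (continuous (fun p : unit_interval R * cube R n =>
  if unlift ord0 i is Some j then set_val p.2 j else set_val p.1 : R)).
case: (unlift ord0 i) => [j|].
  exact: (continuous_comp_fun (@snd_continuous _ _) (@cube_coord_continuous n j)).
exact: (unit_val_continuous (@fst_continuous _ _)).
Qed.

Lemma cube_split_continuous : continuous cube_split.
Proof.
apply: continuous_pair_fun.
  by apply: set_type_continuous => /=; exact: cube_coord_continuous.
by apply: cube_continuous => i /=; exact: cube_coord_continuous.
Qed.

Lemma cube_split_boundary x : cube_boundary x <->
  [\/ set_val (cube_split x).1 = 0, set_val (cube_split x).1 = 1
    | cube_boundary (cube_split x).2].
Proof.
split => [[i]|[x0|x1|[j xj]]].
- case: (unliftP ord0 i) => [j|] -> xi; first by apply: Or33; exists j.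
  by case: xi; [apply: Or31|apply: Or32].
- by exists ord0; left.
- by exists ord0; right.
- by exists (lift ord0 j).
Qed.

End cube_cons.

Lemma cube0_boundary (x : cube R 0) : ~ cube_boundary x.
Proof. by case=> -[]. Qed.

Lemma cube0_subproof (i : 'I_0) : 0 <= (0 : R) <= 1.
Proof. by case: i. Qed.
Definition cube0_pt : cube R 0 := cube_pt cube0_subproof.

End cubes.

(** * Relative lifting and weak equivalences *)

Section homotopy.
Variable R : realType.
Implicit Types Z W : topologicalType.

(** The last clause says that no new values appear, so that whatever both homotopies preserve (a
    base point, the projection to a base) is preserved by their concatenation. *)
Lemma concat_homotopy Z W (h k : unit_interval R * W -> Z) :
  continuous h -> continuous k -> (forall w, h (unit1 R, w) = k (unit0 R, w)) ->
  exists l : unit_interval R * W -> Z,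
    [/\ continuous l, forall w, l (unit0 R, w) = h (unit0 R, w),
        forall w, l (unit1 R, w) = k (unit1 R, w)
      & forall s w, exists s', l (s, w) = h (s', w) \/ l (s, w) = k (s', w)].
Proof.
move=> hc kc hk.
pose v (c : unit_interval R * W) : R := set_val c.1.
have vc : continuous v by exact: (unit_val_continuous (@fst_continuous _ _)).
(* Clamping makes both halves continuous on the whole product, so that they can be pasted along
   [v c = 1 / 2]. *)
pose h' (c : unit_interval R * W) := h (unit_clamp (2 * v c), c.2).
pose k' (c : unit_interval R * W) := k (unit_clamp (2 * v c - 1), c.2).
have v2c : continuous (fun c => 2 * v c).
  by apply: continuous_mulr => //; exact: continuous_cst.
have h'c : continuous h'.
  apply: (@continuous_comp_fun _ _ _ (fun c => (unit_clamp (2 * v c), c.2))) => //.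
  apply: continuous_pair_fun; first exact: unit_clamp_continuous.
  exact: snd_continuous.
have k'c : continuous k'.
  apply: (@continuous_comp_fun _ _ _ (fun c => (unit_clamp (2 * v c - 1), c.2))) => //.
  apply: continuous_pair_fun; last exact: snd_continuous.
  apply: unit_clamp_continuous; apply: continuous_subr => //; exact: continuous_cst.
exists (fun c => if v c <= 1 / 2 then h' c else k' c); split.
- apply: (@paste2_continuous _ _ [set c | v c <= 1 / 2] [set c | 1 / 2 <= v c]).
  + by apply: closed_le_continuous => //; exact: continuous_cst.
  + by apply: closed_le_continuous => //; exact: continuous_cst.
  + by move=> c; have [|/ltW] := leP (v c) (1 / 2); [left|right].
  + by apply: within_continuous_eq (continuous_within h'c) => c /= ->.
  + apply: within_continuous_eq (continuous_within k'c) => c /= cv.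
    case: ifP => // cv'; rewrite /k' /h'.
    rewrite unit_clamp0; last by lra.
    by rewrite -hk unit_clamp1 //; lra.
- move=> w; have v0 : v (unit0 R, w) = 0 by [].
  rewrite ifT /h' v0; last by lra.
  by rewrite unit_clamp0 //; lra.
- move=> w; have v1 : v (unit1 R, w) = 1 by [].
  rewrite ifF /k' v1; last by apply/negbTE; rewrite -ltNge; lra.
  by rewrite unit_clamp1 //; lra.
- move=> s w; case: ifP => _; first by exists (unit_clamp (2 * v (s, w))); left.
  by exists (unit_clamp (2 * v (s, w) - 1)); right.
Qed.

Lemma spheroid_homotopic_refl n Z (z : Z) (a : cube R n -> Z) :
  spheroid z a -> spheroid_homotopic z a a.
Proof.
move=> [ac az]; exists (fun c => a c.2); split => //.
exact: (continuous_comp_fun (@snd_continuous _ _) ac).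
Qed.

Lemma spheroid_homotopic_sym n Z (z : Z) (a b : cube R n -> Z) :
  spheroid_homotopic z a b -> spheroid_homotopic z b a.
Proof.
move=> [h [hc h0 h1 hz]]; exists (fun c => h (unit_opp c.1, c.2)); split => /=.
- apply: (@continuous_comp_fun _ _ _ (fun c => (unit_opp c.1, c.2))) => //.
  apply: continuous_pair_fun; last exact: snd_continuous.
  exact: (continuous_comp_fun (@fst_continuous _ _) (@unit_opp_continuous R)).
- by move=> t s t0; apply: h1; rewrite /unit_opp unit_ptE t0 subr0.
- by move=> t s t1; apply: h0; rewrite /unit_opp unit_ptE t1 subrr.
- by move=> t s sb; exact: hz.
Qed.

Lemma spheroid_homotopic_trans n Z (z : Z) (a b c : cube R n -> Z) :
  spheroid_homotopic z a b -> spheroid_homotopic z b c -> spheroid_homotopic z a c.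
Proof.
move=> [h [hc h0 h1 hz]] [k [kc k0 k1 kz]].
have [|l [lc l0 l1 lhk]] := concat_homotopy hc kc.
  by move=> w; rewrite h1 // k0.
exists l; split => //.
- by move=> t s t0; rewrite (@unit_interval_eq _ t (unit0 R)) // l0 h0.
- by move=> t s t1; rewrite (@unit_interval_eq _ t (unit1 R)) // l1 k1.
- by move=> t s sb; have [s' [->|->]] := lhk t s; [exact: hz|exact: kz].
Qed.

Lemma spheroid_homotopic_comp n Z W (f : Z -> W) z (a b : cube R n -> Z) :
  continuous f -> spheroid_homotopic z a b ->
  spheroid_homotopic (f z) (f \o a) (f \o b).
Proof.
move=> fc [h [hc h0 h1 hz]]; exists (f \o h); split => /=.
- exact: (continuous_comp_fun hc fc).
- by move=> t s /h0 ->.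
- by move=> t s /h1 ->.
- by move=> t s sb; rewrite hz.
Qed.

Lemma spheroid_comp n Z W (f : Z -> W) z (a : cube R n -> Z) :
  continuous f -> spheroid z a -> spheroid (f z) (f \o a).
Proof.
move=> fc [ac az]; split => [|s sb /=]; first exact: (continuous_comp_fun ac fc).
by rewrite az.
Qed.

Lemma spheroid_class_eqP n Z (z : Z) (a b : cube R n -> Z) :
  spheroid z a -> spheroid z b ->
  spheroid_class z a = spheroid_class z b <-> spheroid_homotopic z a b.
Proof.
move=> az bz; split => [E|ab].
  have : spheroid_class z b b by split => //; exact: spheroid_homotopic_refl.
  by rewrite -E => -[].
apply/seteqP; split => c [cz h]; split => //.
  exact: spheroid_homotopic_trans (spheroid_homotopic_sym ab) h.
exact: spheroid_homotopic_trans ab h.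
Qed.

Lemma pi_map_class n Z W (f : Z -> W) z (a : cube R n -> Z) :
  continuous f -> spheroid z a ->
  pi_map f z (spheroid_class z a) = spheroid_class (f z) (f \o a).
Proof.
move=> fc az; apply/seteqP; split => [b [a' [a'z aa'] [bz a'b]]|b [bz ab]].
  split => //; apply: spheroid_homotopic_trans a'b.
  exact: spheroid_homotopic_comp.
by exists a => //; split => //; exact: spheroid_homotopic_refl.
Qed.

Lemma spheroid0 Z (z w : Z) : spheroid z (fun _ : cube R 0 => w).
Proof. by split => [|s /cube0_boundary //]; exact: continuous_cst. Qed.

(** The 0-cube has empty boundary, so points are spheroids of dimension 0 and the facts about
    spheroid homotopies also serve path components. *)
Lemma path_componentP Z (z w v : Z) : path_component R z w <->
  spheroid_homotopic v (fun _ : cube R 0 => z) (fun _ => w).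
Proof.
split => [[c [cc c0 c1]]|[h [hc h0 h1 _]]].
  exists (fun p => c p.1); split => // [|t s /c0|t s /c1|t s /cube0_boundary] //.
  exact: (continuous_comp_fun (@fst_continuous _ _) cc).
exists (fun t => h (t, cube0_pt R)); split => [|t /h0|t /h1] //.
apply: (@continuous_comp_fun _ _ _ (fun t => (t, cube0_pt R))) => //.
by apply: continuous_pair_fun; [move=> x; exact: cvg_id|exact: continuous_cst].
Qed.

Lemma path_component_eqP Z (z w : Z) :
  path_component R z = path_component R w <-> path_component R z w.
Proof.
split => [E|/(path_componentP _ _ z) zw].
  rewrite E; apply/(path_componentP _ _ w).
  by apply: spheroid_homotopic_refl; exact: spheroid0.
apply/seteqP; split => v /(path_componentP _ _ z) h; apply/(path_componentP _ _ z).
  exact: spheroid_homotopic_trans (spheroid_homotopic_sym zw) h.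
exact: spheroid_homotopic_trans zw h.
Qed.

Lemma pi0_map_component Z W (f : Z -> W) z : continuous f ->
  pi0_map R f (path_component R z) = path_component R (f z).
Proof.
move=> fc; apply/seteqP; split => [b [w /(path_componentP _ _ z) zw wb]|b zb].
  suff /path_component_eqP -> : path_component R (f z) (f w) by [].
  exact/(path_componentP _ _ (f z))/(spheroid_homotopic_comp fc zw).
by exists z => //; exact/path_component_eqP.
Qed.

(** The relative lifting property of an acyclic Serre fibration, weakened: the lift lies over
    [f \o r] instead of [f]. As the cube is convex and [r] fixes its boundary, [r] is homotopic to
    the identity relative to the boundary, which homotopy groups cannot detect. *)
Definition collar_lifting (E B : topologicalType) (p : E -> B) : Prop :=
  forall n (f : cube R n -> B) (a : cube R n -> E),
    continuous f -> {within @cube_boundary R n, continuous a} ->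
    (forall x, cube_boundary x -> p (a x) = f x) ->
    exists (g : cube R n -> E) (r : cube R n -> cube R n),
      [/\ continuous g, continuous r,
          forall x, cube_boundary x -> g x = a x,
          forall x, cube_boundary x -> r x = x
        & forall x, p (g x) = f (r x)].

Section collar_lifting_weak_equivalence.
Variables (E B : topologicalType) (p : E -> B).
Hypotheses (pc : continuous p) (psurj : forall b, exists e, p e = b).
Hypothesis plift : collar_lifting p.

Lemma collar_lifting_surjective n e (b : cube R n -> B) : spheroid (p e) b ->
  exists2 a, spheroid e a & spheroid_homotopic (p e) (p \o a) b.
Proof.
move=> [bc be].
have [|x /be //|g [r [gc rc ge rid pg]]] := plift (a := fun=> e) bc.
  exact/continuous_within/continuous_cst.
exists g; first by split.
(* The segment from [r x] to [x] undoes the reparametrization; it is constant for [x] on the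
   boundary. *)
exists (fun c => b (cube_line c.1 (r c.2) c.2)); split.
- apply: (@continuous_comp_fun _ _ _
    (fun c : unit_interval R * _ => cube_line c.1 (r c.2) c.2)) => //.
  apply: cube_line_continuous; first exact: fst_continuous.
    exact: (continuous_comp_fun (@snd_continuous _ _) rc).
  exact: snd_continuous.
- by move=> t s t0 /=; rewrite cube_line0.
- by move=> t s t1 /=; rewrite cube_line1.
- by move=> t s sb /=; rewrite rid // cube_line_id be.
Qed.

(** A homotopy in [B] is a map on the cube of dimension [n.+1] whose lift is prescribed on the
    boundary: [a] and [b] on the two end faces, the base point on the others. The required homotopy
    is read off from the filling through its boundary values, where it does not matter how [r] moves
    the interior. *)
Lemma collar_lifting_injective n e (a b : cube R n -> E) :
  spheroid e a -> spheroid e b ->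
  spheroid_homotopic (p e) (p \o a) (p \o b) -> spheroid_homotopic e a b.
Proof.
move=> [ac ae] [bc be] [h [hc h0 h1 he]].
pose f := h \o @cube_split R n.
pose v1 (x : cube R n.+1) : R := set_val (cube_split x).1.
have v1c : continuous v1.
  apply: unit_val_continuous.
  exact: (continuous_comp_fun (@cube_split_continuous _ _) (@fst_continuous _ _)).
have v2c : continuous (fun x : cube R n.+1 => (cube_split x).2).
  exact: (continuous_comp_fun (@cube_split_continuous _ _) (@snd_continuous _ _)).
pose k (x : cube R n.+1) := if v1 x == 0 then a (cube_split x).2 else
  if v1 x == 1 then b (cube_split x).2 else e.
have ka x : v1 x = 0 -> k x = a (cube_split x).2 by rewrite /k => ->; rewrite eqxx.
have kb x : v1 x = 1 -> k x = b (cube_split x).2.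
  by rewrite /k => ->; rewrite eqxx oner_eq0.
have ke x : cube_boundary (cube_split x).2 -> k x = e.
  by move=> xb; rewrite /k ae // be // !if_same.
have bdE : @cube_boundary R n.+1 = [set x | v1 x = 0] `|` [set x | v1 x = 1] `|`
    [set x | cube_boundary (cube_split x).2].
  apply/seteqP; split => x.
    by move=> /cube_split_boundary[]; [left; left|left; right|right].
  by move=> xb; apply/cube_split_boundary; case: xb => [[]|];
    [apply: Or31|apply: Or32|apply: Or33].
have c0 : closed [set x | v1 x = 0].
  by apply: closed_eq_continuous => //; exact: continuous_cst.
have c1 : closed [set x | v1 x = 1].
  by apply: closed_eq_continuous => //; exact: continuous_cst.
have kc : {within @cube_boundary R n.+1, continuous k}.
  rewrite bdE; apply: withinU_continuous; first exact: closedU.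
  - apply: preimage_closed => [x _|]; first exact: v2c.
    exact: cube_boundary_closed.
  - apply: withinU_continuous => //.
    + apply: (@within_continuous_eq _ _ _ (fun x => a (cube_split x).2)).
        by move=> x /ka.
      exact/continuous_within/(continuous_comp_fun v2c ac).
    + apply: (@within_continuous_eq _ _ _ (fun x => b (cube_split x).2)).
        by move=> x /kb.
      exact/continuous_within/(continuous_comp_fun v2c bc).
  - apply: (@within_continuous_eq _ _ _ (fun=> e)) => [x /ke //|].
    exact/continuous_within/continuous_cst.
have fc : continuous f by exact: (continuous_comp_fun (@cube_split_continuous _ _) hc).
have fk x : cube_boundary x -> p (k x) = f x.
  rewrite /f /= [cube_split x]surjective_pairing => /cube_split_boundary[x0|x1|xb].
  - by rewrite ka // h0.
  - by rewrite kb // h1.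
  - by rewrite ke // he.
have [g [r [gc rc gk rid pg]]] := plift fc kc fk.
have bd c : set_val c.1 = 0 \/ set_val c.1 = 1 \/ cube_boundary c.2 ->
    cube_boundary (@cube_cons R n c).
  move=> H; apply/cube_split_boundary; rewrite cube_consK.
  by case: H => [|[]]; [apply: Or31|apply: Or32|apply: Or33].
have gE c : set_val c.1 = 0 \/ set_val c.1 = 1 \/ cube_boundary c.2 ->
    g (cube_cons c) = k (cube_cons c) by move=> /bd; exact: gk.
exists (g \o @cube_cons R n); split => /=.
- exact: (continuous_comp_fun (@cube_cons_continuous _ _) gc).
- by move=> t s t0; rewrite gE ?ka /v1 ?cube_consK //; left.
- by move=> t s t1; rewrite gE ?kb /v1 ?cube_consK //; right; left.
- by move=> t s sb; rewrite gE ?ke /v1 ?cube_consK //; right; right.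
Qed.

Lemma collar_lifting_weak_equivalence : weak_homotopy_equivalence R p.
Proof.
split => //.
- split.
  + by move=> _ [e _ <-]; rewrite pi0_map_component //; exists (p e).
  + move=> _ _ /set_mem[e _ <-] /set_mem[e' _ <-].
    rewrite !pi0_map_component // => /path_component_eqP/(path_componentP _ _ (p e)) ee'.
    apply/path_component_eqP/(path_componentP _ _ e).
    by apply: collar_lifting_injective => //; exact: spheroid0.
  + move=> _ [b _ <-]; have [e <-] := psurj b.
    by exists (path_component R e); [exists e|exact: pi0_map_component].
- move=> n e n0; split.
  + move=> _ [a ae <-]; rewrite pi_map_class //; exists (p \o a) => //.
    exact: spheroid_comp.
  + move=> _ _ /set_mem[a ae <-] /set_mem[b be <-].
    rewrite !pi_map_class // => /spheroid_class_eqP ab.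
    apply/spheroid_class_eqP => //; apply: collar_lifting_injective => //.
    by apply: ab; exact: spheroid_comp.
  + move=> _ [b bpe <-]; have [a ae ab] := collar_lifting_surjective bpe.
    exists (spheroid_class e a); first by exists a.
    by rewrite pi_map_class //; apply/spheroid_class_eqP => //; exact: spheroid_comp.
Qed.

End collar_lifting_weak_equivalence.

(** A lift to [T] of the inner cube is glued to the trace of [h] on the collar. *)
Lemma retract_collar_lifting (E B T : topologicalType) (p : E -> B) (pT : T -> B)
    (i : E -> T) (q : T -> E) (h : unit_interval R * E -> E) :
  continuous i -> continuous q -> continuous h ->
  (forall e, pT (i e) = p e) -> (forall t, p (q t) = pT t) ->
  (forall e, h (unit0 R, e) = e) -> (forall e, h (unit1 R, e) = q (i e)) ->
  (forall s e, p (h (s, e)) = p e) ->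
  (forall n (f : cube R n -> B) (a : cube R n -> T),
    continuous f -> {within @cube_boundary R n, continuous a} ->
    (forall x, cube_boundary x -> pT (a x) = f x) ->
    exists g : cube R n -> T,
      [/\ continuous g, forall x, cube_boundary x -> g x = a x
        & forall x, pT (g x) = f x]) ->
  collar_lifting p.
Proof.
move=> ic qc hc pi pq h0 h1 ph Tlift n f a fc ac pa.
have iac : {within @cube_boundary R n, continuous (i \o a)}.
  exact: (within_continuous_comp (B := setT) ac (continuous_within ic)).
have [|G [Gc Gbd pG]] := Tlift n f (i \o a) fc iac.
  by move=> x xb /=; rewrite pi pa.
have [r [u [rc uc ur rid]]] := cube_collapse R n.
(* On the collar the homotopy runs backwards: at the inner edge it is at time 1 and meets
   [q \o G \o r], because [G] extends [i \o a]; on the boundary of the cube it is at time 0 and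
   equals [a]. *)
exists (fun x => if `[< cube_boundary (r x) >] then h (unit_opp (u x), a (r x))
  else q (G (r x))), r; split => //.
- apply: (@paste2_continuous _ _ [set x | u x = unit0 R] [set x | cube_boundary (r x)]).
  + apply: closed_preimage_eq => //; first exact: unit_interval_hausdorff.
    exact: continuous_cst.
  + apply: preimage_closed => [x _|]; first exact: rc.
    exact: cube_boundary_closed.
  + by move=> x; exact: ur.
  + apply: (@within_continuous_eq _ _ _ (fun x => q (G (r x)))).
      move=> x /= ux; case: asboolP => // rb; rewrite Gbd // ux -h1.
      by congr (h (_, _)); apply: unit_interval_eq; rewrite /unit_opp unit_ptE subr0.
    exact/continuous_within/(continuous_comp_fun (continuous_comp_fun rc Gc) qc).
  + apply: (@within_continuous_eq _ _ _ (fun x => h (unit_opp (u x), a (r x)))).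
      by move=> x /= rb; rewrite asboolT.
    have arc : {within [set x | cube_boundary (r x)], continuous (a \o r)}.
      exact: (within_continuous_comp (continuous_within rc) ac).
    apply: (@within_continuous_comp _ _ _ _ setT
      (fun x => (unit_opp (u x), a (r x))) h) => //; last exact: continuous_within.
    apply: (@continuous_pair_fun (subspace _)) => //.
    exact/continuous_within/(continuous_comp_fun uc (@unit_opp_continuous R)).
- move=> x xb; have [rx ux] := rid x xb; rewrite asboolT ?rx // ux -[RHS]h0.
  by congr (h (_, _)); apply: unit_interval_eq; rewrite /unit_opp unit_ptE subrr.
- by move=> x xb; have [] := rid x xb.
- by move=> x; case: asboolP => rb; rewrite ?ph ?pa // pq pG.
Qed.

End homotopy.

(** * Simplices and points of homotopy colimits *)

Section simplices.
Variables (R : realType) (n : nat).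

Lemma simplex_ge0 (t : simplex R n) i : 0 <= set_val t i.
Proof. by have [] : simplex_set (set_val t) := set_valP t. Qed.

Lemma simplex_sum1 (t : simplex R n) : \sum_i (set_val t i : R) = 1.
Proof. by have [] : simplex_set (set_val t) := set_valP t. Qed.

Lemma simplex_mem (f : 'I_n.+1 -> R) :
  (forall i, 0 <= f i) -> \sum_i f i = 1 -> f \in @simplex_set R n.
Proof. by move=> f0 f1; rewrite inE. Qed.

Definition simplex_pt f (f0 : forall i, 0 <= f i) (f1 : \sum_i f i = 1) : simplex R n :=
  SigSub (@simplex_mem f f0 f1).

Lemma simplex_ptE f f0 f1 i : set_val (@simplex_pt f f0 f1) i = f i.
Proof. by []. Qed.

Lemma simplex_eq (s t : simplex R n) : (forall i, set_val s i = set_val t i) -> s = t.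
Proof. by move=> st; apply: val_inj; apply/funext. Qed.

Lemma simplex_coord_continuous i : continuous (fun t : simplex R n => set_val t i : R).
Proof.
exact: (continuous_comp_fun (@set_val_continuous _ _)
  (@ptws_eval_continuous 'I_n.+1 R i)).
Qed.

Lemma simplex_continuous (Z : topologicalType) (f : Z -> simplex R n) :
  (forall i, continuous (fun z => set_val (f z) i : R)) -> continuous f.
Proof. by move=> fc; apply: set_type_continuous; exact: ptws_continuous. Qed.

Lemma simplex_line_ge0 (a : unit_interval R) (s t : simplex R n) i :
  0 <= (1 - set_val a) * set_val s i + set_val a * set_val t i.
Proof.
have /andP[a0 a1] := unit_intervalP a.
by rewrite addr_ge0 // mulr_ge0 ?simplex_ge0 // subr_ge0.
Qed.

Lemma simplex_line_sum (a : unit_interval R) (s t : simplex R n) :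
  \sum_i ((1 - set_val a) * set_val s i + set_val a * set_val t i) = 1.
Proof. by rewrite big_split /= -!mulr_sumr !simplex_sum1 !mulr1 subrK. Qed.

Definition simplex_line a s t :=
  simplex_pt (simplex_line_ge0 a s t) (simplex_line_sum a s t).

End simplices.

Lemma simplex_mapE (R : realType) m n (theta : functor (ordcat m) (ordcat n))
    (t : simplex R m) j :
  set_val (simplex_map theta t) j = \sum_(i < m.+1 | theta i == j) set_val t i.
Proof. by []. Qed.

Lemma simplex_map_sum (R : realType) m n (theta : functor (ordcat m) (ordcat n))
    (t : simplex R m) (P : pred 'I_n.+1) :
  \sum_(j | P j) set_val (simplex_map theta t) j = \sum_(i | P (theta i)) set_val t i.
Proof.
rewrite (partition_big theta P) //=; apply: eq_bigr => j Pj.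
by rewrite simplex_mapE; apply: eq_bigl => i; case: eqP => [->|]; rewrite ?Pj ?andbF.
Qed.

Definition thin (Q : category) : Prop := forall (a b : Q) (f g : hom a b), f = g.

(** Equality of functors is an equality of dependent records. Chains of covers and chains in prisms
    live in thin categories, where it reduces to equality on objects. *)
Lemma thin_functor_eq (A Q : category) (F G : functor A Q) :
  thin Q -> (forall a, F a = G a) -> F = G.
Proof.
move=> tQ FG.
have irr : forall (o o' : A -> Q) m m' p1 pM q1 qM, o = o' ->
    @Functor A Q o m p1 pM = @Functor A Q o' m' q1 qM.
  move=> o o' m m' p1 pM q1 qM E; subst o'.
  have E : m = m' by do 3 apply/functional_extensionality_dep => ?; exact: tQ.
  by subst m'; exact: functor_irr.
by apply: irr; apply/funext.
Qed.

Definition thin_functor (A Q : category) (tQ : thin Q) (o : A -> Q)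
    (m : forall a b, hom a b -> hom (o a) (o b)) : functor A Q :=
  @Functor A Q o m (fun a => tQ _ _ _ _) (fun a b c g f => tQ _ _ _ _).

Lemma ordcat_thin n : thin (ordcat n).
Proof. by move=> a b f g; exact: bool_irrelevance. Qed.

Definition ord0_hom n (k : ordcat n) : @hom (ordcat n) ord0 k := leq0n k.

Section hocolim_maps.
Variables (R : realType) (K : topologicalGroupType) (C : category) (D : diagram C K).

Lemma hocells_continuous (Z : topologicalType) (f : hocells R D -> Z) :
  (forall n (sigma : functor (ordcat n) C),
    continuous (fun q : simplex R n * D (sigma ord0) => f (hocells_pair q.1 q.2))) ->
  continuous f.
Proof.
move=> fc [[n sigma] [t x]] U nU.
have : nbhs (t, x) (fun q : simplex R n * D (sigma ord0) =>
    U (f (existT (hocell R D) (existT _ n sigma) q))).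
  have := fc n sigma (t, x) U nU; rewrite /= nbhs_simpl /=.
  by apply: filterS => -[].
exact.
Qed.

Lemma hocolim_continuous (Z : topologicalType) (f : hocolim_space R D -> Z) :
  continuous (f \o hopi (D:=D)) -> continuous f.
Proof. by move=> fc; apply/quotient_continuous. Qed.

Lemma prod_hocells_continuous (S Z : topologicalType) (f : S * hocells R D -> Z) :
  (forall n (sigma : functor (ordcat n) C),
    continuous (fun q : S * (simplex R n * D (sigma ord0)) =>
      f (q.1, hocells_pair q.2.1 q.2.2))) ->
  continuous f.
Proof.
move=> fc [s [[n sigma] [t x]]] U nU.
have [[A B] /= [nA nB] ABU] := fc n sigma (s, (t, x)) U nU.
exists (A, existT (hocell R D) (existT _ n sigma) @` B) => /=.
  by split => //; exact: existT_nbhs.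
move=> [s' _] /= [As' [[t' x'] B' <-]].
exact: (ABU (s', (t', x')) (conj As' B')).
Qed.

Lemma hocells_pair_continuous n (sigma : functor (ordcat n) C) :
  continuous (fun q : simplex R n * D (sigma ord0) => hocells_pair q.1 q.2 : hocells R D).
Proof.
have -> : (fun q : simplex R n * D (sigma ord0) => hocells_pair q.1 q.2 : hocells R D) =
    existT (hocell R D) (existT _ n sigma) by apply/funext => -[].
refine (@existT_continuous (nerve C) (hocell R D) (existT _ n sigma)).
Qed.

End hocolim_maps.

(** * Cells of chains, based at a lower bound of the chain *)

Section based_cells.
Variables (R : realType) (K : topologicalGroupType) (C : category) (D : diagram C K).
Variables (Q : category) (tQ : thin Q) (J : functor Q C).

(** The point of the cell of the chain [J c] with barycentric coordinates [t]
    over the restriction of [y], where [q] is below the chain [c]. *)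
Definition bcell (q : Q) (y : D (J q)) n (c : functor (ordcat n) Q)
    (qc : hom q (c ord0)) (t : simplex R n) : hocolim_space R D :=
  hopi (@hocells_pair R K C D n (functor_comp J c) t (dmap D (fmap J qc) y)).

(** Since [y] lies over the fixed object [q], its type does not mention the chain, and chains that
    agree only propositionally can be exchanged without transport. *)
Lemma bcell_eq (q : Q) (y : D (J q)) n (c c' : functor (ordcat n) Q)
    (qc : hom q (c ord0)) (qc' : hom q (c' ord0)) t :
  (forall k, c k = c' k) -> bcell y qc t = bcell y qc' t.
Proof.
move=> /(thin_functor_eq tQ) cc'; subst c'.
by rewrite (tQ qc qc').
Qed.

Lemma bcell_map (q : Q) (y : D (J q)) m n (theta : functor (ordcat m) (ordcat n))
    (c : functor (ordcat n) Q) (qc : hom q (c ord0))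
    (qc' : hom q (functor_comp c theta ord0)) (t : simplex R m) :
  bcell y qc (simplex_map theta t) = bcell y qc' t.
Proof.
rewrite /bcell (hopi_glue (@HoGlue R K C D m n theta (functor_comp J c) t _)).
rewrite (tQ qc' (compm (fmap c (ord0_hom (theta ord0))) qc)) fmapM dmapM.
set w := dmap D _ (dmap D _ y); congr (hopi _).
apply: (@hocells_pair_eq R K C D C (fun c => D c) id (fun=> id) m
  (functor_comp (functor_comp J c) theta)
  (functor_comp J (functor_comp c theta)) t _ erefl erefl w).
exact: functor_irr.
Qed.

Lemma bcell_rebase (q q' : Q) (qq' : hom q q') (y : D (J q)) n
    (c : functor (ordcat n) Q) (qc : hom q (c ord0)) (qc' : hom q' (c ord0)) t :
  bcell (dmap D (fmap J qq') y) qc' t = bcell y qc t.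
Proof. by rewrite /bcell (tQ qc (compm qc' qq')) fmapM dmapM. Qed.

Lemma bcell_continuous (Z : topologicalType) (q : Q) n (c : functor (ordcat n) Q)
    (qc : hom q (c ord0)) (y : Z -> D (J q)) (t : Z -> simplex R n) :
  continuous y -> continuous t -> continuous (fun z => bcell (y z) qc (t z)).
Proof.
move=> yc tc; apply: continuous_comp_fun (@hopi_continuous R K C D).
apply: (continuous_comp_fun _ (@hocells_pair_continuous R K C D n (functor_comp J c))).
apply: continuous_pair_fun => //.
refine (continuous_comp_fun yc (@gmap_continuous _ _ _ (dmap D (fmap J qc)))).
Qed.

(** The chains only need to agree on the support of [t]: both agree after
    precomposition with the retraction of [n] onto the support sending [k] to
    the last point of the support before [k]. *)
Lemma bcell_support (q : Q) (y : D (J q)) n (c c' : functor (ordcat n) Q)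
    (qc : hom q (c ord0)) (qc' : hom q (c' ord0)) (t : simplex R n) :
  (forall k, set_val t k != 0 -> c k = c' k) ->
  bcell y qc t = bcell y qc' t.
Proof.
move=> cc'; pose S := [pred k : 'I_n.+1 | set_val t k != 0].
have [k0 Sk0] : exists k, S k.
  apply/existsP; rewrite -[[exists _, _]]negbK negb_exists; apply/negP => /forallP t0.
  have := simplex_sum1 t; rewrite big1 => [/esym/eqP|k _]; first by rewrite oner_eq0.
  by have := t0 k; rewrite negbK => /eqP.
pose s0 := [arg min_(i < k0 | S i) (i : nat)].
have [Ss0 s0_min] : S s0 /\ forall i, S i -> (s0 <= i)%N.
  by rewrite /s0; case: arg_minnP.
(* The bound [maxn k s0] sends every [k] before the first support point [s0] to [s0] itself, which
   keeps [o] defined and monotone there. *)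
pose o (k : 'I_n.+1) := [arg max_(i > s0 | S i && (i <= maxn k s0)%N) (i : nat)].
have oP k : [/\ S (o k), (o k <= maxn k s0)%N
    & forall i, S i -> (i <= maxn k s0)%N -> (i <= o k)%N].
  rewrite /o; case: arg_maxnP; first by rewrite Ss0 leq_maxr.
  by move=> i /andP[Si ik] imax; split => // j Sj jk; apply: imax; rewrite Sj.
have oS k : S k -> o k = k.
  move=> Sk; have [_ ok kmax] := oP k; apply/val_inj/anti_leq => /=.
  by rewrite kmax ?leq_maxl // -[X in (_ <= X)%N](maxn_idPl (s0_min k Sk)) ok.
have omono (i j : ordcat n) : hom i j -> @hom (ordcat n) (o i) (o j).
  move=> ij; have [Si oi _] := oP i; have [_ _ jmax] := oP j.
  apply: jmax => //; apply: leq_trans oi _; rewrite geq_max leq_maxr andbT.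
  exact: leq_trans ij (leq_maxl _ _).
pose theta := thin_functor (@ordcat_thin n) omono.
have tE : simplex_map theta t = t.
  apply: simplex_eq => j; rewrite simplex_mapE /=.
  have [Sj|] := boolP (S j).
    rewrite (bigD1 j) /=; last by rewrite oS.
    rewrite big1 ?addr0 // => i /andP[/eqP oij ij]; apply/eqP; apply: contraNT ij => Si.
    by rewrite -oij oS.
  move=> nSj; have /eqP -> := negbNE nSj; rewrite big1 // => i /eqP oij.
  by have [] := oP i; rewrite oij (negbTE nSj).
have q' : hom q (functor_comp c theta ord0) := compm (fmap c (ord0_hom (theta ord0))) qc.
have q'' : hom q (functor_comp c' theta ord0) := compm (fmap c' (ord0_hom (theta ord0))) qc'.
rewrite -tE (bcell_map y qc q') (bcell_map y qc' q'').
by apply: bcell_eq => k /=; apply: cc'; have [] := oP k.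
Qed.

End based_cells.

(** * Weighted configurations *)

Section interval_model.
Variables (R : realType) (G H : topologicalGroupType) (X : gspace G) (Y : gspace H).
Variable A : graph.
Let V := vertex A.
Let B : topologicalType := conf A (prod_gspace X Y).

(** Weights are defined on all pairs of vertices, but constrained by the
    configuration only on edges. *)
Definition model_set : set (B * {ptws (V * V)%type -> R}) :=
  [set p | [/\ forall u v, 0 <= p.2 (u, v) <= 1, forall u v, p.2 (u, v) = p.2 (v, u),
     forall u v, adj u v -> (set_val p.1 u).1 = (set_val p.1 v).1 -> p.2 (u, v) = 0
   & forall u v, adj u v -> (set_val p.1 u).2 = (set_val p.1 v).2 -> p.2 (u, v) = 1]].

Definition model : topologicalType := set_type model_set.

Definition model_base (m : model) : B := (set_val m).1.
Definition model_weight (m : model) (u v : V) : R := (set_val m).2 (u, v).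

Lemma model_weight01 m u v : 0 <= model_weight m u v <= 1.
Proof. by have [w01 _ _ _] : model_set (set_val m) := set_valP m; exact: w01. Qed.

Lemma model_weightC m u v : model_weight m u v = model_weight m v u.
Proof. by have [_ wC _ _] : model_set (set_val m) := set_valP m; exact: wC. Qed.

Lemma model_weight_eq0 m u v : adj u v ->
  (set_val (model_base m) u).1 = (set_val (model_base m) v).1 -> model_weight m u v = 0.
Proof. by have [_ _ w0 _] : model_set (set_val m) := set_valP m; exact: w0. Qed.

Lemma model_weight_eq1 m u v : adj u v ->
  (set_val (model_base m) u).2 = (set_val (model_base m) v).2 -> model_weight m u v = 1.
Proof. by have [_ _ _ w1] : model_set (set_val m) := set_valP m; exact: w1. Qed.

Lemma model_base_continuous : continuous model_base.
Proof.
exact: (continuous_comp_fun (@set_val_continuous _ model_set) (@fst_continuous _ _)).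
Qed.

Lemma model_weight_continuous u v : continuous (fun m => model_weight m u v).
Proof.
apply: (@continuous_comp_fun _ _ _ (fun m : model => (set_val m).2)
  (fun w : {ptws (V * V)%type -> R} => w (u, v))).
  exact: (continuous_comp_fun (@set_val_continuous _ model_set) (@snd_continuous _ _)).
exact: ptws_eval_continuous.
Qed.

Lemma model_valE m : set_val m =
  (model_base m, (fun p : V * V => model_weight m p.1 p.2) : {ptws (V * V)%type -> R}).
Proof. by rewrite [LHS]surjective_pairing; congr pair; apply/funext => -[]. Qed.

Lemma model_continuous (Z : topologicalType) (f : Z -> model) :
  continuous (fun z => model_base (f z)) ->
  (forall u v, continuous (fun z => model_weight (f z) u v)) -> continuous f.
Proof.
move=> bc wc; apply: set_type_continuous.
have -> : (fun z => set_val (f z)) =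
    (fun z => (model_base (f z), fun p : V * V => model_weight (f z) p.1 p.2)).
  by apply/funext => z; exact: model_valE.
apply: continuous_pair_fun => //.
by apply: ptws_continuous => -[u v]; exact: wc.
Qed.

Lemma model_eq m m' : model_base m = model_base m' ->
  (forall u v, model_weight m u v = model_weight m' u v) -> m = m'.
Proof.
move=> bE wE; apply: val_inj; rewrite -!set_valE !model_valE bE; congr pair.
by apply/funext => -[u v] /=; exact: wE.
Qed.

Section model_pt.
Variables (b : B) (w : V -> V -> R).
Hypotheses (w01 : forall u v, 0 <= w u v <= 1) (wC : forall u v, w u v = w v u).
Hypothesis w0 : forall u v, adj u v -> (set_val b u).1 = (set_val b v).1 -> w u v = 0.
Hypothesis w1 : forall u v, adj u v -> (set_val b u).2 = (set_val b v).2 -> w u v = 1.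

Lemma model_mem : (b, fun p : V * V => w p.1 p.2) \in model_set.
Proof. by rewrite inE; split => /= u v; [exact: w01|exact: wC|exact: w0|exact: w1]. Qed.

Definition model_pt : model := SigSub model_mem.

End model_pt.

Lemma conf_adj (b : B) u v : adj u v -> (set_val b u).1 = (set_val b v).1 ->
  (set_val b u).2 = (set_val b v).2 -> False.
Proof.
move=> uv E1 E2; have bP : conf_set A _ (set_val b) := set_valP b.
by apply: (bP u v uv); rewrite [LHS]surjective_pairing [RHS]surjective_pairing E1 E2.
Qed.

(** Composed with [of_model], such a weighted configuration gives surjectivity of the comparison
    map, hence surjectivity on path components. *)
Lemma model_base_surj b : exists m, model_base m = b.
Proof.
pose w u v : R := if `[< adj u v /\ (set_val b u).1 = (set_val b v).1 >] then 0 else 1.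
have w01 u v : 0 <= w u v <= 1 by rewrite /w; case: ifP; lra.
have adjC u v : adj u v -> @adj A v u by have [+ _] := adj_graphical A; apply.
have wC u v : w u v = w v u.
  by rewrite /w; congr (if _ then _ else _); apply: asbool_equiv_eq;
    split => -[/adjC ? ->].
have w0 u v : adj u v -> (set_val b u).1 = (set_val b v).1 -> w u v = 0.
  by move=> uv E; rewrite /w asboolT.
have w1 u v : adj u v -> (set_val b u).2 = (set_val b v).2 -> w u v = 1.
  move=> uv E; rewrite /w asboolF // => -[_ E1]; exact: conf_adj uv E1 E.
by exists (model_pt w01 wC w0 w1).
Qed.

Hypotheses (hX : hausdorff_space X) (hY : hausdorff_space Y).

(** Each ordered pair of vertices is treated separately. Its weight is prescribed on [S], is 0 on
    [W1] and 1 on [W2]; [W1] and [W2] are disjoint because adjacent vertices have distinct images in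
    the product, and on [S] the given weights obey the same constraints. The prescription is thus
    continuous on a closed set, and Tietze's theorem extends it. *)
Lemma model_lift (D : topologicalType) (S : set D) (f : D -> B) (a : D -> model) :
  normal_space D -> closed S -> continuous f -> {within S, continuous a} ->
  (forall x, S x -> model_base (a x) = f x) ->
  exists g : D -> model, [/\ continuous g, forall x, S x -> g x = a x
    & forall x, model_base (g x) = f x].
Proof.
move=> nD cS fc ac af.
have f1c u : continuous (fun x => (set_val (f x) u).1).
  apply: continuous_comp_fun (@fst_continuous X Y).
  exact: (continuous_comp_fun fc (@conf_eval_continuous A (prod_gspace X Y) u)).
have f2c u : continuous (fun x => (set_val (f x) u).2).
  apply: continuous_comp_fun (@snd_continuous X Y).
  exact: (continuous_comp_fun fc (@conf_eval_continuous A (prod_gspace X Y) u)).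
pose P (p : V * V) (t : D -> R) := [/\ continuous t, forall x, 0 <= t x <= 1,
    forall x, S x -> t x = model_weight (a x) p.1 p.2,
    forall x, adj p.1 p.2 -> (set_val (f x) p.1).1 = (set_val (f x) p.2).1 -> t x = 0
  & forall x, adj p.1 p.2 -> (set_val (f x) p.1).2 = (set_val (f x) p.2).2 -> t x = 1].
have [t tP] : {t & forall p, P p (t p)}.
  apply: choice => -[u v]; rewrite /P /=.
  pose W1 := [set x | adj u v /\ (set_val (f x) u).1 = (set_val (f x) v).1].
  pose W2 := [set x | adj u v /\ (set_val (f x) u).2 = (set_val (f x) v).2].
  have cW1 : closed W1.
    have [uv|uv] := pselect (adj u v); last first.
      by rewrite (_ : W1 = set0); [exact: closed0|apply/seteqP; split => x // -[]].
    rewrite (_ : W1 = [set x | (set_val (f x) u).1 = (set_val (f x) v).1]).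
      exact: closed_preimage_eq.
    by apply/seteqP; split => x // -[].
  have cW2 : closed W2.
    have [uv|uv] := pselect (adj u v); last first.
      by rewrite (_ : W2 = set0); [exact: closed0|apply/seteqP; split => x // -[]].
    rewrite (_ : W2 = [set x | (set_val (f x) u).2 = (set_val (f x) v).2]).
      exact: closed_preimage_eq.
    by apply/seteqP; split => x // -[].
  pose k x : R := if `[< S x >] then model_weight (a x) u v else
    if `[< W1 x >] then 0 else 1.
  have kS x : S x -> k x = model_weight (a x) u v by move=> Sx; rewrite /k asboolT.
  have kW1 x : W1 x -> k x = 0.
    move=> W1x; rewrite /k [X in if X then 0 else _]asboolT //.
    case: asboolP => // Sx; case: W1x => uv E.
    by apply: model_weight_eq0 => //; rewrite af.
  have kW2 x : W2 x -> k x = 1.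
    move=> [uv E]; rewrite /k [X in if X then 0 else _]asboolF.
      by case: asboolP => // Sx; apply: model_weight_eq1 => //; rewrite af.
    by move=> [_ E']; exact: conf_adj uv E' E.
  have kc : {within S `|` W1 `|` W2, continuous k}.
    apply: withinU_continuous => //; first exact: closedU.
      apply: withinU_continuous => //.
        apply: (@within_continuous_eq _ _ _ (fun x => model_weight (a x) u v)).
          by move=> x /kS.
        apply: (@within_continuous_comp _ _ _ _ setT a (fun m => model_weight m u v)) => //.
        exact/continuous_within/model_weight_continuous.
      apply: (@within_continuous_eq _ _ _ (fun=> 0 : R)) => [x /kW1 //|].
      exact/continuous_within/continuous_cst.
    apply: (@within_continuous_eq _ _ _ (fun=> 1 : R)) => [x /kW2 //|].
    exact/continuous_within/continuous_cst.
  have k01 x : 0 <= k x <= 1.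
    by rewrite /k; case: ifP => _; [exact: model_weight01|case: ifP; lra].
  have [|||g [gk gc _]] := @continuous_bounded_extension D R nD _ _ k 1 _ kc.
  - by apply: closedU => //; exact: closedU.
  - by [].
  - by move=> x _; have := k01 x; rewrite ler_norml; lra.
  (* Tietze's extension may leave [0, 1]; clamping brings it back and keeps the prescribed
     values. *)
  have gE x : (S `|` W1 `|` W2) x -> set_val (unit_clamp (g x)) = k x.
    by move=> Cx; rewrite -(gk x) ?unit_clampE //; exact: mem_set.
  exists (fun x => set_val (unit_clamp (g x))); split.
  - exact/unit_val_continuous/unit_clamp_continuous.
  - by move=> x; exact: unit_intervalP.
  - by move=> x Sx; rewrite gE ?kS //; left; left.
  - by move=> x uv E; rewrite gE ?kW1 //; left; right.
  - by move=> x uv E; rewrite gE ?kW2 //; right.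
have adjC u v : adj u v -> @adj A v u by have [+ _] := adj_graphical A; apply.
(* The extensions for [(u, v)] and [(v, u)] are unrelated. Their average is symmetric, and it keeps
   the prescribed values because these are symmetric. *)
pose w x u v : R := (t (u, v) x + t (v, u) x) / 2.
have w01 x u v : 0 <= w x u v <= 1.
  by rewrite /w; have [_ /(_ x) + _ _ _] := tP (u, v); have [_ /(_ x) + _ _ _] := tP (v, u); lra.
have wC x u v : w x u v = w x v u by rewrite /w addrC.
have w0 x u v : adj u v -> (set_val (f x) u).1 = (set_val (f x) v).1 -> w x u v = 0.
  move=> uv E; have [_ _ _ /(_ x uv E) t1 _] := tP (u, v).
  have [_ _ _ /(_ x (adjC _ _ uv) (esym E)) t2 _] := tP (v, u).
  by rewrite /w t1 t2; lra.
have w1 x u v : adj u v -> (set_val (f x) u).2 = (set_val (f x) v).2 -> w x u v = 1.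
  move=> uv E; have [_ _ _ _ /(_ x uv E) t1] := tP (u, v).
  have [_ _ _ _ /(_ x (adjC _ _ uv) (esym E)) t2] := tP (v, u).
  by rewrite /w t1 t2; lra.
exists (fun x => model_pt (w01 x) (wC x) (w0 x) (w1 x)); split => //.
- apply: model_continuous => // u v; rewrite /model_weight /= /w.
  apply: continuous_mulr; last exact: continuous_cst.
  by apply: continuous_addr; [have [] := tP (u, v)|have [] := tP (v, u)].
- move=> x Sx; apply: model_eq => [|u v]; first by rewrite af.
  rewrite /model_weight /= /w.
  have [_ _ /(_ x Sx) -> _ _] := tP (u, v); have [_ _ /(_ x Sx) -> _ _] := tP (v, u).
  rewrite /= (model_weightC _ v u); rewrite -/(model_weight _ _ _); lra.
Qed.

End interval_model.

(** * Objects over a graph and covers *)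

Section covers.
Variable A : graph.
Let V := vertex A.

(** These stand for the objects of the comma category over [A] whose underlying
    graph injection is the identity, with as few edges as possible. *)
Record cover := Cover {
  cover_l : V -> V -> Prop;
  cover_r : V -> V -> Prop;
  cover_l_graphical : graphical cover_l;
  cover_r_graphical : graphical cover_r;
  cover_adj : forall u v, adj u v <-> cover_l u v \/ cover_r u v }.

Lemma cover_eq (c d : cover) :
  (forall u v, cover_l c u v <-> cover_l d u v) ->
  (forall u v, cover_r c u v <-> cover_r d u v) -> c = d.
Proof.
case: c d => [l r lg rg lr] [l' r' lg' rg' lr'] /= ll' rr'.
have E : l = l' by apply/funext => u; apply/funext => v; apply/propext.
have E' : r = r' by apply/funext => u; apply/funext => v; apply/propext.
subst l' r'; by rewrite (Prop_irrelevance lg lg') (Prop_irrelevance rg rg')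
  (Prop_irrelevance lr lr').
Qed.

(** Arrows go from larger to smaller relations, as in the opposite of [GI2]. Along a chain the
    relations shrink, so a configuration that is valid for the first cover is valid for all. *)
Definition cover_hom (c d : cover) : Prop :=
  (forall u v, cover_l d u v -> cover_l c u v) /\
  (forall u v, cover_r d u v -> cover_r c u v).

Lemma cover_hom_refl c : cover_hom c c. Proof. by []. Qed.

Lemma cover_hom_trans b c d : cover_hom c d -> cover_hom b c -> cover_hom b d.
Proof. by move=> [l r] [l' r']; split => u v; [move/l/l'|move/r/r']. Qed.

Definition cover_cat : category :=
  @Category cover cover_hom cover_hom_refl (fun b c d => @cover_hom_trans b c d)
    (fun _ _ _ => Prop_irrelevance _ _) (fun _ _ _ => Prop_irrelevance _ _)
    (fun _ _ _ _ _ _ _ => Prop_irrelevance _ _).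

Lemma cover_thin : thin cover_cat.
Proof. by move=> c d f g; exact: (@Prop_irrelevance (cover_hom c d)). Qed.

Lemma cover_join_adj (c d : cover) u v :
  adj u v <-> (cover_l c u v \/ cover_l d u v) \/ (cover_r c u v \/ cover_r d u v).
Proof. by have := cover_adj c u v; have := cover_adj d u v; tauto. Qed.

Lemma graphical_or (r s : V -> V -> Prop) : graphical r -> graphical s ->
  graphical (fun u v => r u v \/ s u v).
Proof.
move=> [rs ri] [ss si]; split => [u v [/rs|/ss]|v [/ri|/si]] //; first by left.
by right.
Qed.

(** A common lower bound of two covers, at which cells of chains with different first members can
    both be based. *)
Definition cover_join (c d : cover) : cover :=
  Cover (graphical_or (cover_l_graphical c) (cover_l_graphical d))
    (graphical_or (cover_r_graphical c) (cover_r_graphical d))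
    (cover_join_adj c d).

Lemma cover_join_l c d : cover_hom (cover_join c d) c.
Proof. by split => u v; left. Qed.

Lemma cover_join_r c d : cover_hom (cover_join c d) d.
Proof. by split => u v; right. Qed.

Definition over : category := comma (op_functor union_functor) (A : op GI).

Definition over_fun (o : over) : graph_injection A (graph_union (comma_src o)) :=
  comma_arr o.

Lemma over_homE (o o' : over) (g : hom o o') v :
  (comma_map g : graph2_injection _ _) (over_fun o' v) = over_fun o v.
Proof.
have E : gi_comp (gi_union (comma_map g)) (over_fun o') = over_fun o := comma_mapP g.
by rewrite -E.
Qed.

Definition cover_graph2 (c : cover) : graph2 :=
  Graph2 (vertex_finite A) (cover_l_graphical c) (cover_r_graphical c).

Lemma cover_graph2_adj c (u v : V) :
  adj u v -> @adj (graph_union (cover_graph2 c)) u v.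
Proof. by move/(cover_adj c). Qed.

Definition cover_ob (c : cover) : over :=
  @CommaOb _ _ (op_functor union_functor) (A : op GI) (cover_graph2 c)
    (@GraphInjection A (graph_union (cover_graph2 c)) id (@inj_id _)
      (@cover_graph2_adj c)).

Definition cover_graph2_map (c d : cover) (h : cover_hom c d) :
    graph2_injection (cover_graph2 d) (cover_graph2 c) :=
  @Graph2Injection (cover_graph2 d) (cover_graph2 c) id (@inj_id _) h.1 h.2.

Definition cover_ob_map (c d : cover) (h : cover_hom c d) :
    hom (cover_ob c) (cover_ob d) :=
  @CommaHom _ _ (op_functor union_functor) (A : op GI) (cover_ob c) (cover_ob d)
    (cover_graph2_map h) (@graph_injection_eq A (graph_union (cover_graph2 c))
       (gi_comp (gi_union (cover_graph2_map h)) (over_fun (cover_ob d)))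
       (over_fun (cover_ob c)) erefl).

Lemma cover_ob_map1 c : cover_ob_map (cover_hom_refl c) = idm (cover_ob c).
Proof. by apply: comma_hom_eq; exact: graph2_injection_eq. Qed.

Lemma cover_ob_mapM b c d (h : cover_hom c d) (k : cover_hom b c) :
  cover_ob_map (cover_hom_trans h k) = compm (cover_ob_map h) (cover_ob_map k).
Proof. by apply: comma_hom_eq; exact: graph2_injection_eq. Qed.

Definition cover_functor : functor cover_cat over :=
  @Functor cover_cat over cover_ob cover_ob_map cover_ob_map1 (fun _ _ _ h k => cover_ob_mapM h k).

Lemma pullback_graphical (W : Set) (r : W -> W -> Prop) (f : V -> W) :
  graphical r -> graphical (fun u v : V => adj u v /\ r (f u) (f v)).
Proof.
move=> [rs ri]; have [As _] := adj_graphical A.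
by split => [u v [/As ? /rs]|v [_ /ri]].
Qed.

Lemma pullback_adj (o : over) u v : adj u v <->
  (adj u v /\ adj' (over_fun o u) (over_fun o v)) \/
  (adj u v /\ adj'' (over_fun o u) (over_fun o v)).
Proof.
split => [uv|]; last by case => -[].
by have [] := gi_adj (over_fun o) uv; [left|right].
Qed.

(** The injection may create edges between images of nonadjacent vertices; keeping only edges of [A]
    makes the two relations cover [A] exactly. *)
Definition pullback (o : over) : cover :=
  Cover (pullback_graphical (over_fun o) (adj'_graphical (comma_src o)))
    (pullback_graphical (over_fun o) (adj''_graphical (comma_src o)))
    (pullback_adj o).

Lemma pullback_map (o o' : over) (g : hom o o') : cover_hom (pullback o) (pullback o').
Proof.
split => u v [uv r]; split => //; rewrite -!(over_homE g); first exact: gi2_adj'.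
exact: gi2_adj''.
Qed.

Definition pullback_functor : functor over cover_cat :=
  @Functor over cover_cat pullback pullback_map
    (fun=> cover_thin _ _) (fun _ _ _ _ _ => cover_thin _ _).

Definition pullback_unit_map (o : over) :
    graph2_injection (cover_graph2 (pullback o)) (comma_src o) :=
  @Graph2Injection (cover_graph2 (pullback o)) (comma_src o) (over_fun o)
    (@gi_inj _ _ (over_fun o)) (fun u v r => r.2) (fun u v r => r.2).

(** The component at [o] of a natural transformation from the identity to pullback followed by
    inclusion of covers; it drives the first of the two homotopies. *)
Definition pullback_unit (o : over) : hom o (cover_ob (pullback o)) :=
  @CommaHom _ _ (op_functor union_functor) (A : op GI) o (cover_ob (pullback o))
    (pullback_unit_map o) (@graph_injection_eq A (graph_union (comma_src o))
       (gi_comp (gi_union (pullback_unit_map o)) (over_fun (cover_ob (pullback o))))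
       (over_fun o) erefl).

Lemma pullback_unit_natural (o o' : over) (g : hom o o') :
  compm (cover_ob_map (pullback_map g)) (pullback_unit o) =
  compm (pullback_unit o') g.
Proof.
apply: comma_hom_eq; apply: graph2_injection_eq; apply/funext => v /=.
exact/esym/over_homE.
Qed.

End covers.

(** * The comparison map and its naturality *)

Section comparison.
Variables (R : realType) (G H : topologicalGroupType) (X : gspace G) (Y : gspace H).
Let confXY := conf_diagram (prod_gspace X Y).

Definition over_diagram (A : graph) : diagram (over A) (G * H)%type :=
  comma_diagram (op_functor union_functor) (conf_prod_diagram X Y) (A : op GI).

Section object.
Variable A : graph.
Let D := over_diagram A.
Let B := conf A (prod_gspace X Y).

(** An edge of [A] is sent into one of the two relations, so its ends differ in the corresponding
    coordinate. *)
Lemma over_base_subproof (o : over A) (x : D o) :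
  (fun v => (set_val x.1 (over_fun o v), set_val x.2 (over_fun o v))) \in
  conf_set A (prod_gspace X Y).
Proof.
have x1P : conf_set _ _ (set_val x.1) := set_valP x.1.
have x2P : conf_set _ _ (set_val x.2) := set_valP x.2.
rewrite inE => u v uv [E1 E2].
by have [r|r] := gi_adj (over_fun o) uv; [apply: (x1P _ _ r)|apply: (x2P _ _ r)].
Qed.

Definition over_base (o : over A) (x : D o) : B := SigSub (over_base_subproof x).

Lemma over_baseE (o : over A) (x : D o) v : set_val (over_base x) v =
  (set_val x.1 (over_fun o v), set_val x.2 (over_fun o v)).
Proof. by []. Qed.

Lemma over_base_map (o o' : over A) (g : hom o o') (x : D o) :
  over_base (dmap D g x) = over_base x.
Proof.
apply: conf_eq => v; rewrite !over_baseE -(over_homE g v).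
by case: x.
Qed.

Lemma over_base_continuous o : continuous (@over_base o).
Proof.
apply: conf_continuous => v /=; apply: continuous_pair_fun.
  apply: continuous_comp_fun (@conf_eval_continuous _ _ _).
  exact: fst_continuous.
apply: continuous_comp_fun (@conf_eval_continuous _ _ _).
exact: snd_continuous.
Qed.

Definition hocells_base (p : hocells R D) : B :=
  @over_base (nerve_first (projT1 p)) (projT2 p).2.

Definition hocolim_base : hocolim_space R D -> B := hocolim_lift hocells_base.

Lemma hocolim_baseE n (sigma : functor (ordcat n) (over A)) (t : simplex R n)
    (x : D (sigma ord0)) :
  hocolim_base (hopi (hocells_pair t x)) = over_base x.
Proof.
rewrite /hocolim_base hocolim_liftE // => {n sigma t x} _ _ [m n theta sigma t x].
exact/esym/over_base_map.
Qed.

Lemma hocolim_base_continuous : continuous hocolim_base.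
Proof.
apply: hocolim_continuous; apply: hocells_continuous => n sigma.
under eq_fun do rewrite /= hocolim_baseE.
exact: (continuous_comp_fun (@snd_continuous _ _) (@over_base_continuous _)).
Qed.

Lemma hocolim_base_act g z : hocolim_base (act (hocolim R D) g z) =
  act (conf_gspace A (prod_gspace X Y)) g (hocolim_base z).
Proof.
have [[[n sigma] [t x]] ->] := hopi_surj z.
rewrite /= (@hocolim_actE R _ _ D g n sigma t x) !hocolim_baseE.
exact: conf_eq.
Qed.

Definition hocolim_base_gmap : gmap (hocolim R D) (confXY (A : op GI)) :=
  @GMap _ (hocolim R D) (conf_gspace A (prod_gspace X Y)) hocolim_base
    hocolim_base_continuous hocolim_base_act.

End object.

Lemma hocolim_base_natural (A B : op GI) (f : hom A B)
    (z : hLan R (op_functor union_functor) (conf_prod_diagram X Y) A) :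
  hocolim_base_gmap B (dmap (hLan R (op_functor union_functor) (conf_prod_diagram X Y)) f z)
  = dmap confXY f (hocolim_base_gmap A z).
Proof.
have [[[n sigma] [t x]] ->] := @hopi_surj R _ _ (over_diagram A) z.
rewrite [dmap _ f _](@hLan_mapE R _ _ _ (op_functor union_functor) (conf_prod_diagram X Y)
  A B f n sigma t x).
rewrite /= (@hocolim_baseE A n sigma t x).
rewrite (@hocolim_baseE B n (functor_comp (comma_push (op_functor union_functor) f) sigma) t x).
exact: conf_eq.
Qed.

Definition comparison :
    nat_trans (hLan R (op_functor union_functor) (conf_prod_diagram X Y)) confXY :=
  @NatTrans _ _ (hLan R (op_functor union_functor) (conf_prod_diagram X Y)) confXY
    hocolim_base_gmap hocolim_base_natural.

End comparison.

(** * Cells over a fixed configuration *)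

Section cover_cells.
Variables (R : realType) (G H : topologicalGroupType) (X : gspace G) (Y : gspace H).
Variable A : graph.
Let V := vertex A.
Let D := over_diagram X Y A.
Let B := conf A (prod_gspace X Y).

(** The condition for [z] to split into a pair of configurations over the cover [c]; the pair is
    [cover_pt]. *)
Definition cover_valid (z : B) (c : cover A) : Prop :=
  (forall u v, cover_l c u v -> (set_val z u).1 <> (set_val z v).1) /\
  (forall u v, cover_r c u v -> (set_val z u).2 <> (set_val z v).2).

Lemma cover_valid_hom z c d : cover_hom c d -> cover_valid z c -> cover_valid z d.
Proof. by move=> [l r] [zl zr]; split => u v; [move/l/zl|move/r/zr]. Qed.

Lemma cover_valid_join z c d :
  cover_valid z c -> cover_valid z d -> cover_valid z (cover_join c d).
Proof.
by move=> [cl cr] [dl dr]; split => u v [];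
  [exact: cl|exact: dl|exact: cr|exact: dr].
Qed.

Lemma cover_valid_pullback (o : over A) (x : D o) :
  cover_valid (over_base x) (pullback o).
Proof.
have x1P : conf_set _ _ (set_val x.1) := set_valP x.1.
have x2P : conf_set _ _ (set_val x.2) := set_valP x.2.
by split => u v [_ r]; rewrite !over_baseE /=; [exact: x1P|exact: x2P].
Qed.

Lemma cover_pt_l z c : cover_valid z c ->
  (fun v => (set_val z v).1) \in conf_set (graph_l (cover_graph2 c)) X.
Proof. by move=> [zl _]; rewrite inE => u v; exact: zl. Qed.

Lemma cover_pt_r z c : cover_valid z c ->
  (fun v => (set_val z v).2) \in conf_set (graph_r (cover_graph2 c)) Y.
Proof. by move=> [_ zr]; rewrite inE => u v; exact: zr. Qed.

Definition cover_pt z c (zc : cover_valid z c) : D (cover_ob c) :=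
  (SigSub (cover_pt_l zc) : conf (graph_l (cover_graph2 c)) X,
   SigSub (cover_pt_r zc) : conf (graph_r (cover_graph2 c)) Y).

Lemma over_base_cover_pt z c (zc : cover_valid z c) : over_base (cover_pt zc) = z.
Proof. by apply: conf_eq => v; rewrite over_baseE /= -surjective_pairing. Qed.

Lemma cover_pt_map z c d (h : cover_hom c d) (zc : cover_valid z c)
    (zd : cover_valid z d) :
  dmap D (cover_ob_map h) (cover_pt zc) = cover_pt zd.
Proof. by congr pair; exact: conf_eq. Qed.

Lemma cover_pt_continuous (Z : topologicalType) (f : Z -> B) c
    (fv : forall w, cover_valid (f w) c) :
  continuous f -> continuous (fun w => cover_pt (fv w)).
Proof.
move=> fc.
have fvc v : continuous (fun w => set_val (f w) v).
  exact: (continuous_comp_fun fc (@conf_eval_continuous A (prod_gspace X Y) v)).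
apply: (@continuous_pair_fun _ _ _
  (fun w => SigSub (cover_pt_l (fv w)) : conf (graph_l (cover_graph2 c)) X)
  (fun w => SigSub (cover_pt_r (fv w)) : conf (graph_r (cover_graph2 c)) Y)).
- by apply: conf_continuous => v; exact: (continuous_comp_fun (fvc v) (@fst_continuous _ _)).
- by apply: conf_continuous => v; exact: (continuous_comp_fun (fvc v) (@snd_continuous _ _)).
Qed.

Lemma unit_pullback_pt (o : over A) (x : D o) (xv : cover_valid (over_base x) (pullback o)) :
  dmap D (pullback_unit o) x = cover_pt xv.
Proof. by case: x xv => x y xv; congr pair; exact: conf_eq. Qed.

(** Because [cover_pt] is determined by [z] and the cover, a point over [z] in a cell of covers is
    given by a chain and barycentric coordinates alone. Basing it along an identity arrow makes the
    results on [bcell] available. *)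
Definition zcell z n (c : functor (ordcat n) (cover_cat A))
    (zc : cover_valid z (c ord0)) (t : simplex R n) : hocolim_space R D :=
  @bcell R _ _ D _ (cover_functor A) (c ord0) (cover_pt zc) n c (idm (c ord0)) t.

Lemma zcell_bcell z q (zq : cover_valid z q) n (c : functor (ordcat n) (cover_cat A))
    (qc : @hom (cover_cat A) q (c ord0)) (zc : cover_valid z (c ord0)) (t : simplex R n) :
  @bcell R _ _ D _ (cover_functor A) q (cover_pt zq) n c qc t = zcell zc t.
Proof.
rewrite /zcell -(cover_pt_map qc zq zc).
exact/esym/(@bcell_rebase R _ _ D _ (@cover_thin A) (cover_functor A) q (c ord0) qc).
Qed.

Lemma zcell_base z n (c : functor (ordcat n) (cover_cat A)) zc (t : simplex R n) :
  hocolim_base (@zcell z n c zc t) = z.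
Proof.
rewrite /zcell /bcell.
rewrite (@hocolim_baseE R G H X Y A n (functor_comp (cover_functor A) c)).
by rewrite over_base_map over_base_cover_pt.
Qed.

(** The two chains may begin at different covers, when the first coordinate of [t] is 0. Both cells
    are based at the join of these covers, which is still valid at [z]. *)
Lemma zcell_support z n (c c' : functor (ordcat n) (cover_cat A)) zc zc'
    (t : simplex R n) :
  (forall k, set_val t k != 0 -> c k = c' k) ->
  @zcell z n c zc t = @zcell z n c' zc' t.
Proof.
move=> cc'; have zq := cover_valid_join zc zc'.
rewrite -(zcell_bcell zq (@cover_join_l _ _ _)) -(zcell_bcell zq (@cover_join_r _ _ _)).
exact: (bcell_support (@cover_thin A)).
Qed.

Lemma zcell_map z m n (theta : functor (ordcat m) (ordcat n))
    (c : functor (ordcat n) (cover_cat A)) zc zc' (t : simplex R m) :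
  @zcell z n c zc (simplex_map theta t) = @zcell z m (functor_comp c theta) zc' t.
Proof.
pose h : @hom (cover_cat A) (c ord0) (functor_comp c theta ord0) :=
  fmap c (ord0_hom (theta ord0)).
rewrite -(zcell_bcell zc h).
exact: (bcell_map (@cover_thin A)).
Qed.

Lemma zcell_continuous (Z : topologicalType) (f : Z -> B) n
    (c : functor (ordcat n) (cover_cat A)) (fv : forall w, cover_valid (f w) (c ord0))
    (t : Z -> simplex R n) :
  continuous f -> continuous t -> continuous (fun w => zcell (fv w) (t w)).
Proof.
move=> fc tc.
apply: (@bcell_continuous R _ _ D (cover_cat A) (cover_functor A) Z (c ord0) n c
  (idm (c ord0)) (fun w => cover_pt (fv w)) t) => //.
exact: cover_pt_continuous.
Qed.

Section first_index.
Variables (n : nat) (c : functor (ordcat n) (cover_cat A)).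

(** A chain may repeat a cover. Moving all the mass of a cover to its first occurrence normalizes
    the coordinates without moving the point. *)
Definition first_index (k : 'I_n.+1) : 'I_n.+1 :=
  [arg min_(j < k | `[< c j = c k >]) (j : nat)].

Lemma first_indexP k : c (first_index k) = c k /\
  forall j, c j = c k -> (first_index k <= j)%N.
Proof.
rewrite /first_index; case: arg_minnP; first exact/asboolP.
by move=> i /asboolP ci imin; split => // j /asboolP /imin.
Qed.

Lemma first_index_eq j k : c j = c k -> first_index j = first_index k.
Proof.
move=> jk; have [cj jmin] := first_indexP j; have [ck kmin] := first_indexP k.
by apply/val_inj/anti_leq; rewrite /= jmin ?kmin // ?cj ?ck.
Qed.

(** If the order were reversed, [c i] would lie between two occurrences of [c j], hence equal [c j]
    by antisymmetry of inclusion, against the minimality of [first_index i]. *)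
Lemma first_index_mono (i j : ordcat n) :
  hom i j -> @hom (ordcat n) (first_index i) (first_index j).
Proof.
move=> ij; have [ci imin] := first_indexP i; have [cj jmin] := first_indexP j.
change (first_index i <= first_index j)%N; rewrite leqNgt; apply/negP => ji.
have ii : (first_index i <= i)%N by exact: imin.
have h1 : @hom (cover_cat A) (c (first_index j)) (c i).
  by apply: fmap; exact: ltnW (leq_trans ji ii).
have h2 : @hom (cover_cat A) (c i) (c (first_index j)) by rewrite cj; exact: fmap.
have E : c (first_index j) = c i.
  by case: h1 h2 => [l1 r1] [l2 r2]; apply: cover_eq => u v; split; auto.
by have := imin _ E; rewrite leqNgt ji.
Qed.

Definition first_functor : functor (ordcat n) (ordcat n) :=
  thin_functor (@ordcat_thin n) first_index_mono.

Lemma zcell_first z zc (t : simplex R n) :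
  @zcell z n c zc t = @zcell z n c zc (simplex_map first_functor t).
Proof.
have zc' : cover_valid z (functor_comp c first_functor ord0).
  by rewrite /= (first_indexP ord0).1.
rewrite (zcell_map zc zc'); apply: zcell_support => k _.
by rewrite /= (first_indexP k).1.
Qed.

Lemma simplex_map_first (t : simplex R n) j :
  set_val (simplex_map first_functor t) j =
  if first_index j == j then \sum_(i | `[< c i = c j >]) set_val t i else 0.
Proof.
rewrite simplex_mapE /=; case: ifP => [/eqP jj|/negbT jj].
  apply: eq_bigl => i; apply/eqP/asboolP => [ij|/first_index_eq -> //].
  by rewrite -ij (first_indexP i).1.
rewrite big1 // => i /eqP ij; case/negP: jj; apply/eqP; rewrite -ij.
exact/first_index_eq/(first_indexP i).1.
Qed.

Lemma zcell_mass z zc (s t : simplex R n) :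
  (forall d, \sum_(i | `[< c i = d >]) set_val s i =
             \sum_(i | `[< c i = d >]) set_val t i :> R) ->
  @zcell z n c zc s = @zcell z n c zc t.
Proof.
move=> st; rewrite zcell_first [RHS]zcell_first; congr zcell.
by apply: simplex_eq => j; rewrite !simplex_map_first st.
Qed.

End first_index.

End cover_cells.

(** * Between the homotopy colimit and weighted configurations *)

Lemma simplex_map_weighted (R : realType) m n (theta : functor (ordcat m) (ordcat n))
    (t : simplex R m) (F : 'I_n.+1 -> R) :
  \sum_j set_val (simplex_map theta t) j * F j = \sum_i set_val t i * F (theta i).
Proof.
rewrite [RHS](partition_big theta predT) //=; apply: eq_bigr => j _.
by rewrite simplex_mapE mulr_suml; apply: eq_bigr => i /eqP ->.
Qed.

Section model_maps.
Variables (R : realType) (G H : topologicalGroupType) (X : gspace G) (Y : gspace H).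
Variable A : graph.
Let V := vertex A.
Let D := over_diagram X Y A.
Let B := conf A (prod_gspace X Y).
Let T := model R X Y A.

(** Value 1 for an edge in the left relation only, 0 in the right only, 1/2 in both. Pairs that are
    not edges also get 1/2. *)
Definition cover_height (c : cover A) (u v : V) : R :=
  (1 + (`[< cover_l c u v >])%:R - (`[< cover_r c u v >])%:R) / 2.

Lemma cover_height01 c u v : 0 <= cover_height c u v <= 1.
Proof. by rewrite /cover_height; do 2 case: asboolP => _; rewrite /=; lra. Qed.

Lemma cover_heightC c u v : cover_height c u v = cover_height c v u.
Proof.
have [ls _] := cover_l_graphical c; have [rs _] := cover_r_graphical c.
have lE : `[< cover_l c u v >] = `[< cover_l c v u >] by apply: asbool_equiv_eq; split; exact: ls.
have rE : `[< cover_r c u v >] = `[< cover_r c v u >] by apply: asbool_equiv_eq; split; exact: rs.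
by rewrite /cover_height lE rE.
Qed.

Lemma chain_le n (c : functor (ordcat n) (cover_cat A)) (i j : 'I_n.+1) :
  (i <= j)%N -> cover_hom (c i) (c j).
Proof. by move=> ij; exact: (@fmap _ _ c i j ij). Qed.

Section chain_model.
Variables (z : B) (n : nat) (c : functor (ordcat n) (cover_cat A)).
Hypothesis zc : cover_valid z (c ord0).
Variable t : simplex R n.

Definition chain_weight u v : R := \sum_i set_val t i * cover_height (c i) u v.

Lemma chain_weight01 u v : 0 <= chain_weight u v <= 1.
Proof.
apply/andP; split.
  apply: sumr_ge0 => i _; rewrite mulr_ge0 ?simplex_ge0 //.
  by have /andP[] := cover_height01 (c i) u v.
rewrite -(simplex_sum1 t); apply: ler_sum => i _.
by rewrite ler_piMr ?simplex_ge0 //; have /andP[] := cover_height01 (c i) u v.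
Qed.

Lemma chain_weightC u v : chain_weight u v = chain_weight v u.
Proof. by apply: eq_bigr => i _; rewrite cover_heightC. Qed.

Lemma chain_valid i : cover_valid z (c i).
Proof. by apply: (cover_valid_hom _ zc); exact: chain_le. Qed.

Lemma chain_weight0 u v : adj u v -> (set_val z u).1 = (set_val z v).1 ->
  chain_weight u v = 0.
Proof.
move=> uv E; rewrite /chain_weight big1 // => i _.
have [zl zr] := chain_valid i; have nl : ~ cover_l (c i) u v by move=> /zl.
have r : cover_r (c i) u v by have /(cover_adj (c i))[] := uv.
by rewrite /cover_height asboolF // asboolT //=; lra.
Qed.

Lemma chain_weight1 u v : adj u v -> (set_val z u).2 = (set_val z v).2 ->
  chain_weight u v = 1.
Proof.
move=> uv E; rewrite -(simplex_sum1 t); apply: eq_bigr => i _.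
have [zl zr] := chain_valid i; have nr : ~ cover_r (c i) u v by move=> /zr.
have l : cover_l (c i) u v by have /(cover_adj (c i))[] := uv.
by rewrite /cover_height asboolT // asboolF //=; lra.
Qed.

Definition chain_model : T :=
  model_pt chain_weight01 chain_weightC chain_weight0 chain_weight1.

Lemma chain_model_weight u v : model_weight chain_model u v = chain_weight u v.
Proof. by []. Qed.

End chain_model.

Definition cell_model (p : hocells R D) : T :=
  @chain_model (@over_base G H X Y A (nerve_first (projT1 p)) (projT2 p).2) _
    (functor_comp (pullback_functor A) (projT2 (projT1 p)))
    (cover_valid_pullback (projT2 p).2) (projT2 p).1.

Definition to_model : hocolim_space R D -> T := hocolim_lift cell_model.

Lemma to_modelE n (sigma : functor (ordcat n) (over A)) (t : simplex R n)
    (x : D (sigma ord0)) :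
  to_model (hopi (hocells_pair t x)) =
  @chain_model (over_base x) n (functor_comp (pullback_functor A) sigma)
    (cover_valid_pullback x) t.
Proof.
rewrite /to_model hocolim_liftE // => {n sigma t x} _ _ [m n theta sigma t x].
apply: model_eq => [|u v]; first exact/esym/over_base_map.
exact: (simplex_map_weighted theta t (fun j => cover_height (pullback (sigma j)) u v)).
Qed.

Lemma to_model_base e : model_base (to_model e) = hocolim_base e.
Proof.
have [[[n sigma] [t x]] ->] := hopi_surj e.
by rewrite (@to_modelE n sigma t x) (@hocolim_baseE R G H X Y A n sigma t x).
Qed.

Lemma to_model_continuous : continuous to_model.
Proof.
apply: hocolim_continuous; apply: hocells_continuous => n sigma.
under eq_fun do rewrite /= to_modelE.
apply: model_continuous => [|u v].
  exact: (continuous_comp_fun (@snd_continuous _ _) (@over_base_continuous _ _ _ _ _ _)).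
under eq_fun do rewrite chain_model_weight /chain_weight.
apply: continuous_sumr => i; apply: continuous_mulr; last exact: continuous_cst.
exact: (continuous_comp_fun (@fst_continuous _ _) (@simplex_coord_continuous R n i)).
Qed.

Section level_cover.
Variables (m : T) (a : R).
Hypothesis a_half : a <= 1 / 2.

Let level_l u v := adj u v /\ a <= model_weight m u v.
Let level_r u v := adj u v /\ model_weight m u v <= 1 - a.

Let adjC u v : adj u v -> @adj A v u.
Proof. by have [+ _] := adj_graphical A; apply. Qed.

Lemma level_l_graphical : graphical level_l.
Proof.
split => [u v [/adjC vu]|v [+ _]]; first by rewrite /level_l model_weightC.
by have [_ +] := adj_graphical A; apply.
Qed.

Lemma level_r_graphical : graphical level_r.
Proof.
split => [u v [/adjC vu]|v [+ _]]; first by rewrite /level_r model_weightC.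
by have [_ +] := adj_graphical A; apply.
Qed.

Lemma level_adj u v : adj u v <-> level_l u v \/ level_r u v.
Proof.
split => [uv|[][] //].
have [aw|wa] := leP a (model_weight m u v); first by left.
right; split => //; have h := a_half; have h2 := ltW wa.
set w := model_weight m u v in h2 *; lra.
Qed.

(** With [a <= 1 / 2] every edge satisfies one of the two inequalities; with [0 < a] the forced
    weights 0 and 1 fall on the permitted side; and as [a] grows both relations shrink, so
    increasing thresholds give a chain. *)
Definition level_cover : cover A := Cover level_l_graphical level_r_graphical level_adj.

Lemma level_cover_l u v :
  cover_l level_cover u v <-> adj u v /\ a <= model_weight m u v.
Proof. by []. Qed.

Lemma level_cover_r u v :
  cover_r level_cover u v <-> adj u v /\ model_weight m u v <= 1 - a.
Proof. by []. Qed.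

Lemma level_cover_valid : 0 < a -> cover_valid (model_base m) level_cover.
Proof.
move=> a0; split => u v [uv aw] E.
  by move: aw; rewrite (model_weight_eq0 uv E) leNgt a0.
by move: aw; rewrite (model_weight_eq1 uv E) leNgt ltrBlDr ltrDl a0.
Qed.

End level_cover.

Lemma level_cover_hom m a b (ha : a <= 1 / 2) (hb : b <= 1 / 2) : a <= b ->
  cover_hom (level_cover m ha) (level_cover m hb).
Proof. by move=> ab; split => u v [uv w]; split => //; lra. Qed.

Section crossing.
Variables (n : nat) (t : simplex R n).

(** The factor 2 undoes the halving in [cover_height]: an edge that lies in the right relation
    throughout, and in the left one with mass [m], has weight [m / 2]. The default [ord_max]
    qualifies because the total mass is 1. *)
Definition crossing (a : R) : 'I_n.+1 :=
  [arg min_(j < ord_max | 2 * a <= \sum_(i < n.+1 | (i <= j)%N) set_val t i) (j : nat)].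

Lemma crossingP a : a <= 1 / 2 ->
  2 * a <= \sum_(i < n.+1 | (i <= crossing a)%N) set_val t i /\
  forall j : 'I_n.+1, 2 * a <= \sum_(i < n.+1 | (i <= j)%N) set_val t i ->
    (crossing a <= j)%N.
Proof.
move=> ha; rewrite /crossing; case: arg_minnP.
  rewrite (eq_bigl predT) => [|i]; last by rewrite /= leq_ord.
  by rewrite simplex_sum1; lra.
by move=> i ci imin; split => // j /imin.
Qed.

Lemma crossing_mono a b : a <= b -> b <= 1 / 2 -> (crossing a <= crossing b)%N.
Proof.
move=> ab hb; have [_ amin] := crossingP (le_trans ab hb); have [bc _] := crossingP hb.
by apply: amin; lra.
Qed.

Lemma crossing_mass a (P : pred 'I_n.+1) : 0 < a -> a <= 1 / 2 ->
  (forall i j : 'I_n.+1, (i <= j)%N -> P j -> P i) ->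
  (2 * a <= \sum_(i | P i) set_val t i) = P (crossing a).
Proof.
move=> a0 ha Pdecr; have [ac amin] := crossingP ha; apply/idP/idP => [aP|Pa].
  apply: contraT => nP.
  have Plt i : P i -> (i < crossing a)%N.
    by move=> Pi; rewrite ltnNge; apply: contra nP => /Pdecr; apply.
  have [c0|c0] := posnP (crossing a).
    move: aP; rewrite big1 => [|i /Plt]; first by lra.
    by rewrite c0.
  (* If [P] fails at [crossing a], all of [P] lies strictly before it, so the predecessor of
     [crossing a] would already reach mass [2 * a]. *)
  have cn : ((crossing a).-1 < n.+1)%N by rewrite (leq_ltn_trans (leq_pred _)).
  have h := amin (Ordinal cn); rewrite /= leqNgt ltn_predL c0 /= in h.
  suff : false by []. apply: h; apply: le_trans aP _.
  rewrite [X in X <= _]big_mkcond [X in _ <= X]big_mkcond /=; apply: ler_sum => i _.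
  case: ifP => [/Plt ilt|_]; first by rewrite ifT // -ltnS (prednK c0).
  by case: ifP => _ //; exact: simplex_ge0.
apply: le_trans ac _.
rewrite [X in X <= _]big_mkcond [X in _ <= X]big_mkcond /=; apply: ler_sum => i _.
case: ifP => [/Pdecr/(_ Pa) -> //|_].
by case: ifP => _ //; exact: simplex_ge0.
Qed.

End crossing.

(** The last cover of the chain is contained in all the others, so each edge stays in the left or in
    the right relation throughout: one of its masses [ml], [mr] is 1 and the weight determines the
    other. Comparing the weight with [a] and [1 - a] then amounts to comparing both masses with
    [2 * a]. This keeps the composite of the two maps inside the simplex of the original chain of
    covers. *)
Lemma level_chain_model z n (c : functor (ordcat n) (cover_cat A))
    (zc : cover_valid z (c ord0)) (t : simplex R n) a (ha : a <= 1 / 2) : 0 < a ->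
  level_cover (chain_model zc t) ha = c (crossing t a).
Proof.
move=> a0.
pose ml u v : R := \sum_(i | `[< cover_l (c i) u v >]) set_val t i.
pose mr u v : R := \sum_(i | `[< cover_r (c i) u v >]) set_val t i.
have mlE u v : (2 * a <= ml u v) <-> cover_l (c (crossing t a)) u v.
  rewrite crossing_mass //; first by split => /asboolP.
  by move=> i j ij /asboolP cj; apply/asboolP; exact: (chain_le c ij).1.
have mrE u v : (2 * a <= mr u v) <-> cover_r (c (crossing t a)) u v.
  rewrite crossing_mass //; first by split => /asboolP.
  by move=> i j ij /asboolP cj; apply/asboolP; exact: (chain_le c ij).2.
have wE u v : chain_weight c t u v = (1 + ml u v - mr u v) / 2.
  rewrite /chain_weight /ml /mr -{1}(simplex_sum1 t) [X in _ + X - _]big_mkcond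
    [X in _ - X]big_mkcond -sumrN -!big_split mulr_suml; apply: eq_bigr => i _.
  by rewrite /cover_height /=; do 2 case: asboolP => _; rewrite /=; lra.
have full u v : adj u v -> ml u v = 1 \/ mr u v = 1.
  move=> /(cover_adj (c ord_max))[l|r]; [left|right]; rewrite -(simplex_sum1 t).
    apply: eq_bigl => i; rewrite asboolT //; exact: (@chain_le n c i ord_max (leq_ord i)).1 u v l.
  apply: eq_bigl => i; rewrite asboolT //; exact: (@chain_le n c i ord_max (leq_ord i)).2 u v r.
have sub (P : pred 'I_n.+1) : \sum_(i | P i) set_val t i <= 1 :> R.
  rewrite -(simplex_sum1 t) [X in X <= _]big_mkcond /=; apply: ler_sum => i _.
  by case: ifP => _ //; exact: simplex_ge0.
have ml1 u v : ml u v <= 1 by exact: sub.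
have mr1 u v : mr u v <= 1 by exact: sub.
apply: cover_eq => u v.
  rewrite level_cover_l chain_model_weight wE -mlE; split => [[uv]|h].
    by case: (full u v uv) => ->; have := mr1 u v; have := ml1 u v; lra.
  have uv : adj u v by apply/(cover_adj (c (crossing t a))); left; apply/mlE.
  by split => //; move: h; case: (full u v uv) => ->; have := mr1 u v; lra.
rewrite level_cover_r chain_model_weight wE -mrE; split => [[uv]|h].
  by case: (full u v uv) => ->; have := mr1 u v; have := ml1 u v; lra.
have uv : adj u v by apply/(cover_adj (c (crossing t a))); right; apply/mrE.
by split => //; move: h; case: (full u v uv) => ->; have := ml1 u v; lra.
Qed.

End model_maps.

(** * The map from weighted configurations to the homotopy colimit *)

Section of_model.
Variables (R : realType) (G H : topologicalGroupType) (X : gspace G) (Y : gspace H).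
Variable A : graph.
Let V := vertex A.
Let D := over_diagram X Y A.
Let B := conf A (prod_gspace X Y).
Let T := model R X Y A.

Variables (N : nat) (e : 'I_N -> V).
Hypothesis e_surj : forall v, exists i, e i = v.

(** One more threshold than there are values [w u v] and [1 - w u v], so that
    some threshold avoids all of them. *)
Let M := #|{: 'I_N * 'I_N * bool}|.

(** [M.+1] evenly spaced points strictly between 0 and 1/2. *)
Definition threshold (k : 'I_M.+1) : R := k.+1%:R / (M.+2 * 2)%:R.

Lemma threshold_gt0 k : 0 < threshold k.
Proof. by rewrite /threshold divr_gt0 // ltr0n. Qed.

Lemma threshold_half k : threshold k <= 1 / 2.
Proof.
rewrite /threshold natrM invfM mulrA ler_wpM2r ?invr_ge0 ?ler0n //.
by rewrite ler_pdivrMr ?ltr0n // mul1r ler_nat ltnS ltnW // ltnS.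
Qed.

Lemma threshold_le j k : (threshold j <= threshold k) = (j <= k)%N.
Proof. by rewrite /threshold ler_pM2r ?invr_gt0 ?ltr0n // ler_nat ltnS. Qed.

Lemma threshold_inj : injective threshold.
Proof.
by move=> j k jk; apply/val_inj/anti_leq; rewrite -!threshold_le jk !lexx.
Qed.

Let w (m : T) (p : 'I_N * 'I_N) := model_weight m (e p.1) (e p.2).

(** The weight of a threshold before normalization: it is 0 precisely when the threshold equals some
    value [w] or [1 - w], that is, where its level cover may jump. *)
Definition gap (m : T) k : R :=
  \prod_p (`|w m p - threshold k| * `|1 - w m p - threshold k|).

Lemma gap_ge0 (m : T) k : 0 <= gap m k.
Proof. by apply: prodr_ge0 => p _; rewrite mulr_ge0 ?normr_ge0. Qed.

Lemma gap_neq0 (m : T) k u v : gap m k != 0 ->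
  model_weight m u v != threshold k /\ model_weight m u v != 1 - threshold k.
Proof.
have [[i <-] [j <-]] := (e_surj u, e_surj v).
move=> /prodf_neq0/(_ (i, j) isT); rewrite mulf_eq0 negb_or !normr_eq0 !subr_eq0 /w /=.
by move=> /andP[-> h]; split => //; apply: contra h => /eqP ->; rewrite opprB addrC subrK.
Qed.

Lemma gap_continuous k : continuous (gap^~ k).
Proof.
apply: continuous_prodr => p.
have wc : continuous (fun m => w m p) by exact: model_weight_continuous.
apply: continuous_mulr; apply: continuous_normr; apply: continuous_subr => //;
  try exact: continuous_cst.
by apply: continuous_subr => //; exact: continuous_cst.
Qed.

Lemma gap_total_gt0 (m : T) : 0 < \sum_k gap m k.
Proof.
rewrite lt_neqAle sumr_ge0 ?andbT => [|k _]; last exact: gap_ge0.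
apply/negP; rewrite eq_sym psumr_eq0 => [/allP g0|k _]; last exact: gap_ge0.
have : forall k, exists p : 'I_N * 'I_N * bool,
    threshold k = if p.2 then w m p.1 else 1 - w m p.1.
  move=> k; have := g0 k (mem_index_enum k); rewrite /= => /prodf_eq0[p _].
  rewrite mulf_eq0 !normr_eq0 !subr_eq0 => /orP[]/eqP E.
    by exists (p, true).
  by exists (p, false).
move=> /choice[f fP].
have f_inj : injective f by move=> j k fjk; apply: threshold_inj; rewrite !fP fjk.
by have := leq_card f f_inj; rewrite card_ord ltnn.
Qed.

Lemma level_simplex_ge0 (m : T) k : 0 <= gap m k / \sum_j gap m j.
Proof. by rewrite divr_ge0 ?gap_ge0 // ltW // gap_total_gt0. Qed.

Lemma level_simplex_sum (m : T) : \sum_k gap m k / \sum_j gap m j = 1.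
Proof. by rewrite -mulr_suml mulfV // gt_eqF // gap_total_gt0. Qed.

Definition level_simplex (m : T) : simplex R M :=
  simplex_pt (level_simplex_ge0 m) (level_simplex_sum m).

Lemma level_simplex_continuous : continuous level_simplex.
Proof.
apply: simplex_continuous => k /=; apply: continuous_mulr; first exact: gap_continuous.
apply: continuous_invr => [m|]; first by rewrite gt_eqF // gap_total_gt0.
by apply: continuous_sumr => j; exact: gap_continuous.
Qed.

Definition level (m : T) k : cover A := level_cover m (threshold_half k).

Lemma level_mono (m : T) (j k : ordcat M) : hom j k -> @hom (cover_cat A) (level m j) (level m k).
Proof. by move=> jk; apply: level_cover_hom; rewrite threshold_le. Qed.

Definition level_chain (m : T) : functor (ordcat M) (cover_cat A) :=
  thin_functor (@cover_thin A) (@level_mono m).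

Definition of_model (m : T) : hocolim_space R D :=
  @zcell R G H X Y A (model_base m) M (level_chain m)
    (level_cover_valid m (threshold_half ord0) (threshold_gt0 ord0)) (level_simplex m).

Lemma of_model_base (m : T) : hocolim_base (of_model m) = model_base m.
Proof. exact: zcell_base. Qed.

(** The closed set where [c] is the chain of level covers of [m], up to the ties
    between weights and thresholds. *)
Definition level_region (c : functor (ordcat M) (cover_cat A)) : set T :=
  [set m | forall k u v, adj u v ->
    (if `[< cover_l (c k) u v >] then threshold k <= model_weight m u v
     else model_weight m u v <= threshold k) /\
    (if `[< cover_r (c k) u v >] then model_weight m u v <= 1 - threshold k
     else 1 - threshold k <= model_weight m u v)].

Lemma level_region_closed c : closed (level_region c).
Proof.
have -> : level_region c = \bigcap_(k in setT) \bigcap_(u in setT)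
    \bigcap_(v in [set v | adj u v])
    ([set m | if `[< cover_l (c k) u v >] then threshold k <= model_weight m u v
      else model_weight m u v <= threshold k] `&`
     [set m | if `[< cover_r (c k) u v >] then model_weight m u v <= 1 - threshold k
      else 1 - threshold k <= model_weight m u v]).
  by apply/seteqP; split => m h k; [move=> _ u _ v uv|move=> u v uv];
    apply: h.
apply: closed_bigI => k _; apply: closed_bigI => u _; apply: closed_bigI => v _.
have wc := @model_weight_continuous R G H X Y A u v.
apply: closedI; case: asboolP => _; apply: closed_le_continuous => //;
  exact: continuous_cst.
Qed.

Lemma level_region_chain (m : T) : level_region (level_chain m) m.
Proof.
move=> k u v uv; split; case: asboolP => //=.
- by move=> h; have [] := h.
- by move=> h; rewrite leNgt; apply/negP => /ltW kw; apply: h; split.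
- by move=> h; have [] := h.
- by move=> h; rewrite leNgt; apply/negP => /ltW kw; apply: h; split.
Qed.

Lemma level_region_valid c (m : T) : level_region c m -> cover_valid (model_base m) (c ord0).
Proof.
move=> cm; have t0 := threshold_gt0 ord0; split => u v cuv E.
  have uv : adj u v by apply/(cover_adj (c ord0)); left.
  have [+ _] := cm ord0 u v uv; rewrite asboolT // (model_weight_eq0 uv E).
  by rewrite leNgt t0.
have uv : adj u v by apply/(cover_adj (c ord0)); right.
have [_ +] := cm ord0 u v uv; rewrite asboolT // (model_weight_eq1 uv E).
by rewrite lerBrDr gerDl leNgt t0.
Qed.

Lemma level_region_agree c (m : T) k : level_region c m -> gap m k != 0 -> level m k = c k.
Proof.
move=> cm g0; apply: cover_eq => u v.
  rewrite level_cover_l; split => [[uv kw]|cuv].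
    have [+ _] := cm k u v uv; case: asboolP => // _ wk.
    by have [/eqP[]] := gap_neq0 u v g0; apply/le_anti; rewrite wk kw.
  have uv : adj u v by apply/(cover_adj (c k)); left.
  by split => //; have [+ _] := cm k u v uv; rewrite asboolT.
rewrite level_cover_r; split => [[uv kw]|cuv].
  have [_ +] := cm k u v uv; case: asboolP => // _ wk.
  by have [_ /eqP[]] := gap_neq0 u v g0; apply/le_anti; rewrite wk kw.
have uv : adj u v by apply/(cover_adj (c k)); right.
by split => //; have [_ +] := cm k u v uv; rewrite asboolT.
Qed.

Lemma of_model_region c (m : T) (cm : level_region c m) :
  of_model m = zcell (level_region_valid cm) (level_simplex m).
Proof.
apply: zcell_support => k; rewrite simplex_ptE => gk; apply: level_region_agree => //.
by apply: contra gk => /eqP ->; rewrite mul0r.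
Qed.

Lemma of_model_continuous_region c : {within level_region c, continuous of_model}.
Proof.
apply/subspace_sigL_continuousP.
have -> : sigL (level_region c) of_model = fun m : level_region c =>
    zcell (level_region_valid (set_valP m)) (level_simplex (set_val m)).
  by apply/funext => m; exact: of_model_region.
apply: (@zcell_continuous R G H X Y A _ (fun m : level_region c => model_base (set_val m))
  M c (fun m => level_region_valid (set_valP m)) (fun m => level_simplex (set_val m))).
- exact: (continuous_comp_fun (@set_val_continuous _ _) (@model_base_continuous _ _ _ _ _ _)).
- exact: (continuous_comp_fun (@set_val_continuous _ _) level_simplex_continuous).
Qed.

(** Only finitely many chains of level covers occur, since [type] determines the chain. Their closed
    regions cover [T], and on each of them a single fixed chain describes [of_model]. *)
Lemma of_model_continuous : continuous of_model.
Proof.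
pose type (m : T) : {ffun 'I_M.+1 * 'I_N * 'I_N -> bool * bool} := [ffun p =>
  (`[< cover_l (level m p.1.1) (e p.1.2) (e p.2) >],
   `[< cover_r (level m p.1.1) (e p.1.2) (e p.2) >])].
have typeP m m' : type m = type m' -> level_chain m = level_chain m'.
  move=> mm'; apply: thin_functor_eq => [|k]; first exact: cover_thin.
  apply: cover_eq => u v; have [[i <-] [j <-]] := (e_surj u, e_surj v).
    have /(congr1 fst) := congr1 (fun f : {ffun _} => f (k, i, j)) mm'.
    by rewrite !ffunE /= => E; split => /asboolP h; apply/asboolP; rewrite ?E // -E.
  have /(congr1 snd) := congr1 (fun f : {ffun _} => f (k, i, j)) mm'.
  by rewrite !ffunE /= => E; split => /asboolP h; apply/asboolP; rewrite ?E // -E.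
pose F kappa := [set m | exists2 m0, type m0 = kappa & level_region (level_chain m0) m].
have FE m0 : F (type m0) = level_region (level_chain m0).
  apply/seteqP; split => [m [m1 /typeP -> //]|m ?]; by exists m0.
have FP kappa : F kappa = set0 \/ exists m0, F kappa = level_region (level_chain m0).
  have [[m0 <-]|h] := pselect (exists m0, type m0 = kappa); first by right; exists m0.
  by left; apply/seteqP; split => // m [m0 h0 _]; case: h; exists m0.
apply: (@paste_continuous _ _ _ F) => [kappa|m|kappa].
- by have [->|[m0 ->]] := FP kappa; [exact: closed0|exact: level_region_closed].
- by exists (type m); rewrite FE; exact: level_region_chain.
- have [->|[m0 ->]] := FP kappa; first exact: continuous_subspace0.
  exact: of_model_continuous_region.
Qed.

Definition level_gap (m : T) k (d : cover A) : R :=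
  if `[< level m k = d >] then gap m k else 0.

Let pos (x : R) := Num.max 0 x.
Let pos_continuous (Z : topologicalType) (f : Z -> R) :
  continuous f -> continuous (fun z => pos (f z)).
Proof. by move=> fc; apply: continuous_maxr => //; exact: continuous_cst. Qed.

Let pos_ge x : 0 <= x -> pos x = `|x|.
Proof. by move=> x0; rewrite /pos max_r // ger0_norm. Qed.

Let pos_le x : x <= 0 -> pos x = 0.
Proof. by move=> x0; rewrite /pos max_l. Qed.

(** The indicator of [level m k = d] jumps only where [gap m k] vanishes. Concretely, on each edge
    the distances to the threshold are replaced by positive parts of signed distances, with the sign
    that [d] prescribes: they agree when the level cover is [d], and some factor is 0 otherwise. *)
Lemma level_gap_continuous k d : continuous (fun m => level_gap m k d).
Proof.
pose fac (m : T) (p : 'I_N * 'I_N) : R :=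
  (if `[< adj (e p.1) (e p.2) >] then
     (if `[< cover_l d (e p.1) (e p.2) >] then pos (w m p - threshold k)
      else pos (threshold k - w m p)) *
     (if `[< cover_r d (e p.1) (e p.2) >] then pos (1 - w m p - threshold k)
      else pos (threshold k - (1 - w m p)))
   else `|w m p - threshold k| * `|1 - w m p - threshold k|).
have -> : (fun m => level_gap m k d) = (fun m => \prod_p fac m p).
  apply/funext => m; rewrite /level_gap; case: asboolP => [E|nE].
    apply: eq_bigr => p _; rewrite /fac; case: asboolP => // uv; congr (_ * _).
      have := level_cover_l m (threshold_half k) (e p.1) (e p.2).
      rewrite -/(level m k) E /w => dP; case: asboolP => [/dP[_ kw]|nl].
        by rewrite pos_ge // subr_ge0.
      rewrite distrC pos_ge // subr_ge0 leNgt; apply/negP => /ltW kw.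
      by apply: nl; apply/dP.
    have := level_cover_r m (threshold_half k) (e p.1) (e p.2).
    rewrite -/(level m k) E /w => dP; case: asboolP => [/dP[_ kw]|nl].
      by rewrite pos_ge //; lra.
    rewrite distrC pos_ge // subr_ge0 leNgt; apply/negP => /ltW kw.
    by apply: nl; apply/dP; split => //; lra.
  (* If no factor vanished, every edge would lie strictly on the side prescribed by [d], and the
     level cover would be [d]. *)
  have [p p0] : exists p, fac m p = 0; last by rewrite (bigD1 p) //= p0 mul0r.
  apply: contra_notP nE => /forallNP fac0; apply: cover_eq => u v;
    have [[i <-] [j <-]] := (e_surj u, e_surj v); have := fac0 (i, j); rewrite /fac /=.
  - case: asboolP => uv; last first.
      by move=> _; split => h; case: uv; [have [] := h|apply/(cover_adj d); left].
    case: asboolP => h h0; last first.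
      by split => // -[_ kw]; case: h0; rewrite pos_le ?mul0r // subr_le0.
    split => // _; split => //; rewrite leNgt; apply/negP => wk; apply: h0.
    by rewrite pos_le ?mul0r // subr_le0 ltW.
  - case: asboolP => uv; last first.
      by move=> _; split => h; case: uv; [have [] := h|apply/(cover_adj d); right].
    case: (asboolP (cover_r _ _ _)) => h h0; last first.
      by split => // -[_ kw]; case: h0; rewrite [X in _ * X]pos_le ?mulr0 // /w /=; lra.
    split => // _; split => //; rewrite leNgt; apply/negP => wk; apply: h0.
    by rewrite [X in _ * X]pos_le ?mulr0 // /w /=; lra.
apply: continuous_prodr => p; rewrite /fac.
have wc : continuous (fun m => w m p) by exact: model_weight_continuous.
have w1c : continuous (fun m => 1 - w m p).
  by apply: continuous_subr => //; exact: continuous_cst.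
have tc : continuous (fun _ : T => threshold k) by exact: continuous_cst.
case: (`[< adj _ _ >]); last first.
  by apply: continuous_mulr; apply: continuous_normr; exact: continuous_subr.
apply: continuous_mulr.
  by case: (`[< cover_l _ _ _ >]); apply: pos_continuous; exact: continuous_subr.
by case: (`[< cover_r _ _ _ >]); apply: pos_continuous; exact: continuous_subr.
Qed.

Lemma level_mass_continuous d :
  continuous (fun m => \sum_(k | `[< level m k = d >]) set_val (level_simplex m) k : R).
Proof.
have -> : (fun m => \sum_(k | `[< level m k = d >]) set_val (level_simplex m) k : R) =
    (fun m => (\sum_k level_gap m k d) / \sum_j gap m j).
  apply/funext => m; rewrite big_mkcond mulr_suml; apply: eq_bigr => k _.
  by rewrite simplex_ptE /level_gap; case: ifP => //; rewrite mul0r.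
apply: continuous_mulr.
  by apply: continuous_sumr => k; exact: level_gap_continuous.
apply: continuous_invr => [m|]; first by rewrite gt_eqF // gap_total_gt0.
by apply: continuous_sumr => j; exact: gap_continuous.
Qed.

Section chain_level.
Variables (z : B) (n : nat) (c : functor (ordcat n) (cover_cat A)).
Hypothesis zc : cover_valid z (c ord0).
Variable t : simplex R n.

Lemma crossing_threshold_mono (j k : ordcat M) :
  hom j k -> @hom (ordcat n) (crossing t (threshold j)) (crossing t (threshold k)).
Proof. by move=> jk; apply: crossing_mono (threshold_half k); rewrite threshold_le. Qed.

Definition crossing_functor : functor (ordcat M) (ordcat n) :=
  thin_functor (@ordcat_thin n) crossing_threshold_mono.

(** The push-forward along [crossing_functor] alone is not continuous in [t]: inside a block of
    equal covers the crossing index can move without any tie between weight and threshold. Gathering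
    the mass at first occurrences leaves coordinates that are masses of level covers, and these are
    continuous. *)
Definition chain_level : simplex R n :=
  simplex_map (first_functor c) (simplex_map crossing_functor
    (level_simplex (chain_model zc t))).

Lemma of_model_chain : of_model (chain_model zc t) = zcell zc chain_level.
Proof.
rewrite -zcell_first.
have zc' : cover_valid z (functor_comp c crossing_functor ord0).
  exact: (chain_valid zc (crossing_functor ord0)).
rewrite (zcell_map zc zc'); apply: zcell_support => k _.
exact/level_chain_model/threshold_gt0.
Qed.

Lemma chain_level_mass d : \sum_(i | `[< c i = d >]) (set_val chain_level i : R) =
  \sum_(k | `[< level (chain_model zc t) k = d >])
    set_val (level_simplex (chain_model zc t)) k.
Proof.
rewrite !simplex_map_sum; apply: eq_bigl => k /=.
rewrite (first_indexP c _).1; congr (`[< _ = _ >]); apply/esym.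
exact/level_chain_model/threshold_gt0.
Qed.

Lemma chain_levelE j : set_val chain_level j =
  if first_index c j == j then
    \sum_(k | `[< level (chain_model zc t) k = c j >])
      set_val (level_simplex (chain_model zc t)) k
  else 0.
Proof.
rewrite simplex_map_first; case: ifP => // _; rewrite -chain_level_mass [RHS]simplex_map_sum.
by apply: eq_bigl => k /=; rewrite (first_indexP c _).1.
Qed.

End chain_level.

(** The linear motion respects the gluing. The coordinates themselves need not correspond, as
    [theta] may skip the first occurrence of a cover in [c]; the mass of each cover does, and by
    [zcell_mass] this suffices. *)
Lemma zcell_line_map z m n (theta : functor (ordcat m) (ordcat n))
    (c : functor (ordcat n) (cover_cat A)) (zc : cover_valid z (c ord0))
    (zc' : cover_valid z (functor_comp c theta ord0)) (s : unit_interval R)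
    (t : simplex R m) :
  zcell zc (simplex_line s (simplex_map theta t) (chain_level zc (simplex_map theta t))) =
  zcell zc' (simplex_line s t (chain_level zc' t)).
Proof.
have E : chain_model zc (simplex_map theta t) = chain_model zc' t.
  apply: model_eq => // u v.
  exact: (simplex_map_weighted theta t (fun j => cover_height R (c j) u v)).
rewrite -(zcell_map zc zc'); apply: zcell_mass => d.
rewrite simplex_map_sum.
under eq_bigr do rewrite simplex_ptE.
under [RHS]eq_bigr do rewrite simplex_ptE.
rewrite !big_split /= -!mulr_sumr chain_level_mass E simplex_map_sum.
by congr (_ + _ * _); rewrite -chain_level_mass.
Qed.

End of_model.

(** * Natural transformations induce homotopies *)

Lemma functor_eq (A B : category) (o : A -> B)
    (m m' : forall a b, hom a b -> hom (o a) (o b)) p1 pM q1 qM :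
  (forall a b f, m a b f = m' a b f) ->
  @Functor A B o m p1 pM = @Functor A B o m' q1 qM.
Proof.
move=> mm'; have E : m = m' by do 3 apply/functional_extensionality_dep => ?; exact: mm'.
by subst m'; exact: functor_irr.
Qed.

Lemma bcell_comp (R : realType) (K : topologicalGroupType) (C : category)
    (D : diagram C K) (P Q : category) (J : functor Q C) (Phi : functor P Q)
    (q : P) (y : D (J (Phi q))) n (c : functor (ordcat n) P) (qc : hom q (c ord0))
    (t : simplex R n) :
  @bcell R K C D P (functor_comp J Phi) q y n c qc t =
  @bcell R K C D Q J (Phi q) y n (functor_comp Phi c) (fmap Phi qc) t.
Proof.
rewrite /bcell; set x := dmap D _ y; congr (hopi _).
apply: (@hocells_pair_eq R K C D C (fun c => D c) id (fun=> id) n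
  (functor_comp (functor_comp J Phi) c)
  (functor_comp J (functor_comp Phi c)) t _ erefl erefl x).
exact: functor_irr.
Qed.

(** * Prism decomposition by cutting a simplex at a cumulative mass *)

Section cut.
Variable R : realType.

Section weights.
Variables (n : nat) (t : simplex R n).

Definition cumul (i : nat) : R := \sum_(j < n.+1 | (j < i)%N) set_val t j.

Lemma cumul0 : cumul 0 = 0.
Proof. by rewrite /cumul big1. Qed.

Lemma cumul_max : cumul n.+1 = 1.
Proof. by rewrite -(simplex_sum1 t); apply: eq_bigl => j; rewrite ltn_ord. Qed.

Lemma cumulS (i : 'I_n.+1) : cumul i.+1 = cumul i + set_val t i.
Proof.
rewrite /cumul (bigD1 i) //= addrC; congr (_ + _); apply: eq_bigl => j.
by rewrite ltnS [RHS]ltn_neqAle andbC.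
Qed.

Lemma cumul_le i j : (i <= j)%N -> cumul i <= cumul j.
Proof.
move=> ij; rewrite /cumul [X in X <= _]big_mkcond [X in _ <= X]big_mkcond /=.
apply: ler_sum => k _; case: ifP => [ki|_]; first by rewrite (leq_trans ki ij).
by case: ifP => _ //; exact: simplex_ge0.
Qed.

Lemma cumul_ge0 i : 0 <= cumul i.
Proof. by rewrite -cumul0 cumul_le. Qed.

Lemma cumul_le1 i : (i <= n.+1)%N -> cumul i <= 1.
Proof. by move=> ni; rewrite -cumul_max cumul_le. Qed.

Variable r : R.

(** Barycentric coordinates are read as lengths of consecutive intervals filling [0, 1]; [below] and
    [above] are the lengths of the two pieces of an interval cut at [r]. In the prism the first
    piece stays in the bottom layer and the second goes to the top layer. *)
Definition below i : R := Num.min (cumul i.+1) r - Num.min (cumul i) r.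
Definition above i : R := Num.max (cumul i.+1) r - Num.max (cumul i) r.

Lemma below_ge0 i : 0 <= below i.
Proof.
by rewrite subr_ge0 le_min !ge_min lexx cumul_le //= orbT.
Qed.

Lemma above_ge0 i : 0 <= above i.
Proof.
by rewrite subr_ge0 ge_max !le_max lexx cumul_le //= orbT.
Qed.

Lemma below_eq0 i : r <= cumul i -> below i = 0.
Proof. by move=> ri; rewrite /below !min_r ?subrr // (le_trans ri) // cumul_le. Qed.

Lemma above_eq0 i : cumul i.+1 <= r -> above i = 0.
Proof. by move=> ri; rewrite /above !max_r ?subrr // (le_trans _ ri) // cumul_le. Qed.

Lemma cut_sum k : (k <= n)%N -> 0 <= r <= 1 -> cumul k <= r <= cumul k.+1 ->
  \sum_(l < n.+2) (if (l <= k)%N then below l else above l.-1) = 1.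
Proof.
move=> kn /andP[r0 r1] /andP[kr rk].
rewrite -(big_mkord predT (fun l => if (l <= k)%N then below l else above l.-1)).
rewrite (@big_cat_nat _ _ _ k.+1) //=; last by rewrite !ltnS (leq_trans kn).
rewrite (@eq_big_nat _ _ _ 0 k.+1 _ below) => [|l /andP[_ lk]]; last first.
  by rewrite -ltnS lk.
rewrite telescope_sumr // big_add1 /=.
rewrite (@eq_big_nat _ _ _ k n.+1 _ above) => [|l /andP[kl _]]; last first.
  by rewrite ltnNge kl.
rewrite telescope_sumr ?(leqW kn) // cumul_max cumul0.
rewrite (min_r rk) (min_l r0) (max_l r1) (max_r kr); lra.
Qed.

End weights.

Lemma cumul_continuous n i : continuous (fun t : simplex R n => cumul t i).
Proof. by apply: continuous_sumr => j; exact: simplex_coord_continuous. Qed.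

Lemma cumul_map m n (theta : functor (ordcat m) (ordcat n)) (t : simplex R m) i :
  cumul (simplex_map theta t) i = \sum_(j < m.+1 | (theta j < i)%N) set_val t j.
Proof. exact: (simplex_map_sum theta t (fun j => (j < i)%N)). Qed.

Lemma functor_ordcat_le m n (theta : functor (ordcat m) (ordcat n)) (i j : 'I_m.+1) :
  (i <= j)%N -> (theta i <= theta j)%N.
Proof. by move=> ij; exact: (@fmap _ _ theta i j ij). Qed.

(** The preimage of an initial segment is an initial segment [alpha]. *)
Lemma telescope_map m n (theta : functor (ordcat m) (ordcat n)) (t : simplex R m)
    (f : R -> R) i :
  \sum_(j < m.+1 | (theta j < i)%N) (f (cumul t j.+1) - f (cumul t j)) =
  f (cumul (simplex_map theta t) i) - f 0.
Proof.
have [alpha aP] : exists2 alpha, (alpha <= m.+1)%N &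
    forall j : 'I_m.+1, (theta j < i)%N = (j < alpha)%N.
  have [h|h] := pselect (exists j : 'I_m.+1, (i <= theta j)%N); last first.
    exists m.+1 => // j; rewrite ltn_ord ltnNge; apply/negP => ij.
    by apply: h; exists j.
  have [j0 hj0] := h.
  pose a := [arg min_(j < j0 | (i <= theta j)%N) (j : nat)].
  have [ai amin] : (i <= theta a)%N /\ forall j, (i <= theta j)%N -> (a <= j)%N.
    by rewrite /a; case: arg_minnP.
  exists a; first exact: ltnW.
  move=> j; apply/idP/idP => [ji|ja].
    rewrite ltnNge; apply/negP => aj.
    by have := leq_trans ai (functor_ordcat_le theta aj); rewrite leqNgt ji.
  by rewrite ltnNge; apply/negP => /amin; rewrite leqNgt ja.
move=> thetaE.
have -> : cumul (simplex_map theta t) i = cumul t alpha.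
  by rewrite cumul_map; apply: eq_bigl.
have f0 : f 0 = f (cumul t 0) by rewrite cumul0.
rewrite (eq_bigl _ _ thetaE) f0.
rewrite -(telescope_sumr (f \o cumul t) (leq0n alpha)) /= big_mkord.
by rewrite (big_ord_widen m.+1 (fun j => f (cumul t j.+1) - f (cumul t j))).
Qed.

(** With [f] the minimum or the maximum with [r], this says that cutting at [r] commutes with
    pushing forward along a monotone map. *)
Lemma telescope_map_eq m n (theta : functor (ordcat m) (ordcat n)) (t : simplex R m)
    (f : R -> R) (l : nat) :
  \sum_(j < m.+1 | (theta j == l :> nat)%N) (f (cumul t j.+1) - f (cumul t j)) =
  f (cumul (simplex_map theta t) l.+1) - f (cumul (simplex_map theta t) l).
Proof.
have := telescope_map theta t f l.+1.
rewrite (bigID (fun j => theta j < l)%N) /=.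
rewrite (eq_bigl (fun j => theta j < l)%N) => [|j]; last first.
  by rewrite andb_idl // => /ltnW; rewrite ltnS.
rewrite telescope_map => E.
rewrite (eq_bigl (fun j => (theta j < l.+1)%N && ~~ (theta j < l)%N)) => [|j]; last first.
  by rewrite -leqNgt ltnS eqn_leq.
by lra.
Qed.

End cut.

(** The poset [n] x [1], and the prism chains (0,0) < ... < (k,0) < (k,1) < ... < (n,1). *)
Section prism_poset.
Variable n : nat.

Definition prism_hom (p q : 'I_n.+1 * bool) : Prop := (p.1 <= q.1)%N /\ (p.2 ==> q.2).

Lemma prism_hom_refl p : prism_hom p p.
Proof. by split => //; exact: implybb. Qed.

Lemma prism_hom_trans p q r : prism_hom q r -> prism_hom p q -> prism_hom p r.
Proof.
move=> [qr1 qr2] [pq1 pq2]; split; first exact: leq_trans pq1 qr1.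
by apply/implyP => /(implyP pq2)/(implyP qr2).
Qed.

Definition prism : category :=
  @Category ('I_n.+1 * bool)%type prism_hom prism_hom_refl
    (fun p q r => @prism_hom_trans p q r)
    (fun _ _ _ => Prop_irrelevance _ _) (fun _ _ _ => Prop_irrelevance _ _)
    (fun _ _ _ _ _ _ _ => Prop_irrelevance _ _).

Lemma prism_thin : thin prism.
Proof. by move=> p q f g; exact: (@Prop_irrelevance (prism_hom p q)). Qed.

Definition prism_chain_ob (k : 'I_n.+1) (l : 'I_n.+2) : prism :=
  if (l <= k)%N then (inord l, false) else (inord l.-1, true).

Lemma prism_chain_mono (k : 'I_n.+1) (i j : ordcat n.+1) :
  hom i j -> hom (prism_chain_ob k i) (prism_chain_ob k j).
Proof.
move=> ij; have {}ij : (i <= j)%N := ij.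
have kn : (k <= n)%N by rewrite -ltnS.
have jn : (j <= n.+1)%N by rewrite -ltnS.
rewrite /prism_chain_ob; split; last by do 2 case: ifP => //=; lia.
case: (leqP j k) => jk; first by rewrite (leq_trans ij jk) /= !inordK; lia.
by case: (leqP i k) => ik; rewrite /= !inordK; lia.
Qed.

Definition prism_chain (k : 'I_n.+1) : functor (ordcat n.+1) prism :=
  thin_functor prism_thin (prism_chain_mono k).

Lemma prism_layer_mono (b : bool) (i j : ordcat n) :
  hom i j -> @hom prism (i, b) (j, b).
Proof. by move=> ij; split => //=; exact: implybb. Qed.

Definition prism_layer (b : bool) : functor (ordcat n) prism :=
  @thin_functor (ordcat n) prism prism_thin (fun i => (i, b)) (prism_layer_mono b).

Definition prism_bottom : prism := (ord0, false).

Lemma prism_bottom_hom (p : prism) : hom prism_bottom p.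
Proof. by []. Qed.

End prism_poset.

Lemma prism_map_mono m n (theta : functor (ordcat m) (ordcat n)) (p q : prism m) :
  hom p q -> @hom (prism n) (theta p.1, p.2) (theta q.1, q.2).
Proof. by move=> [h1 h2]; split => //; exact: functor_ordcat_le. Qed.

Definition prism_map m n (theta : functor (ordcat m) (ordcat n)) :
    functor (prism m) (prism n) :=
  @thin_functor (prism m) (prism n) (@prism_thin n) (fun p => (theta p.1, p.2))
    (prism_map_mono theta).

Section prism_weights.
Variables (R : realType) (n : nat).

(** Moving [r] into the interval [k] gives a simplex point for every [r] and [k], hence a formula
    that is continuous everywhere and correct where [r] already lies in that interval. *)
Definition cut_clamp (t : simplex R n) (k : nat) (r : R) : R :=
  Num.max (cumul t k) (Num.min (cumul t k.+1) r).

Lemma cut_clamp_id t k r : cumul t k <= r <= cumul t k.+1 -> cut_clamp t k r = r.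
Proof. by move=> /andP[kr rk]; rewrite /cut_clamp min_r // max_r. Qed.

Lemma cut_clampP t (k : 'I_n.+1) r :
  0 <= cut_clamp t k r <= 1 /\ cumul t k <= cut_clamp t k r <= cumul t k.+1.
Proof.
have h : cumul t k <= cut_clamp t k r <= cumul t k.+1.
  by rewrite /cut_clamp le_max lexx ge_max cumul_le //= ge_min lexx.
split => //; case/andP: h => h1 h2.
by rewrite (le_trans (cumul_ge0 t k) h1) (le_trans h2 (cumul_le1 t _)).
Qed.

Definition prism_weight (t : simplex R n) (r : R) (k : 'I_n.+1) (l : 'I_n.+2) : R :=
  if (l <= k)%N then below t (cut_clamp t k r) l else above t (cut_clamp t k r) l.-1.

Lemma prism_weight_ge0 t r k l : 0 <= prism_weight t r k l.
Proof. by rewrite /prism_weight; case: ifP => _; [exact: below_ge0|exact: above_ge0]. Qed.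

Lemma prism_weight_sum t r k : \sum_l prism_weight t r k l = 1.
Proof. by have [h1 h2] := cut_clampP t k r; apply: cut_sum => //; rewrite -ltnS. Qed.

Definition prism_simplex t r k : simplex R n.+1 :=
  simplex_pt (prism_weight_ge0 t r k) (prism_weight_sum t r k).

Lemma prism_simplexE t r (k : 'I_n.+1) l : cumul t k <= r <= cumul t k.+1 ->
  set_val (prism_simplex t r k) l = if (l <= k)%N then below t r l else above t r l.-1.
Proof. by move=> h; rewrite simplex_ptE /prism_weight cut_clamp_id. Qed.

Lemma prism_simplex_continuous (Z : topologicalType) (t : Z -> simplex R n) (r : Z -> R) k :
  continuous t -> continuous r -> continuous (fun z => prism_simplex (t z) (r z) k).
Proof.
move=> tc rc.
have cc i : continuous (fun z => cumul (t z) i).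
  exact: (continuous_comp_fun tc (@cumul_continuous R n i)).
have clc : continuous (fun z => cut_clamp (t z) k (r z)).
  by apply: continuous_maxr => //; exact: continuous_minr.
apply: simplex_continuous => l.
have -> : (fun z => set_val (prism_simplex (t z) (r z) k) l : R) = (fun z =>
    if (l <= k)%N then below (t z) (cut_clamp (t z) k (r z)) l
    else above (t z) (cut_clamp (t z) k (r z)) l.-1) by [].
by case: (l <= k)%N; apply: continuous_subr;
  [exact: continuous_minr|exact: continuous_minr|
   exact: continuous_maxr|exact: continuous_maxr].
Qed.

Lemma cut_index_exists (t : simplex R n) r : 0 <= r <= 1 ->
  exists k : 'I_n.+1, cumul t k <= r <= cumul t k.+1.
Proof.
move=> /andP[r0 r1].
have max_ok : r <= cumul t (ord_max : 'I_n.+1).+1 by rewrite cumul_max.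
pose k : 'I_n.+1 := [arg min_(k < ord_max | r <= cumul t k.+1) (k : nat)].
have [rk kmin] : r <= cumul t k.+1 /\
    forall j : 'I_n.+1, r <= cumul t j.+1 -> (k <= j)%N.
  by rewrite /k; case: arg_minnP.
exists k; rewrite rk andbT; have [k0|k0] := posnP k; first by rewrite k0 cumul0.
rewrite leNgt; apply/negP => /ltW rk'.
have kn : (k.-1 < n.+1)%N by rewrite (leq_ltn_trans (leq_pred _)).
by have := kmin (Ordinal kn); rewrite /= (prednK k0) rk' leqNgt ltn_predL k0 => /(_ isT).
Qed.

End prism_weights.

Section prism_reindex.
Variables (m n : nat) (theta : functor (ordcat m) (ordcat n)) (k : 'I_m.+1).

(** Positions after [k] belong to the top layer, where the index in the chain is one more than the
    vertex; this explains both the predecessor and the successor. *)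
Definition prism_reindex_ob (j : 'I_m.+2) : 'I_n.+2 :=
  inord (if (j <= k)%N then theta (inord j) : nat else (theta (inord j.-1)).+1).

Lemma prism_reindex_val (j : 'I_m.+2) : prism_reindex_ob j =
  (if (j <= k)%N then theta (inord j) : nat else (theta (inord j.-1)).+1) :> nat.
Proof.
rewrite /prism_reindex_ob inordK //; case: ifP => _; last by rewrite ltnS.
exact: leqW.
Qed.

Lemma prism_reindex_mono (i j : ordcat m.+1) :
  hom i j -> @hom (ordcat n.+1) (prism_reindex_ob i) (prism_reindex_ob j).
Proof.
move=> ij; have {}ij : (i <= j)%N := ij.
change (prism_reindex_ob i <= prism_reindex_ob j)%N; rewrite !prism_reindex_val.
have km : (k <= m)%N by rewrite -ltnS.
have jm : (j <= m.+1)%N by rewrite -ltnS.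
case: (leqP j k) => jk.
  by rewrite (leq_trans ij jk); apply: functor_ordcat_le; rewrite !inordK; lia.
case: (leqP i k) => ik; last first.
  by rewrite ltnS; apply: functor_ordcat_le; rewrite !inordK; lia.
by apply: leqW; apply: functor_ordcat_le; rewrite !inordK; lia.
Qed.

Definition prism_reindex : functor (ordcat m.+1) (ordcat n.+1) :=
  thin_functor (@ordcat_thin n.+1) prism_reindex_mono.

Lemma prism_reindex_chain j :
  prism_map theta (prism_chain k j) = prism_chain (theta k) (prism_reindex j).
Proof.
have km : (k <= m)%N by rewrite -ltnS.
have jm : (j <= m.+1)%N by rewrite -ltnS.
rewrite /= /prism_chain_ob prism_reindex_val; case: (leqP j k) => jk /=.
  rewrite ifT ?inord_val //; apply: functor_ordcat_le; rewrite inordK; lia.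
rewrite ifF ?inord_val //; apply/negbTE; rewrite -ltnNge ltnS.
by apply: functor_ordcat_le; rewrite inordK; lia.
Qed.

Lemma cumul_map_cut (R : realType) (t : simplex R m) r :
  cumul t k <= r <= cumul t k.+1 ->
  cumul (simplex_map theta t) (theta k) <= r <=
    cumul (simplex_map theta t) (theta k).+1.
Proof.
move=> /andP[kr1 kr2].
rewrite !cumul_map; apply/andP; split.
  apply: le_trans _ kr1; rewrite [X in X <= _]big_mkcond [X in _ <= X]big_mkcond /=.
  apply: ler_sum => j _; case: ifP => [jk|_].
    rewrite ifT // ltnNge; apply/negP => kj.
    by have := functor_ordcat_le theta kj; rewrite leqNgt jk.
  by case: ifP => _ //; exact: simplex_ge0.
apply: le_trans kr2 _; rewrite [X in X <= _]big_mkcond [X in _ <= X]big_mkcond /=.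
apply: ler_sum => j _; case: ifP => [jk|_].
  by rewrite ifT // ltnS; apply: functor_ordcat_le.
by case: ifP => _ //; exact: simplex_ge0.
Qed.

(** Intervals after [k] have no piece below [r], and those before [k] none above it. The sum over a
    fibre of the reindexing can therefore be completed to the sum over a whole fibre of [theta],
    which telescopes. *)
Lemma prism_reindex_simplex (R : realType) (t : simplex R m) r :
  cumul t k <= r <= cumul t k.+1 ->
  simplex_map prism_reindex (prism_simplex t r k) =
  prism_simplex (simplex_map theta t) r (theta k).
Proof.
move=> kr; have /andP[kr1 kr2] := kr.
have km : (k <= m)%N by rewrite -ltnS.
have kr' := cumul_map_cut kr.
apply: simplex_eq => l; rewrite prism_simplexE // simplex_mapE.
under eq_bigr do rewrite prism_simplexE //.
have val_eq (j : 'I_m.+2) : (prism_reindex j == l) =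
    ((if (j <= k)%N then theta (inord j) : nat else (theta (inord j.-1)).+1) == l).
  by rewrite -prism_reindex_val.
under eq_bigl do rewrite val_eq.
rewrite big_mkcond /=; case: (leqP l (theta k)) => lk.
  rewrite big_ord_recr /= ifN; last first.
    rewrite leqNgt ltnS km /= gtn_eqF // ltnS (leq_trans lk) //.
    by apply: functor_ordcat_le; rewrite inordK.
  rewrite addr0; transitivity (\sum_(j < m.+1 | (theta j == l :> nat)%N) below t r j);
    last exact: (telescope_map_eq theta t (fun x => Num.min x r) l).
  rewrite [RHS]big_mkcond /=; apply: eq_bigr => j _; rewrite inord_val; case: (leqP j k) => jk //.
  rewrite (@below_eq0 _ _ t r j) ?if_same; last by rewrite (le_trans kr2) // cumul_le.
  rewrite ifN // gtn_eqF // ltnS (leq_trans lk) //; apply: functor_ordcat_le.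
  by rewrite inordK; have := ltn_ord j; lia.
have l0 : (0 < l)%N by exact: leq_trans lk.
rewrite big_ord_recl /= ifN; last first.
  rewrite ltn_eqF // (leq_ltn_trans _ lk) //; apply: functor_ordcat_le.
  by rewrite inordK.
transitivity (\sum_(j < m.+1 | (theta j == l.-1 :> nat)%N) above t r j); last first.
  exact: (telescope_map_eq theta t (fun x => Num.max x r) l.-1).
rewrite add0r [RHS]big_mkcond /=.
apply: eq_bigr => j _; rewrite /bump /= add1n /= inord_val.
case: (ltnP j k) => jk; last by rewrite add0n -{1}(prednK l0) eqSS.
rewrite (@above_eq0 _ _ t r j) ?if_same; last by rewrite (le_trans _ kr1) // cumul_le.
rewrite ifN // ltn_eqF // (leq_ltn_trans _ lk) //; apply: functor_ordcat_le.
by rewrite inordK //; have := ltn_ord k; lia.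
Qed.

End prism_reindex.

(** Continuity can be tested on cells because the product of the quotient map with a compact
    Hausdorff [S] still detects continuity. *)
Lemma hocolim_homotopy_continuous (R : realType) (K : topologicalGroupType)
    (C : category) (D : diagram C K) (S W : topologicalType) (F : S -> hocells R D -> W) :
  compact [set: S] -> hausdorff_space S ->
  (forall s p q, hoglue p q -> F s p = F s q) ->
  (forall n (sigma : functor (ordcat n) C),
    continuous (fun q : S * (simplex R n * D (sigma ord0)) =>
      F q.1 (hocells_pair q.2.1 q.2.2))) ->
  continuous (fun c : S * hocolim_space R D => hocolim_lift (F c.1) c.2).
Proof.
move=> cS hS Fglue Fc; apply: hocolim_prod_continuous => //=.
have -> : (fun q : S * hocells R D => hocolim_lift (F q.1) (hopi q.2)) =
    (fun q => F q.1 q.2).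
  by apply/funext => q; apply: hocolim_liftE => p p'; exact: Fglue.
by apply: prod_hocells_continuous => n sigma; exact: Fc.
Qed.

Lemma bcell_functor (R : realType) (K : topologicalGroupType) (C Q : category)
    (D : diagram C K) (o : Q -> C) (m m' : forall a b, hom a b -> hom (o a) (o b))
    p1 pM q1 qM (q : Q) (y : D (o q)) n (c : functor (ordcat n) Q) (qc : hom q (c ord0))
    (t : simplex R n) :
  (forall a b f, m a b f = m' a b f) ->
  @bcell R K C D Q (@Functor Q C o m p1 pM) q y n c qc t =
  @bcell R K C D Q (@Functor Q C o m' q1 qM) q y n c qc t.
Proof.
move=> mm'; have E : m = m' by do 3 apply/functional_extensionality_dep => ?; exact: mm'.
by subst m'; rewrite (Prop_irrelevance p1 q1) (Prop_irrelevance pM qM).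
Qed.

(** * The homotopy along the prisms of a chain *)

Section natural_homotopy.
Variables (R : realType) (K : topologicalGroupType) (C : category) (D : diagram C K).
Variables (F : functor C C) (eta : forall c, hom c (F c)).
Hypothesis eta_natural : forall a b (g : hom a b),
  compm (fmap F g) (eta a) = compm (eta b) g.

(** The action on arrows of the functor from C x [1] to C that [F] and [eta] amount to; prisms are
    mapped into C through it. *)
Definition cyl_map (a b : C) (d e : bool) (g : hom a b) :
    d ==> e -> hom (if d then F a else a) (if e then F b else b) :=
  match d, e return d ==> e -> hom (if d then F a else a) (if e then F b else b) with
  | true, true => fun=> fmap F g
  | true, false => fun h => match notF h with end
  | false, true => fun=> compm (fmap F g) (eta a)
  | false, false => fun=> g
  end.

Lemma cyl_map1 a d (h : d ==> d) : cyl_map (idm a) h = idm (if d then F a else a).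
Proof. by case: d h => h //=; exact: fmap1. Qed.

Lemma cyl_mapM a b c d e f (g : hom b c) (g' : hom a b) (h : d ==> f) (h1 : e ==> f)
    (h2 : d ==> e) :
  cyl_map (compm g g') h = compm (cyl_map g h1) (cyl_map g' h2).
Proof.
case: d e f h h1 h2 => [] [] [] //= _ _ _; first exact: fmapM.
  by rewrite fmapM compmA.
by rewrite fmapM -!compmA eta_natural.
Qed.

Section chain.
Variables (n : nat) (sigma : functor (ordcat n) C).

Definition prism_ob (p : prism n) : C := if p.2 then F (sigma p.1) else sigma p.1.

Definition prism_arr (p q : prism n) (h : hom p q) : hom (prism_ob p) (prism_ob q) :=
  cyl_map (@fmap _ _ sigma p.1 q.1 h.1) h.2.

Lemma prism_arr1 p : prism_arr (idm p) = idm (prism_ob p).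
Proof.
rewrite /prism_arr (_ : fmap sigma _ = idm (sigma p.1)); first exact: cyl_map1.
by rewrite -fmap1; congr (fmap sigma _); exact: bool_irrelevance.
Qed.

Lemma prism_arrM p q r (g : hom q r) (f : hom p q) :
  prism_arr (compm g f) = compm (prism_arr g) (prism_arr f).
Proof.
transitivity (cyl_map (compm (@fmap _ _ sigma q.1 r.1 g.1) (@fmap _ _ sigma p.1 q.1 f.1))
  (compm g f).2); last exact: cyl_mapM.
rewrite /prism_arr -fmapM; congr (cyl_map (fmap sigma _) _).
exact: bool_irrelevance.
Qed.

Definition prism_functor : functor (prism n) C :=
  Functor prism_arr1 prism_arrM.

Definition prism_cell (x : D (sigma ord0)) (t : simplex R n) (r : R) (k : 'I_n.+1) :
    hocolim_space R D :=
  @bcell R K C D (prism n) prism_functor (prism_bottom n) x n.+1 (prism_chain k)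
    (prism_bottom_hom _) (prism_simplex t r k).

(** If [r] lies in the intervals [k] and [k'], no mass separates them: at the positions where the
    two prism chains differ, the coordinate is 0. *)
Lemma prism_cell_indep x t r (k k' : 'I_n.+1) :
  cumul t k <= r <= cumul t k.+1 -> cumul t k' <= r <= cumul t k'.+1 ->
  prism_cell x t r k = prism_cell x t r k'.
Proof.
wlog kk' : k k' / (k <= k')%N => [hw kr kr'|].
  by case: (leqP k k') => [|/ltnW] kk'; [exact: hw|apply/esym; exact: hw].
move=> kr kr'; have /andP[_ rk] := kr; have /andP[kr2 _] := kr'.
have u0 (l : 'I_n.+2) : (k < l)%N -> (l <= k')%N ->
    below t r l = 0 /\ above t r l.-1 = 0.
  move=> kl lk; split; first by apply: below_eq0; rewrite (le_trans rk) // cumul_le.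
  by apply: above_eq0; rewrite prednK ?(leq_ltn_trans _ kl) // (le_trans _ kr2) // cumul_le.
have E : prism_simplex t r k = prism_simplex t r k'.
  apply: simplex_eq => l; rewrite !prism_simplexE //.
  case: (leqP l k) => lk; first by rewrite (leq_trans lk kk').
  by case: (leqP l k') => // lk'; have [-> ->] := u0 l lk lk'.
rewrite /prism_cell -E; apply: (bcell_support (@prism_thin n)) => l.
rewrite prism_simplexE // /= /prism_chain_ob; case: (leqP l k) => lk.
  by rewrite (leq_trans lk kk').
by case: (leqP l k') => // lk'; have [_ ->] := u0 l lk lk'; rewrite eqxx.
Qed.

Lemma prism_cell_continuous k : continuous
  (fun q : unit_interval R * (simplex R n * D (sigma ord0)) =>
    prism_cell q.2.2 q.2.1 (1 - set_val q.1) k).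
Proof.
have c1 : continuous (fun q : unit_interval R * (simplex R n * D (sigma ord0)) => q.2.1).
  exact: (continuous_comp_fun (@snd_continuous _ _) (@fst_continuous _ _)).
have c2 : continuous (fun q : unit_interval R * (simplex R n * D (sigma ord0)) => q.2.2).
  exact: (continuous_comp_fun (@snd_continuous _ _) (@snd_continuous _ _)).
apply: (@bcell_continuous R K C D (prism n) prism_functor _ (prism_bottom n) n.+1
  (prism_chain k) (prism_bottom_hom _)
  (fun q : unit_interval R * (simplex R n * D (sigma ord0)) => q.2.2)
  (fun q => prism_simplex q.2.1 (1 - set_val q.1) k)) => //.
apply: prism_simplex_continuous => //; apply: continuous_subr.
  exact: continuous_cst.
exact: (unit_val_continuous (@fst_continuous _ _)).
Qed.

(** Cutting at 1 leaves all the mass in the bottom layer; the only top vertex of the last prism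
    chain gets coordinate 0, so the point lies on a face. *)
Lemma prism_cell_start x t : prism_cell x t 1 ord_max = hopi (hocells_pair t x).
Proof.
have widen_mono (i j : ordcat n) : hom i j ->
    @hom (ordcat n.+1) (widen_ord (leqnSn n.+1) i) (widen_ord (leqnSn n.+1) j) by [].
pose delta := thin_functor (@ordcat_thin n.+1) widen_mono.
have tE : prism_simplex t 1 ord_max = simplex_map delta t.
  apply: simplex_eq => l; rewrite prism_simplexE; last first.
    by rewrite cumul_max lexx cumul_le1.
  rewrite simplex_mapE; case: (leqP l n) => ln.
    have ln' : (l < n.+1)%N by [].
    rewrite (big_pred1 (Ordinal ln')) => [|i]; last by rewrite -!val_eqE.
    rewrite /below !min_l ?cumul_le1 // ?(leqW ln) //.
    by rewrite (@cumulS _ _ t (Ordinal ln')); lra.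
  rewrite big1 => [|i /eqP/(congr1 val) /= il]; last by have := ltn_ord i; lia.
  by apply: above_eq0; rewrite prednK ?(leq_ltn_trans _ ln) // cumul_le1 // -ltnS.
rewrite /prism_cell tE (bcell_map (@prism_thin n) _ _ (prism_bottom_hom _)).
rewrite (bcell_eq (@prism_thin n) (c' := prism_layer n false) _ _ (prism_bottom_hom _)).
  rewrite /bcell; have -> : dmap D (fmap prism_functor
      (prism_bottom_hom (prism_layer n false ord0))) x = x.
    rewrite -[RHS](@dmap1 _ _ D (sigma ord0)); congr (dmap D _ x); rewrite -fmap1.
    by congr (fmap sigma _); exact: bool_irrelevance.
  congr (hopi _).
  apply: (@hocells_pair_eq R K C D C (fun c => D c) id (fun=> id) n
    (functor_comp prism_functor (prism_layer n false)) sigma t _ erefl erefl x).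
  apply: functor_eq => i j ij; rewrite /= /prism_arr /=.
  by congr (fmap sigma _); exact: bool_irrelevance.
move=> i; rewrite /= /prism_chain_ob ifT; last by rewrite /= leq_ord.
by congr pair; exact: inord_val.
Qed.

Lemma prism_cell_end x t : prism_cell x t 0 ord0 =
  hopi (@hocells_pair R K C D n (functor_comp F sigma) t (dmap D (eta (sigma ord0)) x)).
Proof.
have shift_mono (i j : ordcat n) : hom i j ->
    @hom (ordcat n.+1) (lift ord0 i) (lift ord0 j) by [].
pose delta := thin_functor (@ordcat_thin n.+1) shift_mono.
have tE : prism_simplex t 0 ord0 = simplex_map delta t.
  apply: simplex_eq => l; rewrite prism_simplexE; last by rewrite cumul0 lexx cumul_ge0.
  rewrite simplex_mapE leqn0; case: (unliftP ord0 l) => [j|] -> /=.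
    rewrite (big_pred1 j) => [|i]; last by rewrite /= (inj_eq lift_inj).
    rewrite /bump /= add0n /above !max_l ?cumul_ge0 //.
    by rewrite cumulS; lra.
  rewrite big1 => [|i /eqP/(congr1 val) //].
  by apply: below_eq0; rewrite cumul_ge0.
rewrite /prism_cell tE (bcell_map (@prism_thin n) _ _ (prism_bottom_hom _)).
rewrite (bcell_eq (@prism_thin n) (c' := prism_layer n true) _ _ (prism_bottom_hom _)).
  rewrite /bcell; have -> : dmap D (fmap prism_functor
      (prism_bottom_hom (prism_layer n true ord0))) x = dmap D (eta (sigma ord0)) x.
    congr (dmap D _ x); rewrite /= /prism_arr /=.
    rewrite (_ : fmap sigma _ = idm (sigma ord0)) ?fmap1 ?comp1m //.
    by rewrite -fmap1; congr (fmap sigma _); exact: bool_irrelevance.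
  congr (hopi _).
  apply: (@hocells_pair_eq R K C D C (fun c => D c) id (fun=> id) n
    (functor_comp prism_functor (prism_layer n true)) (functor_comp F sigma) t _
    erefl erefl (dmap D (eta (sigma ord0)) x)).
  apply: functor_eq => i j ij; rewrite /= /prism_arr /=.
  by congr (fmap F (fmap sigma _)); exact: bool_irrelevance.
by move=> i; rewrite /= /prism_chain_ob /= /bump /= add0n inord_val.
Qed.

End chain.

Lemma prism_cell_map m n (theta : functor (ordcat m) (ordcat n))
    (sigma : functor (ordcat n) C) (x : D (sigma ord0)) (t : simplex R m) r (k : 'I_m.+1) :
  cumul t k <= r <= cumul t k.+1 ->
  prism_cell x (simplex_map theta t) r (theta k) =
  @prism_cell m (functor_comp sigma theta)
    (dmap D (@fmap _ _ sigma ord0 (theta ord0) (leq0n (theta ord0))) x) t r k.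
Proof.
move=> kr; rewrite /prism_cell -prism_reindex_simplex //.
set x' := dmap D _ x.
rewrite (bcell_map (@prism_thin n) _ _ (prism_bottom_hom _)).
have x'E : x' = dmap D (fmap (prism_functor sigma)
    (prism_bottom_hom (prism_map theta (prism_bottom m)))) x.
  by congr (dmap D _ x); congr (fmap sigma _); exact: bool_irrelevance.
transitivity (@bcell R K C D (prism m) (functor_comp (prism_functor sigma) (prism_map theta))
  (prism_bottom m) x' m.+1 (prism_chain k) (prism_bottom_hom _) (prism_simplex t r k));
  last first.
  apply: bcell_functor => p q h; rewrite /= /prism_arr /=.
  by congr (cyl_map (fmap sigma _) _); exact: bool_irrelevance.
rewrite (@bcell_comp R K C D (prism m) (prism n) (prism_functor sigma) (prism_map theta)
  (prism_bottom m) x') x'E.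
rewrite (@bcell_rebase R K C D (prism n) (@prism_thin n) (prism_functor sigma)
  (prism_bottom n) (prism_map theta (prism_bottom m)) _ x m.+1 _ (prism_bottom_hom _)).
apply: (bcell_eq (@prism_thin n)) => j.
exact/esym/prism_reindex_chain.
Qed.

(** At time [s] the simplex is cut at [1 - s]. The last clause says that a point is only ever
    replaced by its image under an arrow of C, so any function invariant under these arrows, such as
    the projection to configurations, is constant along the homotopy. *)
Lemma natural_homotopy : exists h : unit_interval R * hocolim_space R D -> hocolim_space R D,
  [/\ continuous h, forall z, h (unit0 R, z) = z,
    forall n (sigma : functor (ordcat n) C) (t : simplex R n) (x : D (sigma ord0)),
      h (unit1 R, hopi (hocells_pair t x)) =
      hopi (@hocells_pair R K C D n (functor_comp F sigma) t (dmap D (eta (sigma ord0)) x))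
  & forall s n (sigma : functor (ordcat n) C) (t : simplex R n) (x : D (sigma ord0)),
      exists m (tau : functor (ordcat m) C) (t' : simplex R m)
        (g : hom (sigma ord0) (tau ord0)),
        h (s, hopi (hocells_pair t x)) = hopi (@hocells_pair R K C D m tau t' (dmap D g x))].
Proof.
have r01 (s : unit_interval R) : 0 <= 1 - (set_val s : R) <= 1.
  by have := unit_intervalP s; lra.
(* An arbitrary choice of interval containing the cut, with no continuity; [prism_cell_indep] shows
   that the cell does not depend on it. *)
pose k s n (t : simplex R n) := projT1 (cid (cut_index_exists t (r01 s))).
have kP s n (t : simplex R n) : cumul t (k s n t) <= 1 - set_val s <= cumul t (k s n t).+1.
  by rewrite /k; case: cid.
pose f (s : unit_interval R) (p : hocells R D) : hocolim_space R D :=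
  @prism_cell (projT1 (projT1 p)) (projT2 (projT1 p)) (projT2 p).2 (projT2 p).1
    (1 - set_val s) (k s _ (projT2 p).1).
have fE s n (sigma : functor (ordcat n) C) (t : simplex R n) (x : D (sigma ord0)) (j : 'I_n.+1) :
    cumul t j <= 1 - set_val s <= cumul t j.+1 ->
    f s (hocells_pair t x) = prism_cell x t (1 - set_val s) j.
  by move=> jP; apply: prism_cell_indep => //; exact: kP.
have fglue s p q : hoglue p q -> f s p = f s q.
  case=> {p q} m n theta sigma t x; have jP := kP s m t.
  rewrite (fE s m _ t _ (k s m t)) // -prism_cell_map //; apply: fE.
  exact: cumul_map_cut.
exists (fun c => hocolim_lift (f c.1) c.2).
have hE s n (sigma : functor (ordcat n) C) (t : simplex R n) (x : D (sigma ord0)) :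
    hocolim_lift (f s) (hopi (hocells_pair t x)) = f s (hocells_pair t x).
  by apply: hocolim_liftE => p q; exact: fglue.
split.
- apply: hocolim_homotopy_continuous => //.
  + exact: unit_interval_compact.
  + exact: unit_interval_hausdorff.
  + move=> n sigma.
    have tc j : continuous (fun q : unit_interval R * (simplex R n * D (sigma ord0)) =>
        cumul q.2.1 j).
      apply: (continuous_comp_fun _ (@cumul_continuous R n j)).
      exact: (continuous_comp_fun (@snd_continuous _ _) (@fst_continuous _ _)).
    have rc : continuous (fun q : unit_interval R * (simplex R n * D (sigma ord0)) =>
        1 - set_val q.1 : R).
      apply: continuous_subr; first exact: continuous_cst.
      exact: (unit_val_continuous (@fst_continuous _ _)).
    apply: (@paste_continuous _ _ 'I_n.+1 (fun j => [set q | cumul q.2.1 j <= 1 - set_val q.1]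
      `&` [set q | 1 - set_val q.1 <= cumul q.2.1 j.+1])) => [j|q|j].
    * by apply: closedI; exact: closed_le_continuous.
    * by have /andP[? ?] := kP q.1 n q.2.1; exists (k q.1 n q.2.1).
    * apply: within_continuous_eq (continuous_within (@prism_cell_continuous n sigma j)).
      by move=> q [h1 h2]; apply/esym/fE; rewrite h1 h2.
- move=> z; have [[[n sigma] [t x]] ->] := hopi_surj z.
  rewrite (hE (unit0 R) n sigma t x) -prism_cell_start.
  have r1 : 1 - set_val (unit0 R) = 1 :> R by rewrite unit_ptE subr0.
  rewrite (fE _ _ _ _ _ ord_max) ?r1 //.
  by rewrite cumul_max lexx cumul_le1.
- move=> n sigma t x; rewrite hE -prism_cell_end.
  have r0 : 1 - set_val (unit1 R) = 0 :> R by rewrite unit_ptE subrr.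
  by rewrite (fE _ _ _ _ _ ord0) ?r0 // cumul0 lexx cumul_ge0.
- move=> s n sigma t x; rewrite hE.
  exists n.+1, (functor_comp (prism_functor sigma) (prism_chain (k s n t))),
    (prism_simplex t (1 - set_val s) (k s n t)),
    (fmap (prism_functor sigma) (prism_bottom_hom (prism_chain (k s n t) ord0))).
  by [].
Qed.

End natural_homotopy.

(** * The comparison map *)

Section model_homotopy.
Variables (R : realType) (G H : topologicalGroupType) (X : gspace G) (Y : gspace H).
Variable A : graph.
Let D := over_diagram X Y A.
Let B := conf A (prod_gspace X Y).
Variables (N : nat) (e : 'I_N -> vertex A).
Hypothesis e_surj : forall v, exists i, e i = v.

Lemma chain_model_continuous (Z : topologicalType) (f : Z -> B) n
    (c : functor (ordcat n) (cover_cat A)) (fv : forall w, cover_valid (f w) (c ord0))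
    (t : Z -> simplex R n) :
  continuous f -> continuous t -> continuous (fun w => chain_model (fv w) (t w)).
Proof.
move=> fc tc; apply: model_continuous => [//|u v].
under eq_fun do rewrite chain_model_weight /chain_weight.
apply: continuous_sumr => i; apply: continuous_mulr; last exact: continuous_cst.
exact: (continuous_comp_fun tc (@simplex_coord_continuous R n i)).
Qed.

Lemma chain_level_continuous (Z : topologicalType) (f : Z -> B) n
    (c : functor (ordcat n) (cover_cat A)) (fv : forall w, cover_valid (f w) (c ord0))
    (t : Z -> simplex R n) :
  continuous f -> continuous t -> continuous (fun w => chain_level e (fv w) (t w)).
Proof.
move=> fc tc; apply: simplex_continuous => j.
under eq_fun do rewrite chain_levelE.
case: (first_index c j == j); last exact: continuous_cst.
exact: (continuous_comp_fun (@chain_model_continuous Z f n c fv t fc tc)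
  (@level_mass_continuous R G H X Y A N e e_surj (c j))).
Qed.

Lemma simplex_line_continuous (Z : topologicalType) n (s : Z -> unit_interval R)
    (t t' : Z -> simplex R n) : continuous s -> continuous t -> continuous t' ->
  continuous (fun z => simplex_line (s z) (t z) (t' z)).
Proof.
move=> sc tc tc'; have sc' := unit_val_continuous sc.
apply: simplex_continuous => i /=; apply: continuous_addr; apply: continuous_mulr => //.
- by apply: continuous_subr => //; exact: continuous_cst.
- exact: (continuous_comp_fun tc (@simplex_coord_continuous R n i)).
- exact: (continuous_comp_fun tc' (@simplex_coord_continuous R n i)).
Qed.

Definition level_line z n (c : functor (ordcat n) (cover_cat A))
    (zc : cover_valid z (c ord0)) (s : unit_interval R) (t : simplex R n) :
    hocolim_space R D :=
  zcell zc (simplex_line s t (chain_level e zc t)).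

Lemma level_line_eq z z' n (c c' : functor (ordcat n) (cover_cat A))
    (zc : cover_valid z (c ord0)) (zc' : cover_valid z' (c' ord0)) s t :
  z = z' -> c = c' -> level_line zc s t = level_line zc' s t.
Proof. by move=> E E'; subst z' c'; rewrite (Prop_irrelevance zc zc'). Qed.

Lemma level_homotopy : exists h : unit_interval R * hocolim_space R D -> hocolim_space R D,
  [/\ continuous h,
    forall n (sigma : functor (ordcat n) (over A)) (t : simplex R n) (x : D (sigma ord0)),
      h (unit0 R, hopi (hocells_pair t x)) =
      @zcell R G H X Y A _ n (functor_comp (pullback_functor A) sigma)
        (cover_valid_pullback x) t,
    forall z, h (unit1 R, z) = of_model e (to_model z)
  & forall s z, hocolim_base (h (s, z)) = hocolim_base z].
Proof.
pose f s (p : hocells R D) : hocolim_space R D :=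
  @level_line (@over_base G H X Y A (nerve_first (projT1 p)) (projT2 p).2) _
    (functor_comp (pullback_functor A) (projT2 (projT1 p)))
    (cover_valid_pullback (projT2 p).2) s (projT2 p).1.
have fglue s p q : hoglue p q -> f s p = f s q.
  case=> {p q} m n theta sigma t x; rewrite /f /=.
  have zc' : cover_valid (over_base x)
      (functor_comp (functor_comp (pullback_functor A) sigma) theta ord0).
    exact: (@chain_valid G H X Y A _ n (functor_comp (pullback_functor A) sigma)
      (cover_valid_pullback x) (theta ord0)).
  transitivity (level_line zc' s t); first exact: zcell_line_map.
  apply: level_line_eq; first exact/esym/over_base_map.
  by apply: thin_functor_eq => //; exact: cover_thin.
have hE s n (sigma : functor (ordcat n) (over A)) (t : simplex R n) (x : D (sigma ord0)) :
    hocolim_lift (f s) (hopi (hocells_pair t x)) =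
    @level_line (over_base x) n (functor_comp (pullback_functor A) sigma)
      (cover_valid_pullback x) s t.
  by rewrite hocolim_liftE // => p q; exact: fglue.
exists (fun c => hocolim_lift (f c.1) c.2); split.
- apply: hocolim_homotopy_continuous => //.
  + exact: unit_interval_compact.
  + exact: unit_interval_hausdorff.
  + move=> n sigma.
    have c1 : continuous
        (fun q : unit_interval R * (simplex R n * D (sigma ord0)) => q.2.1).
      exact: (continuous_comp_fun (@snd_continuous _ _) (@fst_continuous _ _)).
    have c2 : continuous (fun q : unit_interval R * (simplex R n * D (sigma ord0)) =>
        over_base q.2.2).
      apply: (continuous_comp_fun _ (@over_base_continuous G H X Y A (sigma ord0))).
      exact: (continuous_comp_fun (@snd_continuous _ _) (@snd_continuous _ _)).
    refine (@zcell_continuous R G H X Y A _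
      (fun q : unit_interval R * (simplex R n * D (sigma ord0)) => over_base q.2.2)
      n (functor_comp (pullback_functor A) sigma)
      (fun q => cover_valid_pullback q.2.2)
      (fun q => simplex_line q.1 q.2.1
        (@chain_level R G H X Y A N e _ n (functor_comp (pullback_functor A) sigma)
          (cover_valid_pullback q.2.2) q.2.1)) c2 _).
    apply: simplex_line_continuous => //; first exact: fst_continuous.
    exact: (@chain_level_continuous _
      (fun q : unit_interval R * (simplex R n * D (sigma ord0)) => over_base q.2.2) n
      (functor_comp (pullback_functor A) sigma) (fun q => cover_valid_pullback q.2.2)
      (fun q => q.2.1)).
- move=> n sigma t x; rewrite hE /level_line; congr zcell.
  by apply: simplex_eq => i; rewrite simplex_ptE unit_ptE subr0 mul1r mul0r addr0.
- move=> z; have [[[n sigma] [t x]] ->] := hopi_surj z.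
  rewrite (hE (unit1 R) n sigma t x) (@to_modelE R G H X Y A n sigma t x).
  rewrite of_model_chain /level_line; congr zcell.
  by apply: simplex_eq => i; rewrite simplex_ptE unit_ptE subrr mul1r mul0r add0r.
- move=> s z; have [[[n sigma] [t x]] ->] := hopi_surj z.
  rewrite (hE s n sigma t x) /level_line zcell_base.
  by rewrite (@hocolim_baseE R G H X Y A n sigma t x).
Qed.

Lemma model_homotopy : exists h : unit_interval R * hocolim_space R D -> hocolim_space R D,
  [/\ continuous h, forall z, h (unit0 R, z) = z,
    forall z, h (unit1 R, z) = of_model e (to_model z)
  & forall s z, hocolim_base (h (s, z)) = hocolim_base z].
Proof.
have [h [hc h0 h1 hs]] := @natural_homotopy R (G * H)%type (over A) D
  (functor_comp (cover_functor A) (pullback_functor A)) (@pullback_unit A)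
  (@pullback_unit_natural A).
have [k [kc k0 k1 kb]] := level_homotopy.
have hb s z : hocolim_base (h (s, z)) = hocolim_base z.
  have [[[n sigma] [t x]] ->] := hopi_surj z.
  have [m [tau [t' [g ->]]]] := hs s n sigma t x.
  rewrite (@hocolim_baseE R G H X Y A m tau t') over_base_map.
  by rewrite (@hocolim_baseE R G H X Y A n sigma t x).
have [|l [lc l0 l1 lhk]] := concat_homotopy hc kc.
  move=> z; have [[[n sigma] [t x]] ->] := hopi_surj z.
  rewrite (h1 n sigma t x) (k0 n sigma t x) /zcell /bcell.
  (* The homotopies meet: pushing [x] along the unit of the pullback gives the point that its
     underlying configuration determines over the pulled back cover. *)
  have -> : dmap D (fmap (cover_functor A) (idm (c0 := cover_cat A)
      (functor_comp (pullback_functor A) sigma ord0))) (cover_pt (cover_valid_pullback x)) =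
      dmap D (pullback_unit (sigma ord0)) x.
    by rewrite fmap1 dmap1 (unit_pullback_pt (cover_valid_pullback x)).
  congr (hopi _).
  apply: (@hocells_pair_eq R _ (over A) D (over A) (fun c => D c) id (fun=> id) n
    (functor_comp (functor_comp (cover_functor A) (pullback_functor A)) sigma)
    (functor_comp (cover_functor A) (functor_comp (pullback_functor A) sigma)) t _
    erefl erefl (dmap D (pullback_unit (sigma ord0)) x)).
  exact: functor_irr.
exists l; split => //.
- by move=> z; rewrite l0.
- by move=> z; rewrite l1.
- by move=> s z; have [s' [->|->]] := lhk s z.
Qed.

End model_homotopy.

Lemma hocolim_base_weak_equivalence (R : realType) (G H : topologicalGroupType)
    (X : gspace G) (Y : gspace H) (A : graph) :
  hausdorff_space X -> hausdorff_space Y ->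
  weak_homotopy_equivalence R (@hocolim_base R G H X Y A).
Proof.
move=> hX hY.
have [N [e e_surj]] : exists N (e : 'I_N -> vertex A), forall v, exists i, e i = v.
  have /finite_setP[N /card_set_bijP[f [fN f_inj f_surj]]] := vertex_finite A.
  have [e eP] : {e : 'I_N -> vertex A & forall i, f (e i) = i}.
    by apply: (@choice _ _ (fun (i : 'I_N) v => f v = i)) => i;
      have [v _ <-] := f_surj i (ltn_ord i); exists v.
  exists N, e => v; exists (Ordinal (fN v I)).
  by apply: f_inj; rewrite ?inE // eP.
have [h [hc h0 h1 hb]] := model_homotopy R X Y e_surj.
apply: collar_lifting_weak_equivalence.
- exact: hocolim_base_continuous.
- move=> b; have [m <-] := @model_base_surj R G H X Y A b.
  by exists (of_model e m); exact: of_model_base.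
- apply: (@retract_collar_lifting R _ _ (model R X Y A) _ (@model_base R G H X Y A)
    (@to_model R G H X Y A) (of_model e) h) => //.
  + exact: to_model_continuous.
  + exact: of_model_continuous.
  + exact: of_model_base.
  + move=> n f a fc ac fa; apply: model_lift => //; first exact: cube_normal.
    exact: cube_boundary_closed.
Qed.

Theorem theorem1p10 (R : realType) (G H : topologicalGroupType)
    (X : gspace G) (Y : gspace H)
    (hX : hausdorff_space X) (hY : hausdorff_space Y) :
  exists eta : nat_trans (hLan R (op_functor union_functor) (conf_prod_diagram X Y))
                         (conf_diagram (prod_gspace X Y)),
    weak_equivalence R eta.
Proof.
exists (comparison R X Y) => A.
exact: hocolim_base_weak_equivalence.
Qed.
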